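(* Let $V$ be a Probability Vector Field on $\mathcal{P}(\mathbb{R}^n)$ which is support sublinear and locally $\mathcal{W}$-Lipschitz, and let $T>0$. Suppose that for every finite sum of Dirac deltas $\mu\in\mathcal{D}$ the sequence of Lattice Approximate Solutions $\mu^N$ on $[0,T]$ with initial datum $\mu$ converges to a unique limit. Then there exists a unique Lipschitz semigroup $S:[0,T]\times\mathcal{P}_c(\mathbb{R}^n)\to\mathcal{P}_c(\mathbb{R}^n)$ for $\dot\mu=V[\mu]$ whose trajectories are limits of Lattice Approximate Solutions.
   Context: $T\mathbb{R}^n=\mathbb{R}^n\times\mathbb{R}^n$ with points $(x,v)$, $\pi_1(x,v)=x$, $\pi_{13}(x,v,y,w)=(x,y)$. $\mathcal{P}(X)$: Borel probability measures; $\mathcal{P}_c(X)$: those with compact support. $P(\mu,\nu)$ is the set of couplings of $\mu,\nu$; $W$ is the 1-Wasserstein metric on $\mathbb{R}^n$ and $P^{opt}(\mu,\nu)$ the set of couplings minimizing $\int|x-y|\,d\tau$. $B(0,R)$ is the ball of radius $R$ centered at $0$. $\mathcal{D}=\{\sum_{i=1}^N m_i\delta_{x_i}: N\in\mathbb{N},\ m_i>0,\ \sum_i m_i=1,\ x_i\in\mathbb{R}^n\}$. A Probability Vector Field (PVF) is a map $V:\mathcal{P}(\mathbb{R}^n)\to\mathcal{P}(T\mathbb{R}^n)$ with $\pi_1\#V[\mu]=\mu$. It is support sublinear with constant $C>0$ if for every $\mu\in\mathcal{P}_c(\mathbb{R}^n)$: $\sup_{(x,v)\in \mathrm{Supp}(V[\mu])}|v|\le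 C(1+\sup_{x\in \mathrm{Supp}(\mu)}|x|)$. For $V_1,V_2\in\mathcal{P}_c(T\mathbb{R}^n)$ with $\mu_i=\pi_1\#V_i$, $$\mathcal{W}(V_1,V_2)=\inf\Big\{\int|v-w|\,dT(x,v,y,w): T\in P(V_1,V_2),\ \pi_{13}\#T\in P^{opt}(\mu_1,\mu_2)\Big\}.$$ $V$ is locally $\mathcal{W}$-Lipschitz if for every $R>0$ there is $K=K(R)>0$ with $\mathcal{W}(V[\mu],V[\nu])\le K\,W(\mu,\nu)$ whenever $\mathrm{Supp}(\mu),\mathrm{Supp}(\nu)\subset B(0,R)$. Solution: $\mu:[0,T]\to\mathcal{P}(\mathbb{R}^n)$ is a solution to $\dot\mu=V[\mu]$ if for every $f\in C_c^\infty(\mathbb{R}^n)$: $\int_{T\mathbb{R}^n}\nabla f(x)\cdot v\,dV[\mu(s)](x,v)$ is defined for a.e. $s$ and is $L^1$ in $s\in[0,T]$, $t\mapsto\int f\,d\mu(t)$ is absolutely continuous, and for a.e. $t$, $\frac{d}{dt}\int f\,d\mu(t)=\int_{T\mathbb{R}^n}\nabla f(x)\cdot v\,dV[\mu(t)](x,v)$. Lipschitz semigroup for $\dot\mu=V[\mu]$: a map $S:[0,T]\times\mathcal{P}_c(\mathbb{R}^n)\to\mathcal{P}_c(\mathbb{R}^n)$ such that for all $\mu,\nu\in\mathcal{P}_c(\mathbb{R}^n)$ and $t,s\in[0,T]$: (i) $S_0\mu=\mu$ and $S_tS_s\mu=S_{t+s}\mu$ (when $t+s\le T$); (ii) $t\mapsto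 S_t\mu$ is a solution to $\dot\mu=V[\mu]$; (iii) for every $R>0$ there is $C(R)>0$ such that if $\mathrm{Supp}(\mu),\mathrm{Supp}(\nu)\subset B(0,R)$ then $\mathrm{Supp}(S_t\mu)\subset B(0,e^{Ct}(R+1))$ (with $C$ the support-sublinearity constant), $W(S_t\mu,S_t\nu)\le e^{C(R)t}W(\mu,\nu)$, and $W(S_t\mu,S_s\mu)\le C(R)|t-s|$. Lattice Approximate Solutions (LAS) with initial datum $\mu_0\in\mathcal{P}_c(\mathbb{R}^n)$: for $N\in\mathbb{N}$ let $\Delta_N=1/N$, let $x_i$ be the points of $(\mathbb{Z}^n/N^2)\cap[-N,N]^n$ and $v_j$ the points of $(\mathbb{Z}^n/N)\cap[-N,N]^n$. Set $\mu^N_0=\sum_i\mu_0(x_i+[0,N^{-2})^n)\,\delta_{x_i}$. Recursively, given $\mu^N_\ell$ supported on the points $x_i$, put $m_{ij}=V[\mu^N_\ell](\{(x_i,v): v\in v_j+[0,N^{-1})^n\})$ and, for $t\in[0,\Delta_N]$, $\mu^N(\ell\Delta_N+t)=\sum_{i,j}m_{ij}\,\delta_{x_i+t v_j}$, with $\mu^N_{\ell+1}=\mu^N((\ell+1)\Delta_N)$. This is considered for $N$ large enough that all mass stays within the grids on $[0,T]$. Convergence of LASs is meant uniformly on $[0,T]$ for $W$. ''Trajectories are limits of LASs'' means that each $t\mapsto S_t\mu_0$ is a limit of (a subsequence of) the LASs with initial datum $\mu_0$. *)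

(* Defs.v *)
From HB Require Import structures.
From mathcomp Require Import all_boot all_order all_algebra.
From mathcomp Require Import all_classical all_reals all_analysis.
From mathcomp Require Import giry.

Set Implicit Arguments.
Unset Strict Implicit.
Unset Printing Implicit Defensive.

Import Order.TTheory GRing.Theory Num.Theory.
Import numFieldNormedType.Exports.

Local Open Scope classical_set_scope.
Local Open Scope ring_scope.

(* 'rV[R]_n carries the Borel sigma-algebra of its topology.  The product
   sigma-algebra on 'rV[R]_n * 'rV[R]_n is again the Borel one, because
   'rV[R]_n is second countable. *)
HB.instance Definition _ (R : realType) (m n : nat) :=
  Measurable.copy 'M[R]_(m, n) (g_sigma_algebraType (@open 'M[R]_(m, n))).

Notation "''TR[' R ]_ n" := ('rV[R]_n * 'rV[R]_n)%type
  (at level 8, n at level 2, format "''TR[' R ]_ n").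

(* The library norm on 'rV[R]_n is the sup norm; |x| is the Euclidean norm. *)
Definition enorm (R : realType) (n : nat) (x : 'rV[R]_n) : R :=
  Num.sqrt (\sum_(i < n) x 0 i ^+ 2).

Definition eball (R : realType) (n : nat) (r : R) : set 'rV[R]_n :=
  [set x | enorm x < r].

Section projections.
Context (R : realType) (n : nat).

Definition pi1 (z : 'TR[R]_n) : 'rV[R]_n := z.1.

Definition pi13 (z : 'TR[R]_n * 'TR[R]_n) : 'rV[R]_n * 'rV[R]_n :=
  (z.1.1, z.2.1).

Lemma measurable_pi1 : measurable_fun [set: 'TR[R]_n] pi1.
Proof. exact: measurable_fst. Qed.

Lemma measurable_pi13 : measurable_fun [set: 'TR[R]_n * 'TR[R]_n] pi13.
Proof.
apply: measurable_fun_pair.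
- exact: (measurableT_comp measurable_fst measurable_fst).
- exact: (measurableT_comp measurable_fst measurable_snd).
Qed.

HB.instance Definition _ := isMeasurableFun.Build _ _ _ _ pi1 measurable_pi1.
HB.instance Definition _ := isMeasurableFun.Build _ _ _ _ pi13 measurable_pi13.

End projections.

Definition Supp (R : realType) (T : topologicalType) (mu : set T -> \bar R) :
    set T :=
  [set x | forall U : set T, open U -> U x -> (0 < mu U)%E].

Definition compact_supp (R : realType) (T : topologicalType)
    (mu : set T -> \bar R) : Prop :=
  compact (Supp mu).

Definition coupling (R : realType) d1 d2 (T1 : measurableType d1)
    (T2 : measurableType d2) (mu : probability T1 R) (nu : probability T2 R)
    (tau : probability (T1 * T2)%type R) : Prop :=
  (forall A, measurable A -> pushforward tau fst A = mu A) /\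
  (forall B, measurable B -> pushforward tau snd B = nu B).

Section wasserstein.
Context (R : realType) (n : nat).
Local Open Scope ereal_scope.

Definition transport_cost (tau : probability ('rV[R]_n * 'rV[R]_n)%type R) :
    \bar R :=
  \int[tau]_z (enorm (z.1 - z.2)%R)%:E.

Definition W (mu nu : probability 'rV[R]_n R) : \bar R :=
  ereal_inf [set transport_cost tau | tau in coupling mu nu].

Definition optimal_coupling (mu nu : probability 'rV[R]_n R)
    (tau : probability ('rV[R]_n * 'rV[R]_n)%type R) : Prop :=
  coupling mu nu tau /\
  forall tau', coupling mu nu tau' -> transport_cost tau <= transport_cost tau'.

Definition WV (V1 V2 : probability 'TR[R]_n R) : \bar R :=
  ereal_inf [set \int[tau]_z (enorm (z.1.2 - z.2.2)%R)%:E |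
    tau in [set tau : probability ('TR[R]_n * 'TR[R]_n)%type R |
      coupling V1 V2 tau /\
      optimal_coupling (distribution V1 (@pi1 R n)) (distribution V2 (@pi1 R n))
        (distribution tau (@pi13 R n))]].

End wasserstein.

Section pvf.
Context (R : realType) (n : nat).
Local Notation P := (probability 'rV[R]_n R).
Local Notation PT := (probability 'TR[R]_n R).

(* Two probabilities are the same Borel measure when they are related by ≡μ,
   since a library measure is a function on all sets, including the
   non-measurable ones.  A map on Borel measures has to respect ≡μ. *)
Definition is_pvf (V : P -> PT) : Prop :=
  (forall mu nu : P, mu ≡μ nu -> V mu ≡μ V nu) /\
  (forall mu : P, distribution (V mu) (@pi1 R n) ≡μ mu).

Definition support_sublinear (C : R) (V : P -> PT) : Prop :=
  forall mu : P, compact_supp mu ->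
    (ereal_sup [set (enorm z.2)%:E | z in Supp (V mu)] <=
     C%:E * (1 + ereal_sup [set (enorm x)%:E | x in Supp mu]))%E.

Definition locally_WV_lipschitz (V : P -> PT) : Prop :=
  forall r : R, 0 < r -> exists2 K : R, 0 < K &
    forall mu nu : P,
      Supp mu `<=` eball r -> Supp nu `<=` eball r ->
      (WV (V mu) (V nu) <= K%:E * W mu nu)%E.

End pvf.

Section test_functions.
Context (R : realType) (n : nat).

Definition partial (i : 'I_n) (f : 'rV[R]_n -> R) : 'rV[R]_n -> R :=
  fun x => 'D_(delta_mx 0 i) f x.

Definition iter_partial (s : seq 'I_n) (f : 'rV[R]_n -> R) : 'rV[R]_n -> R :=
  foldr partial f s.

Definition smooth (f : 'rV[R]_n -> R) : Prop :=
  forall s : seq 'I_n, continuous (iter_partial s f) /\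
    forall (i : 'I_n) (x : 'rV[R]_n),
      derivable (iter_partial s f) x (delta_mx 0 i).

Definition test_function (f : 'rV[R]_n -> R) : Prop :=
  smooth f /\ compact (closure [set x | f x != 0]).

Definition grad_dot (f : 'rV[R]_n -> R) (z : 'TR[R]_n) : R :=
  \sum_(i < n) partial i f z.1 * z.2 0 i.

End test_functions.

Definition absolutely_continuous (R : realType) (a b : R) (g : R -> R) : Prop :=
  forall e : R, 0 < e -> exists2 d : R, 0 < d &
    forall (k : nat) (u v : 'I_k -> R),
      (forall i, a <= u i /\ u i <= v i /\ v i <= b) ->
      trivIset [set: 'I_k] (fun i => `]u i, v i[%classic) ->
      \sum_(i < k) (v i - u i) < d ->
      \sum_(i < k) `|g (v i) - g (u i)| < e.

(* Curves and semigroups are indexed by all of R; only the times in [0, T]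
   matter. *)
Section solutions.
Context (R : realType) (n : nat).
Local Notation P := (probability 'rV[R]_n R).
Local Notation PT := (probability 'TR[R]_n R).
Local Notation lebesgue := (@lebesgue_measure R).

Definition solution (T : R) (V : P -> PT) (mu : R -> P) : Prop :=
  forall f : 'rV[R]_n -> R, test_function f ->
  [/\ {ae lebesgue, forall s, s \in `[0, T] ->
        (V (mu s)).-integrable setT (fun z => (grad_dot f z)%:E)},
      lebesgue.-integrable `[0, T]
        (fun s => \int[V (mu s)]_z (grad_dot f z)%:E)%E,
      absolutely_continuous 0 T (fun t => \int[mu t]_x f x) &
      {ae lebesgue, forall t, t \in `[0, T] ->
        is_derive t 1 (fun s => \int[mu s]_x f x : R)
          (\int[V (mu t)]_z grad_dot f z)}].

Record lipschitz_semigroup (T : R) (V : P -> PT) (C : R) (S : R -> P -> P) :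
    Prop := LipschitzSemigroup {
  sg_compact : forall (t : R) (mu : P), t \in `[0, T] -> compact_supp mu ->
    compact_supp (S t mu) ;
  sg_zero : forall mu : P, compact_supp mu -> S 0 mu ≡μ mu ;
  sg_add : forall (t s : R) (mu : P), t \in `[0, T] -> s \in `[0, T] ->
    t + s <= T -> compact_supp mu -> S t (S s mu) ≡μ S (t + s) mu ;
  sg_solution : forall mu : P, compact_supp mu ->
    solution T V (fun t => S t mu) ;
  sg_lipschitz : forall r : R, 0 < r -> exists2 Cr : R, 0 < Cr &
    forall (mu nu : P) (t s : R), compact_supp mu -> compact_supp nu ->
      Supp mu `<=` eball r -> Supp nu `<=` eball r ->
      t \in `[0, T] -> s \in `[0, T] ->
      [/\ Supp (S t mu) `<=` eball (expR (C * t) * (r + 1)),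
          (W (S t mu) (S t nu) <= (expR (Cr * t))%:E * W mu nu)%E &
          (W (S t mu) (S s mu) <= (Cr * `|t - s|)%:E)%E] }.

End solutions.

Section lattice_approximate_solutions.
Context (R : realType) (n : nat).
Local Notation P := (probability 'rV[R]_n R).
Local Notation PT := (probability 'TR[R]_n R).

(* Indices of the points of (Z^n / N^p) `&` [-N, N]^n: the coordinate k i
   stands for the integer k i - N^(p+1), in [-N^(p+1), N^(p+1)].  Positions
   use p = 2 and velocities use p = 1. *)
Definition grid_idx (p N : nat) := {ffun 'I_n -> 'I_(N ^ p.+1).*2.+1}.

Definition grid_pt (p N : nat) (k : grid_idx p N) : 'rV[R]_n :=
  \row_i (((k i)%:R - (N ^ p.+1)%:R) / (N ^ p)%:R).

Definition grid_cell (p N : nat) (k : grid_idx p N) : set 'rV[R]_n :=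
  [set y | forall i, grid_pt k 0 i <= y 0 i < grid_pt k 0 i + (N ^ p)%:R^-1].

(* As mu takes values in probability measures, the equations force the grids
   to carry all the mass on [0, T]; no curve is a LAS for an N that is too
   small for that. *)
Definition is_LAS (T : R) (V : P -> PT) (mu0 : P) (N : nat) (mu : R -> P) :
    Prop :=
  (forall A, measurable A ->
     mu 0 A =
     (\sum_(i : grid_idx 2 N) mu0 (grid_cell i) * \d_(grid_pt i) A)%E) /\
  (forall (l : nat) (t : R),
     0 <= t <= N%:R^-1 -> l%:R / N%:R + t <= T ->
     forall A, measurable A ->
     mu (l%:R / N%:R + t) A =
     (\sum_(i : grid_idx 2 N) \sum_(j : grid_idx 1 N)
        V (mu (l%:R / N%:R)%R) ([set grid_pt i] `*` grid_cell j) *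
        \d_(grid_pt i + t *: grid_pt j)%R A)%E).

(* Uniform convergence on [0, T] for W of the LASs of indices phi k. *)
Definition LAS_cvg (T : R) (V : P -> PT) (mu0 : P) (phi : nat -> nat)
    (mu : R -> P) : Prop :=
  forall e : R, 0 < e -> exists k0 : nat, forall k, (k0 <= k)%N ->
    exists2 muN : R -> P, is_LAS T V mu0 (phi k) muN &
      forall t, t \in `[0, T] -> (W (muN t) (mu t) <= e%:E)%E.

Definition LAS_cvg_unique (T : R) (V : P -> PT) (mu0 : P) : Prop :=
  exists2 mu : R -> P, LAS_cvg T V mu0 id mu &
    forall nu, LAS_cvg T V mu0 id nu -> forall t, t \in `[0, T] -> nu t ≡μ mu t.

Definition trajectories_LAS_limits (T : R) (V : P -> PT) (S : R -> P -> P) :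
    Prop :=
  forall mu0 : P, compact_supp mu0 ->
    exists2 phi : nat -> nat, {homo phi : i j / (i < j)%N} &
      LAS_cvg T V mu0 phi (fun t => S t mu0).

Definition finite_dirac_sum (mu : P) : Prop :=
  exists (N : nat) (m : 'I_N -> R) (x : 'I_N -> 'rV[R]_n),
    [/\ (forall i, 0 < m i), \sum_(i < N) m i = 1 &
        forall A, measurable A ->
          mu A = (\sum_(i < N) (m i)%:E * \d_(x i) A)%E].

End lattice_approximate_solutions.

(* Main.v *)
Require Import Defs.
From HB Require Import structures.
From mathcomp Require Import all_boot all_order all_algebra.
From mathcomp Require Import all_classical all_reals all_analysis.
From mathcomp Require Import giry measurable_realfun.
From mathcomp Require Import ring lra.

Set Implicit Arguments.
Unset Strict Implicit.
Unset Printing Implicit Defensive.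

Import Order.TTheory GRing.Theory Num.Theory.
Import numFieldNormedType.Exports.

Local Open Scope classical_set_scope.
Local Open Scope ring_scope.

(** For two initial data in a fixed ball, the couplings provided by the
    Lipschitz bound on WV are optimal between the positions, so one time step of
    length 1/N maps W to at most (1 + K/N) W + O(1/N^2), and the lattice
    approximate solutions mu^N satisfy
    W(mu^N(t), nu^N(t)) <= e^(K t) (W(mu_0, nu_0) + O(1/N)).  Approximating mu_0
    by finite sums of Dirac masses, for which mu^N converges, makes mu^N
    uniformly Cauchy for every mu_0 in P_c; S_t mu_0 is its limit, and it is the
    only possible limit of a subsequence.  The bounds on S are those on mu^N;
    the semigroup law holds because mu^N restarts at the times l/N.  For a test
    function f, with F(mu) and G(mu) the integrals of f for mu and of grad f . v
    for V[mu], Taylor expansion of f along mu^N gives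
    |F(S_h nu) - F(nu) - h G(nu)| <= A h^2 with A uniform on balls, and as G is
    Lipschitz for W, t |-> F(S_t mu) has derivative G(S_t mu).

    A Cauchy sequence of measures is realised by random variables on [0, 1]:
    with X_k of law mu_k, finitely valued, and a coupling of mu_k and mu_(k+1),
    splitting each level set of X_k into pieces of the prescribed masses gives
    X_(k+1), and X_k converges in L^1. *)

(** * Euclidean norm and Borel sets of row vectors *)

(** The obstacle is the triangle inequality for [W], which usually rests on disintegration. It is
    proved here when the middle measure is concentrated on a ball: rounding to a lattice then gives
    it finite support, and couplings are glued atom by atom. Hence the estimates carry a radius
    ([conc r]), and the radii have to be uniform in $N$: [Rmax] bounds all lattice solutions on
    $[0,T]$, and restarting from a point of a trajectory leads to [Rmax] of [Rmax]. A single
    recursion governs both the growth of the supports (with $K = C$) and the stability in the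
    initial datum (with $K$ the Lipschitz constant of $V$), so [growth] serves twice. The
    convergence hypothesis speaks of curves that satisfy [is_LAS], the estimates of the explicit
    curve [Lcan], defined for every $N$. They meet for large $N$, where [Lcan] satisfies [is_LAS]
    and [is_LAS] determines a curve up to [≡μ]. Equality of measures is always [≡μ], and it is
    recovered from arbitrarily small values of [W]. *)

Section euclidean_norm.
Context (R : realType) (n : nat).
Implicit Types x y : 'rV[R]_n.

Lemma sum_sqr_ge0 x : 0 <= \sum_(i < n) x 0 i ^+ 2.
Proof. by apply: sumr_ge0 => i _; exact: sqr_ge0. Qed.

Lemma enorm_ge0 x : 0 <= enorm x.
Proof. exact: sqrtr_ge0. Qed.

Lemma sqr_enorm x : enorm x ^+ 2 = \sum_(i < n) x 0 i ^+ 2.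
Proof. by rewrite sqr_sqrtr// sum_sqr_ge0. Qed.

Lemma enorm0 : enorm (0 : 'rV[R]_n) = 0.
Proof. by rewrite /enorm big1 ?sqrtr0// => i _; rewrite mxE expr0n. Qed.

Lemma enormZ a x : enorm (a *: x) = `|a| * enorm x.
Proof.
rewrite /enorm -sqrtr_sqr -sqrtrM ?sqr_ge0//; congr Num.sqrt.
by rewrite mulr_sumr; apply: eq_bigr => i _; rewrite mxE exprMn.
Qed.

Lemma enormN x : enorm (- x) = enorm x.
Proof. by rewrite -scaleN1r enormZ normrN1 mul1r. Qed.

Lemma enormBC x y : enorm (x - y) = enorm (y - x).
Proof. by rewrite -enormN opprB. Qed.

Lemma coord_le_enorm x i : `|x 0 i| <= enorm x.
Proof.
rewrite -sqrtr_sqr /enorm ler_wsqrtr// (bigD1 i)//= lerDl.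
by apply: sumr_ge0 => j _; exact: sqr_ge0.
Qed.

Lemma cauchy_schwarz_sum x y :
  \sum_(i < n) x 0 i * y 0 i <= enorm x * enorm y.
Proof.
rewrite (le_trans (ler_norm _))// -sqrtr_sqr /enorm.
rewrite -sqrtrM ?sum_sqr_ge0// ler_wsqrtr//.
set a := \sum_i _ ^+ 2; set b := \sum_i _ ^+ 2; set c := \sum_i _.
(* Lagrange's identity: the squares of the $2 \times 2$ minors sum to $2(ab - c^2)$, so $c^2 \le
   ab$. *)
have : 0 <= \sum_(i < n) \sum_(j < n) (x 0 i * y 0 j - x 0 j * y 0 i) ^+ 2.
  by apply: sumr_ge0 => i _; apply: sumr_ge0 => j _; exact: sqr_ge0.
have -> : \sum_(i < n) \sum_(j < n) (x 0 i * y 0 j - x 0 j * y 0 i) ^+ 2 =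
    a * b + b * a - 2 * (c * c).
  rewrite /a /b /c !mulr_suml mulr_sumr -sumrN -!big_split/=.
  apply: eq_bigr => i _; rewrite !mulr_sumr -sumrN -!big_split/=.
  by apply: eq_bigr => j _; ring.
rewrite expr2; lra.
Qed.

Lemma enorm_triangle x y : enorm (x + y) <= enorm x + enorm y.
Proof.
rewrite -(@ler_pXn2r _ 2)// ?nnegrE ?addr_ge0 ?enorm_ge0//.
have -> : (enorm x + enorm y) ^+ 2 =
  enorm x ^+ 2 + enorm y ^+ 2 + 2 * (enorm x * enorm y) by ring.
rewrite !sqr_enorm.
have := cauchy_schwarz_sum x y.
have -> : \sum_(i < n) (x + y) 0 i ^+ 2 = \sum_(i < n) x 0 i ^+ 2 +
   \sum_(i < n) y 0 i ^+ 2 + 2 * \sum_(i < n) x 0 i * y 0 i.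
  rewrite mulr_sumr -!big_split/=.
  by apply: eq_bigr => i _; rewrite mxE; ring.
lra.
Qed.

Lemma enorm_le_sum x : enorm x <= \sum_(i < n) `|x 0 i|.
Proof.
rewrite [X in enorm X]row_sum_delta.
elim/big_ind2 : _ => [|a b c d ab cd|i _].
- by rewrite enorm0.
- by rewrite (le_trans (enorm_triangle _ _))// lerD.
- rewrite enormZ (_ : enorm _ = 1) ?mulr1//.
  rewrite /enorm (bigD1 i)//= big1 ?addr0; first by rewrite mxE !eqxx expr1n sqrtr1.
  by move=> j ji; rewrite mxE (negbTE ji) andbF expr0n.
Qed.

Lemma enorm_le_bound x e : 0 <= e -> (forall i, `|x 0 i| <= e) ->
  enorm x <= n%:R * e.
Proof.
move=> e0 xe; rewrite (le_trans (enorm_le_sum x))//.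
rewrite (le_trans (ler_sum _ (fun i _ => xe i)))//.
by rewrite sumr_const card_ord mulr_natl.
Qed.

Lemma enorm_sub_triangle x y z : enorm (x - z) <= enorm (x - y) + enorm (y - z).
Proof. by rewrite (_ : x - z = (x - y) + (y - z)) ?enorm_triangle// addrA subrK. Qed.

Lemma enorm_continuous : continuous (@enorm R n).
Proof.
move=> x; apply: continuous_comp; last exact: sqrt_continuous.
apply: (continuous_big (op := +%R) (x0 := 0) (P := xpredT)) => [|i _ y].
  exact: add_continuous.
by apply: (@continuous_comp _ _ _ (fun x : 'rV[R]_n => x 0 i) (fun y : R => y ^+ 2));
  [exact: coord_continuous|exact: exprn_continuous].
Qed.

Lemma open_enorm_gt (r : R) : open [set x : 'rV[R]_n | r < enorm x].
Proof. by have := open_comp (fun x _ => @enorm_continuous x) (@open_gt R r). Qed.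

Lemma open_enorm_lt (r : R) : open [set x : 'rV[R]_n | enorm x < r].
Proof. by have := open_comp (fun x _ => @enorm_continuous x) (@open_lt R r). Qed.

End euclidean_norm.

Section row_measurability.
Context (R : realType) (n : nat).

Lemma open_measurable_row (U : set 'rV[R]_n) : open U -> measurable U.
Proof. by move=> oU; exact: sub_sigma_algebra. Qed.

Lemma measurable_continuous_row (f : 'rV[R]_n -> R) :
  continuous f -> measurable_fun [set: 'rV[R]_n] f.
Proof.
move=> cf; apply: (measurability _ (RGenOInfty.measurableE R)).
move=> _ [_ [x ->] <-]; rewrite setTI; apply: open_measurable_row.
by apply: open_comp => // y _; exact: cf.
Qed.

Lemma measurable_coord (i : 'I_n) :
  measurable_fun [set: 'rV[R]_n] (fun x : 'rV[R]_n => x 0 i).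
Proof. by apply: measurable_continuous_row => x; exact: coord_continuous. Qed.

Lemma measurable_enorm : measurable_fun [set: 'rV[R]_n] (@enorm R n).
Proof. exact: measurable_continuous_row (@enorm_continuous R n). Qed.

(* Rational boxes form a countable base. *)
Definition rbox (q : 'rV[rat]_n * nat) : set 'rV[R]_n :=
  [set y | forall i, `|y 0 i - ratr (q.1 0 i)| < q.2.+1%:R^-1].

Lemma rbox_base (U : set 'rV[R]_n) x : open U -> U x ->
  exists2 q, rbox q x & rbox q `<=` U.
Proof.
move=> oU Ux.
have /nbhs_ballP[e /= e0 eU] : nbhs x U by exact: open_nbhs_nbhs.
pose k := Num.truncn (2 / e).
have ke : k.+1%:R^-1 < e / 2 :> R.
  rewrite -[e / 2]invrK ltf_pV2 ?posrE ?invr_gt0 ?divr_gt0//.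
  by rewrite invf_div truncnS_gt.
have ex (i : 'I_n) : exists q : rat, `|x 0 i - ratr q| < k.+1%:R^-1.
  have : x 0 i - k.+1%:R^-1 < x 0 i + k.+1%:R^-1.
    by rewrite ltrD2l gtrN// invr_gt0.
  move=> /rat_in_itvoo[q]; rewrite in_itv/= => /andP[h1 h2].
  by exists q; rewrite distrC ltr_distl h1 h2.
have [q qP] := choice ex.
exists (\row_i q i, k) => [i/=|y /= yb]; first by rewrite mxE.
apply: eU; split => // i j; rewrite (ord1 i) /ball/=.
have := yb j; rewrite mxE => yj; have xj := qP j.
rewrite (_ : x 0 j - y 0 j = (x 0 j - ratr (q j)) - (y 0 j - ratr (q j))); last ring.
rewrite (le_lt_trans (ler_normB _ _))// (splitr e) ltrD// (lt_trans _ ke)//.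
Qed.

Lemma measurable_lt_set d (Om : measurableType d) (f g : Om -> R) :
  measurable_fun setT f -> measurable_fun setT g ->
  measurable [set w | f w < g w].
Proof.
move=> mf mg; rewrite -[X in measurable X]setTI.
exact: (measurable_fun_ltr mf mg measurableT (_ : measurable [set true])).
Qed.

Lemma measurable_le_set d (Om : measurableType d) (f g : Om -> R) :
  measurable_fun setT f -> measurable_fun setT g ->
  measurable [set w | f w <= g w].
Proof.
move=> mf mg; rewrite -[X in measurable X]setTI.
exact: (measurable_fun_ler mf mg measurableT (_ : measurable [set true])).
Qed.

(** An open set is a countable union of rational boxes, and the preimage of a box is a finite
    intersection of conditions on single coordinates. *)
Lemma measurable_row d (Om : measurableType d) (f : Om -> 'rV[R]_n) :
  (forall i, measurable_fun setT (fun w => f w 0 i)) -> measurable_fun setT f.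
Proof.
move=> mf; apply: (measurability (@open 'rV[R]_n)) => //.
move=> _ [U oU <-]; rewrite setTI.
rewrite (_ : f @^-1` U =
   \bigcup_q (f @^-1` rbox q `&` [set _ | rbox q `<=` U])); last first.
  apply/seteqP; split=> [w /= Ufw|w [q _ [/= qf]]]; last exact.
  by have [q qf qU] := rbox_base oU Ufw; exists q.
apply: countable_bigcupT_measurable => // q.
have [qU|qU] := pselect (rbox q `<=` U); last first.
  by rewrite (_ : _ `&` _ = set0)//; apply/seteqP; split=> // w [].
rewrite (_ : _ `&` _ = f @^-1` rbox q); last by apply/seteqP; split=> // w [].
rewrite (_ : f @^-1` rbox q = \bigcap_(i in [set: 'I_n])
    [set w | `|f w 0 i - ratr (q.1 0 i)| < q.2.+1%:R^-1]); last first.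
  by apply/seteqP; split=> [w h i _|w h i]; exact: h.
apply: fin_bigcap_measurable => // i _.
apply: measurable_lt_set => //.
apply: measurableT_comp => //; exact: measurable_funB.
Qed.
End row_measurability.

(** * Supports *)

Section null_sets.
Context d (T : measurableType d) (R : realType) (mu : {measure set T -> \bar R}).

Lemma null_subset (A B : set T) : measurable A -> measurable B ->
  A `<=` B -> mu B = 0%E -> mu A = 0%E.
Proof.
move=> mA mB AB B0; apply/eqP; rewrite eq_le measure_ge0 andbT -B0.
by apply: le_measure => //; rewrite inE.
Qed.

(* Lindelof: a set covered by null members of a countable family is null. *)
Lemma null_cover (I : countType) (B : I -> set T) (U : set T) :
  measurable U -> (forall i, measurable (B i)) ->
  (forall x, U x -> exists2 i, B i x & mu (B i) = 0%E) -> mu U = 0%E.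
Proof.
move=> mU mB UB.
pose F k := if unpickle k is Some i then
  (if mu (B i) == 0%E then B i else set0) else set0.
have F0 k : mu.-negligible (F k).
  rewrite /F; case: (unpickle k) => [i|]; last exact: negligible_set0.
  case: ifPn => [/eqP Bi|_]; last exact: negligible_set0.
  by exists (B i); split.
have /negligibleP : mu.-negligible U.
  apply: negligibleS (negligible_bigcup F0) => x /UB[i Bix Bi0].
  by exists (pickle i) => //; rewrite /F pickleK Bi0 eqxx.
exact.
Qed.

End null_sets.

Section supports.
Context (R : realType) (n : nat).
Local Notation P := (probability 'rV[R]_n R).
Local Notation PT := (probability 'TR[R]_n R).

Lemma measurable_rbox (q : 'rV[rat]_n * nat) : measurable (@rbox R n q).
Proof.
rewrite (_ : rbox q = \bigcap_(i in [set: 'I_n])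
    [set w : 'rV[R]_n | `|w 0 i - ratr (q.1 0 i)| < q.2.+1%:R^-1]); last first.
  by apply/seteqP; split=> [w h i _|w h i]; exact: h.
apply: fin_bigcap_measurable => // i _; apply: measurable_lt_set => //.
by apply: measurableT_comp => //; apply: measurable_funB => //; exact: measurable_coord.
Qed.

Lemma rbox_base_TR (U : set 'TR[R]_n) z : open U -> U z ->
  exists2 q, (@rbox R n q.1 `*` rbox q.2) z & rbox q.1 `*` rbox q.2 `<=` U.
Proof.
move=> oU Uz; have : nbhs z U by exact: open_nbhs_nbhs.
move=> [[A B] /= [zA zB] ABU].
have := nbhs_interior zA => /nbhs_singleton /(rbox_base (@open_interior _ A))[q1 q1z q1A].
have := nbhs_interior zB => /nbhs_singleton /(rbox_base (@open_interior _ B))[q2 q2z q2B].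
exists (q1, q2); first by split.
move=> w [/= w1 w2]; apply: ABU; split; apply: interior_subset.
- exact: q1A.
- exact: q2B.
Qed.

(** The sigma-algebra on the product is generated by rectangles; an open set is a countable union of
    products of rational boxes. *)
Lemma open_measurable_TR (U : set 'TR[R]_n) : open U -> measurable U.
Proof.
move=> oU; rewrite (_ : U = \bigcup_q (rbox q.1 `*` rbox q.2 `&`
    [set _ | @rbox R n q.1 `*` rbox q.2 `<=` U])); last first.
  apply/seteqP; split=> [w /= Uw|w [q _ [/= qw]]]; last exact.
  by have [q qf qU] := rbox_base_TR oU Uw; exists q.
apply: countable_bigcupT_measurable => // q.
have [qU|qU] := pselect (@rbox R n q.1 `*` rbox q.2 `<=` U); last first.
  by rewrite (_ : _ `&` _ = set0)//; apply/seteqP; split=> // w [].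
rewrite (_ : _ `&` _ = rbox q.1 `*` rbox q.2); last by apply/seteqP; split=> // w [].
by apply: measurableX; exact: measurable_rbox.
Qed.

(** A point outside the support has a null open neighbourhood, hence lies in a null rational box,
    and there are countably many boxes. *)
Lemma Supp_null (mu : P) (U : set 'rV[R]_n) : open U ->
  (forall x, U x -> ~ Supp mu x) -> mu U = 0%E.
Proof.
move=> oU US; apply: (@null_cover _ _ _ _ _ (@rbox R n)) => [||x /US].
- exact: open_measurable_row.
- exact: measurable_rbox.
- move=> /existsNP[G /not_implyP[oG /not_implyP[Gx /negP]]].
  rewrite -leNgt => G0; have [q qx qG] := rbox_base oG Gx; exists q => //.
  apply: (null_subset _ _ qG); [exact: measurable_rbox|exact: open_measurable_row|].
  by apply/eqP; rewrite eq_le G0 measure_ge0.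
Qed.

Lemma Supp_null_TR (mu : PT) (U : set 'TR[R]_n) : open U ->
  (forall x, U x -> ~ Supp mu x) -> mu U = 0%E.
Proof.
move=> oU US; apply: (@null_cover _ _ _ _ _
  (fun q => @rbox R n q.1 `*` @rbox R n q.2)) => [|q|x /US].
- exact: open_measurable_TR.
- by apply: measurableX; exact: measurable_rbox.
- move=> /existsNP[G /not_implyP[oG /not_implyP[Gx /negP]]].
  rewrite -leNgt => G0; have [q qx qG] := rbox_base_TR oG Gx; exists q => //.
  apply: (null_subset _ _ qG).
  + by apply: measurableX; exact: measurable_rbox.
  + exact: open_measurable_TR.
  + by apply/eqP; rewrite eq_le G0 measure_ge0.
Qed.

(** Stands for the inclusion of the support in the closed ball of radius [r], to which it is
    equivalent ([Supp_conc], [conc_Supp]). As the measure of one Borel set it respects [≡μ] and is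
    easily followed through pushforwards and limits for [W]. *)
Definition conc (r : R) (mu : P) := mu [set x | r < enorm x] = 0%E.

Lemma measurable_enorm_gt (r : R) : measurable [set x : 'rV[R]_n | r < enorm x].
Proof. by apply: open_measurable_row; exact: open_enorm_gt. Qed.

Lemma conc_le (r s : R) (mu : P) : r <= s -> conc r mu -> conc s mu.
Proof.
move=> rs cr; apply: (null_subset _ _ _ cr).
- exact: measurable_enorm_gt.
- exact: measurable_enorm_gt.
- by move=> x; exact: le_lt_trans.
Qed.

Lemma conc_ge0 r (mu : P) : conc r mu -> 0 <= r.
Proof.
move=> cr; rewrite leNgt; apply/negP => r0.
have : mu setT = 0%E.
  rewrite (_ : setT = [set x | r < enorm x]) ?cr//.
  by apply/seteqP; split=> // x _ /=; rewrite (lt_le_trans r0)// enorm_ge0.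
by rewrite probability_setT => /eqP; rewrite onee_eq0.
Qed.

Lemma conc_eqm (r : R) (mu nu : P) : mu ≡μ nu -> conc r mu -> conc r nu.
Proof. by move=> mn; rewrite /conc mn//; exact: measurable_enorm_gt. Qed.

Lemma Supp_conc (r : R) (mu : P) : Supp mu `<=` [set x | enorm x <= r] -> conc r mu.
Proof.
move=> Sr; apply: Supp_null; first exact: open_enorm_gt.
by move=> x /= rx /Sr/=; rewrite leNgt rx.
Qed.

Lemma conc_Supp (r : R) (mu : P) : conc r mu -> Supp mu `<=` [set x | enorm x <= r].
Proof.
move=> cr x Sx /=; rewrite leNgt; apply/negP => rx.
by have := Sx _ (@open_enorm_gt R n r) rx; rewrite cr ltxx.
Qed.

Lemma Supp_eball_conc (r : R) (mu : P) : Supp mu `<=` eball r -> conc r mu.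
Proof. by move=> h; apply: Supp_conc => x /h /ltW. Qed.

Lemma conc_Supp_eball (r s : R) (mu : P) : r < s -> conc r mu -> Supp mu `<=` eball s.
Proof. by move=> rs /conc_Supp h x /h /= h'; exact: le_lt_trans rs. Qed.

Lemma closed_Supp (T : topologicalType) (mu : set T -> \bar R) : closed (Supp mu).
Proof.
rewrite -[X in closed X]setCK closedC openE => x.
move=> /existsNP[G /not_implyP[oG /not_implyP[Gx G0]]].
by apply: filterS (open_nbhs_nbhs (conj oG Gx)) => y Gy Sy; exact/G0/Sy.
Qed.

Lemma row_normE (x : 'rV[R]_n) : `|x| = \big[Num.max/0]_ij `|x ij.1 ij.2|.
Proof. exact: mx_normrE. Qed.

Lemma conc_compact (r : R) (mu : P) : conc r mu -> compact_supp mu.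
Proof.
move=> cr; apply: bounded_closed_compact; last exact: closed_Supp.
exists (Num.max r 0); split; first by rewrite num_real.
move=> M rM x /(conc_Supp cr)/= xr.
rewrite row_normE; apply/bigmax_leP; split.
  by rewrite (le_trans _ (ltW rM))// le_max lexx orbT.
move=> [i j] _ /=; rewrite (ord1 i) (le_trans (coord_le_enorm _ _))//.
by rewrite (le_trans xr)// (le_trans _ (ltW rM))// le_max lexx.
Qed.

Lemma compact_conc (mu : P) : compact_supp mu -> exists2 r, 0 < r & conc r mu.
Proof.
move=> /compact_bounded[M [_ MS]].
(* The bound [M] is for the sup norm, whence the factor $n$. Inside, [+ 1] gives a number strictly
   above [M]; outside, it keeps the radius positive even for $n = 0$. *)
exists (n%:R * (`|M| + 1) + 1); first by rewrite ltr_wpDl// mulr_ge0// addr_ge0.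
apply: Supp_conc => x Sx /=; rewrite ler_wpDr//.
apply: enorm_le_bound; first by rewrite addr_ge0.
have := MS (`|M| + 1) _ _ Sx; rewrite ltr_pwDr// ?ler_norm// => /(_ isT) xM i.
rewrite (le_trans _ xM)// row_normE.
by apply/bigmax_geP; right; exists (0, i).
Qed.

(** Support sublinearity enters the estimates in this form: the open set of too large velocities
    misses the support, so it is null. *)
Lemma sublinear_null (C : R) (V : P -> PT) (r : R) (mu : P) : 0 <= C ->
  support_sublinear C V -> conc r mu ->
  V mu [set z | C * (1 + r) < enorm z.2] = 0%E.
Proof.
move=> C0 sV cr; apply: Supp_null_TR.
  apply: (@open_comp _ _ snd [set x : 'rV[R]_n | C * (1 + r) < enorm x]).
    by move=> z _; exact: cvg_snd.
  exact: open_enorm_gt.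
move=> z /= rz Sz; move: rz; apply/negP; rewrite -leNgt -lee_fin.
apply: le_trans (le_trans (sV mu (conc_compact cr)) _).
  by apply: ereal_sup_ubound; exists z.
rewrite EFinM EFinD lee_wpmul2l// leeD2l//.
by apply: ge_ereal_sup => _ [x /(conc_Supp cr)/= xr <-]; rewrite lee_fin.
Qed.

End supports.

(** * Laws of random variables and integral inequalities *)

Section laws.
Context d d' (Om : measurableType d) (T : measurableType d') (R : realType).

Definition law (P : probability Om R) (f : Om -> T) (mf : measurable_fun setT f) :
    probability T R :=
  distribution P (HB.pack_for {mfun Om >-> T} f (isMeasurableFun.Build _ _ _ _ f mf)).

Lemma lawE (P : probability Om R) (f : Om -> T) (mf : measurable_fun setT f) A :
  law P mf A = P (f @^-1` A).
Proof. by []. Qed.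

Lemma integral_has_law (P : probability Om R) (mu : probability T R) (X : Om -> T)
    (f : T -> \bar R) :
  measurable_fun setT X -> measurable_fun setT f -> (forall y, 0 <= f y)%E ->
  (forall A, measurable A -> P (X @^-1` A) = mu A) ->
  (\int[mu]_y f y = \int[P]_x f (X x))%E.
Proof.
move=> mX mf f0 XP.
rewrite (@eq_measure_integral _ _ _ _ (law P mX)) => [|A mA _]; last exact: esym (XP _ mA).
by rewrite ge0_integral_distribution.
Qed.

End laws.

Section probability_integrals.
Context d (Om : measurableType d) (R : realType) (P : probability Om R).
Local Open Scope ereal_scope.

Lemma ae_not_null (N : set Om) (Q : Om -> Prop) : measurable N -> P N = 0 ->
  (forall w, ~ N w -> Q w) -> {ae P, forall w, Q w}.
Proof.
move=> mN N0 NQ; exists N; split => // w /= nQ.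
by apply: contrapT => /NQ.
Qed.

(** The common form of the cost estimates: a pointwise affine bound off a null set is integrated in
    the extended reals, so that no integrability has to be checked. *)
Lemma integral_affine_le (f g h : Om -> R) (a b c : R) (N : set Om) :
  measurable N -> P N = 0 ->
  measurable_fun setT f -> measurable_fun setT g -> measurable_fun setT h ->
  (forall w, 0 <= f w)%R -> (forall w, 0 <= g w)%R -> (forall w, 0 <= h w)%R ->
  (0 <= a)%R -> (0 <= b)%R -> (0 <= c)%R ->
  (forall w, ~ N w -> f w <= a * g w + b * h w + c)%R ->
  \int[P]_w (f w)%:E <=
    a%:E * \int[P]_w (g w)%:E + b%:E * \int[P]_w (h w)%:E + c%:E.
Proof.
move=> mN N0 mf mg mh f0 g0 h0 a0 b0 c0 fgh.
have mag : measurable_fun setT (fun w => a%:E * (g w)%:E).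
  by apply/measurable_funeM/measurable_EFinP.
have mbh : measurable_fun setT (fun w => b%:E * (h w)%:E).
  by apply/measurable_funeM/measurable_EFinP.
apply: (@le_trans _ _ (\int[P]_w (a%:E * (g w)%:E + b%:E * (h w)%:E + c%:E))).
  apply: ae_ge0_le_integral => //.
  - by move=> w _; rewrite lee_fin.
  - exact/measurable_EFinP.
  - by move=> w _; rewrite !adde_ge0// ?mule_ge0 ?lee_fin.
  - by apply: emeasurable_funD => //; exact: emeasurable_funD.
  - by apply: (ae_not_null mN N0) => w /fgh fw _; rewrite -!EFinM -!EFinD lee_fin.
rewrite ge0_integralD//=; last 2 first.
  - by move=> w _; rewrite adde_ge0// mule_ge0 ?lee_fin.
  - exact: emeasurable_funD.
rewrite ge0_integralD//=; last 2 first.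
  - by move=> w _; rewrite mule_ge0 ?lee_fin.
  - by move=> w _; rewrite mule_ge0 ?lee_fin.
rewrite !ge0_integralZl_EFin//=; last 4 first.
  - by move=> w _; rewrite lee_fin.
  - exact/measurable_EFinP.
  - by move=> w _; rewrite lee_fin.
  - exact/measurable_EFinP.
by rewrite integral_cst//= probability_setT mule1.
Qed.

Lemma integral_const_le (f : Om -> R) (c : R) (N : set Om) :
  measurable N -> P N = 0 -> measurable_fun setT f ->
  (forall w, 0 <= f w)%R -> (0 <= c)%R -> (forall w, ~ N w -> f w <= c)%R ->
  \int[P]_w (f w)%:E <= c%:E.
Proof.
move=> mN N0 mf f0 c0 fc.
rewrite (le_trans (@integral_affine_le f (cst 0%R) (cst 0%R) 0 0 c N _ _ _ _ _ _ _ _ _ _ _ _))//.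
  by move=> w /fc; rewrite !mul0r !add0r.
by rewrite !mul0e !add0e.
Qed.

Lemma markov_measure (f : Om -> R) (c : R) :
  measurable_fun setT f -> (forall w, 0 <= f w)%R -> (0 < c)%R ->
  P [set w | c <= f w]%R <= \int[P]_w (f w)%:E * (c^-1)%:E.
Proof.
move=> mf f0 c0.
have mS : measurable [set w | c <= f w]%R.
  by apply: measurable_le_set => //; exact: measurable_cst.
rewrite lee_pdivlMr//.
have -> : P [set w | c <= f w]%R * c%:E = \int[P]_(w in [set w | c <= f w]%R) c%:E.
  by rewrite integral_cst// muleC.
apply: (@le_trans _ _ (\int[P]_(w in [set w | c <= f w]%R) (f w)%:E)).
  apply: ge0_le_integral => //.
  - by move=> w _; rewrite lee_fin ltW.
  - exact/measurable_EFinP/measurable_funTS.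
apply: ge0_subset_integral => //.
- exact/measurable_EFinP.
- by move=> w _; rewrite lee_fin.
Qed.

End probability_integrals.

(** * The Wasserstein distance *)

Section wasserstein_basics.
Context (R : realType) (n : nat).
Local Notation rV := 'rV[R]_n.
Local Notation P := (probability 'rV[R]_n R).

Lemma measurable_rowB d (Om : measurableType d) (X Y : Om -> rV) :
  measurable_fun setT X -> measurable_fun setT Y ->
  measurable_fun setT (fun w => X w - Y w).
Proof.
move=> mX mY; apply: measurable_row => i.
rewrite (_ : (fun w => _) = (fun w => X w 0 i - Y w 0 i)); last first.
  by apply/funext => w; rewrite !mxE.
by apply: measurable_funB; apply: (measurableT_comp (measurable_coord i)).
Qed.

Lemma measurable_rowD d (Om : measurableType d) (X Y : Om -> rV) :
  measurable_fun setT X -> measurable_fun setT Y ->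
  measurable_fun setT (fun w => X w + Y w).
Proof.
move=> mX mY; apply: measurable_row => i.
rewrite (_ : (fun w => _) = (fun w => X w 0 i + Y w 0 i)); last first.
  by apply/funext => w; rewrite !mxE.
by apply: measurable_funD; apply: (measurableT_comp (measurable_coord i)).
Qed.

Lemma measurable_rowZ d (Om : measurableType d) (t : R) (X : Om -> rV) :
  measurable_fun setT X -> measurable_fun setT (fun w => t *: X w).
Proof.
move=> mX; apply: measurable_row => i.
rewrite (_ : (fun w => _) = (fun w => t * X w 0 i)); last first.
  by apply/funext => w; rewrite !mxE.
by apply: measurable_funM => //; apply: (measurableT_comp (measurable_coord i)).
Qed.

Lemma measurable_dist d (Om : measurableType d) (X Y : Om -> rV) :
  measurable_fun setT X -> measurable_fun setT Y ->
  measurable_fun setT (fun w => enorm (X w - Y w)).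
Proof.
by move=> mX mY; apply: (measurableT_comp (@measurable_enorm R n)); exact: measurable_rowB.
Qed.

Local Open Scope ereal_scope.

(** The law of the pair $(X, Y)$ is a coupling. *)
Lemma W_le_integral d (Om : measurableType d) (Q : probability Om R)
    (X Y : Om -> rV) (mu nu : P) :
  measurable_fun setT X -> measurable_fun setT Y ->
  (forall A, measurable A -> Q (X @^-1` A) = mu A) ->
  (forall A, measurable A -> Q (Y @^-1` A) = nu A) ->
  W mu nu <= \int[Q]_w (enorm (X w - Y w)%R)%:E.
Proof.
move=> mX mY lX lY; have mXY := measurable_fun_pair mX mY.
apply: ereal_inf_lbound; exists (law Q mXY).
  by split=> A mA; rewrite ?(lX, lY) -?lX -?lY.
rewrite /transport_cost (@integral_has_law _ _ _ _ _ Q (law Q mXY) _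
  (fun z : rV * rV => (enorm (z.1 - z.2)%R)%:E) mXY)//.
  by apply/measurable_EFinP; exact: measurable_dist.
by move=> z; rewrite lee_fin enorm_ge0.
Qed.

Lemma W_ge0 (mu nu : P) : 0 <= W mu nu.
Proof.
apply: le_ereal_inf_tmp => _ [tau _ <-].
by apply: integral_ge0 => z _; rewrite lee_fin enorm_ge0.
Qed.

Lemma W_lt_coupling (mu nu : P) (a : \bar R) : W mu nu < a ->
  exists2 tau, coupling mu nu tau & transport_cost tau < a.
Proof. by move=> /ereal_inf_lt[_ [tau ctau <-] ta]; exists tau. Qed.

Lemma W_le_coupling (mu nu : P) (a e : R) : W mu nu <= a%:E -> (0 < e)%R ->
  exists2 tau, coupling mu nu tau & transport_cost tau <= (a + e)%:E.
Proof.
move=> Wa e0; have /W_lt_coupling[tau ct lt] : W mu nu < (a + e)%:E.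
  by rewrite (le_lt_trans Wa)// lte_fin ltrDl.
by exists tau => //; exact: ltW.
Qed.

Lemma W_eqm (mu mu' nu nu' : P) : mu ≡μ mu' -> nu ≡μ nu' -> W mu nu = W mu' nu'.
Proof.
move=> mE nE; rewrite /W; congr (ereal_inf (image _ _)).
by apply/seteqP; split=> tau [c1 c2]; split=> A mA; rewrite ?c1 ?c2// ?mE ?nE.
Qed.

Lemma W_refl (mu nu : P) : mu ≡μ nu -> W mu nu = 0.
Proof.
move=> mn; apply/eqP; rewrite eq_le W_ge0 andbT.
rewrite (le_trans (@W_le_integral _ _ mu id id mu nu _ _ _ _))//.
rewrite integral0_eq// => x _; by rewrite subrr enorm0.
Qed.

Lemma W_sym (mu nu : P) : W mu nu = W nu mu.
Proof.
wlog suff : mu nu / W nu mu <= W mu nu.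
  by move=> h; apply/eqP; rewrite eq_le !h.
apply: le_ereal_inf_tmp => _ [tau [c1 c2] <-].
rewrite (le_trans (@W_le_integral _ _ tau snd fst nu mu _ _ _ _))//.
by rewrite le_eqVlt; apply/orP; left; apply/eqP; apply: eq_integral => z _; rewrite enormBC.
Qed.

(** Under a nearly optimal coupling, pairs at distance at least [c] have mass about [e / c] by
    Markov's inequality; all other pairs that start in [A] end in [B]. *)
Lemma W_markov (mu nu : P) (e c : R) (A B : set rV) :
  W mu nu <= e%:E -> (0 < c)%R -> measurable A -> measurable B ->
  (forall x y, A x -> (enorm (x - y) < c)%R -> B y) ->
  mu A <= nu B + (e / c)%:E.
Proof.
move=> We c0 mA mB AB; apply/lee_addgt0Pr => h h0.
(* The slack $hc$ in the cost becomes $h$ after the division by $c$. *)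
have [tau [c1 c2] ct] := W_le_coupling We (mulr_gt0 h0 c0).
have mS : measurable [set z : rV * rV | c <= enorm (z.1 - z.2)]%R.
  by apply: measurable_le_set => //; exact: measurable_dist.
have mA' : measurable (fst @^-1` A : set (rV * rV)).
  by rewrite -[X in measurable X]setTI; exact: measurable_fst.
have mB' : measurable (snd @^-1` B : set (rV * rV)).
  by rewrite -[X in measurable X]setTI; exact: measurable_snd.
rewrite -(c1 A mA) -(c2 B mB) /pushforward.
apply: (@le_trans _ _ (tau (snd @^-1` B `|` [set z : rV * rV | c <= enorm (z.1 - z.2)]%R))).
  apply: le_measure; rewrite ?inE//; first exact: measurableU.
  move=> [x y] /= Ax; have [cz|cz] := leP c (enorm (x - y)); first by right.
  by left; exact: AB cz.
rewrite (le_trans (measureU2 _ _ _))// -addeA leeD2l//.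
rewrite (le_trans (markov_measure _ _ _ c0))//.
- exact: measurable_dist.
- by move=> z; exact: enorm_ge0.
rewrite (le_trans (lee_wpmul2r _ ct))// ?lee_fin ?invr_ge0 ?(ltW c0)//.
by rewrite mulrDl mulfK// gt_eqF.
Qed.

(** A point of norm at least $r + 1/(k+1)$ moved by less than $1/(k+1)$ still has norm above $r$.
    [W_markov], applied to an approximation within $e/(k+1)$, thus bounds the mass of [F k] by $e$,
    and the sets [F k] exhaust the outside of the ball. *)
Lemma conc_W_limit (r : R) (mu : P) :
  (forall e : R, (0 < e)%R -> exists2 nu : P, conc r nu & W nu mu <= e%:E) ->
  conc r mu.
Proof.
move=> h; pose F (k : nat) := [set x : rV | r + k.+1%:R^-1 <= enorm x]%R.
have mF k : measurable (F k).
  by apply: measurable_le_set => //; exact: measurable_enorm.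
have F0 k : mu (F k) = 0.
  apply/eqP; rewrite eq_le measure_ge0 andbT; apply/lee_addgt0Pr => e e0.
  have ek : (0 < e * k.+1%:R^-1)%R by rewrite mulr_gt0.
  have [nu cnu Wnu] := h _ ek.
  rewrite add0e; rewrite W_sym in Wnu.
  have := @W_markov mu nu _ k.+1%:R^-1 (F k) [set x : rV | r < enorm x]%R Wnu.
  rewrite cnu add0e mulfK ?gt_eqF// => -> //.
  - exact: measurable_enorm_gt.
  - move=> x y /= rx xy; have xyy := enorm_triangle (x - y) y.
    rewrite subrK in xyy; rewrite -(ltrD2r k.+1%:R^-1%R) (le_lt_trans rx)//.
    by rewrite (le_lt_trans xyy)// addrC ltrD2l.
have : mu.-negligible (\bigcup_k F k).
  by apply: negligible_bigcup => k; apply/negligibleP; [exact: mF|exact: F0].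
rewrite (_ : \bigcup_k F k = [set x : rV | r < enorm x]%R) => [/negligibleP|].
  by apply; exact: measurable_enorm_gt.
apply/seteqP; split=> [x [k _]/=|x /= rx].
  by apply: lt_le_trans; rewrite ltrDl.
exists (Num.truncn (enorm x - r)^-1) => //=; rewrite /F/=.
rewrite -lerBrDl -[leRHS]invrK lef_pV2 ?posrE ?invr_gt0 ?subr_gt0//.
by rewrite ltW// truncnS_gt.
Qed.

(** An open [U] is the increasing union of the sets [F k] of points whose ball of radius $1/(k+1)$
    lies in [U], and [W_markov] bounds the mass of [F k] by that of [U] under the other measure. By
    symmetry the measures agree on the open sets, a generating class stable under intersection. *)
Lemma W_eq0_eqm (mu nu : P) : (forall e : R, (0 < e)%R -> W mu nu <= e%:E) ->
  mu ≡μ nu.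
Proof.
move=> h.
have open_le (m1 m2 : P) (U : set rV) : open U ->
    (forall e : R, (0 < e)%R -> W m1 m2 <= e%:E) -> m1 U <= m2 U.
  move=> oU h12.
  pose F (k : nat) := [set x : rV | forall y, (enorm (x - y) < k.+1%:R^-1)%R -> U y].
  have mF k : measurable (F k).
    rewrite -[X in measurable X]setCK; apply: measurableC; apply: open_measurable_row.
    rewrite openE => x /existsNP[y /not_implyP[xy Uy]].
    have oB : open [set x : rV | enorm (x - y) < k.+1%:R^-1]%R.
      have ct : continuous (fun x : rV => x - y)%R.
        by move=> z; apply: (@cvgB _ _ _ (nbhs z) _ id (cst y)); [exact: cvg_id|exact: cvg_cst].
      exact: (open_comp (fun z _ => ct z) (@open_enorm_lt R n k.+1%:R^-1%R)).
    apply: filterS (open_nbhs_nbhs (conj oB xy)) => z /= zy Fz; exact/Uy/Fz.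
  have FU : \bigcup_k F k = U.
    apply/seteqP; split=> [x [k _ Fx]|x Ux]; first by apply: Fx; rewrite subrr enorm0.
    have /nbhs_ballP[e /= e0 eU] : nbhs x U by exact: open_nbhs_nbhs.
    exists (Num.truncn e^-1) => //= y xy; apply: eU; split => // i j.
    rewrite (ord1 i) /ball/=; have := coord_le_enorm (x - y) j; rewrite !mxE.
    move=> /le_lt_trans; apply; apply: (lt_trans xy).
    by rewrite -[ltRHS]invrK ltf_pV2 ?posrE ?invr_gt0// truncnS_gt.
  have Fle k : m1 (F k) <= m2 U.
    apply/lee_addgt0Pr => e e0.
    have ek : (0 < e * k.+1%:R^-1)%R by rewrite mulr_gt0.
    have := @W_markov m1 m2 _ k.+1%:R^-1 (F k) U (h12 _ ek).
    rewrite mulfK ?gt_eqF//; apply => //.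
    - exact: open_measurable_row.
    - by move=> x y; apply.
  have := @nondecreasing_cvg_mu _ _ _ m1 F mF.
  rewrite FU => /(_ (open_measurable_row oU)) cv.
  have ndF : nondecreasing_seq F.
    move=> i j ij; apply/subsetPset => x Fx y xy; apply: Fx; apply: (lt_le_trans xy).
    by rewrite lef_pV2 ?posrE// ler_nat.
  have mcv := cv ndF.
  rewrite -(cvg_lim _ mcv)//; apply: lime_le => //; first by apply/cvg_ex; exists (m1 U).
  by apply: nearW.
have h' e : (0 < e)%R -> W nu mu <= e%:E by rewrite W_sym; exact: h.
move=> A mA.
apply: (@g_sigma_algebra_measure_unique _ _ _ (@open rV) _ (fun=> setT)) => //.
- by move=> U; exact: open_measurable_row.
- by move=> _; exact: openT.
- by apply/seteqP; split=> // x _; exists 0%N.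
- by move=> U1 U2; exact: openI.
- by move=> U oU; apply/eqP; rewrite eq_le !open_le.
- by move=> _; rewrite -ge0_fin_numE ?fin_num_measure.
Qed.
End wasserstein_basics.

(** * Gluing of couplings *)

Section finite_decomposition.
Context d (T : measurableType d) (R : realType).
Local Open Scope ereal_scope.

Lemma measure_finType_bigcup (I : finType) (mu : {measure set T -> \bar R}) (E : I -> set T) :
  (forall i, measurable (E i)) -> trivIset setT E ->
  mu (\bigcup_i E i) = \sum_i mu (E i).
Proof.
move=> mE tE; rewrite measure_fin_bigcup//.
rewrite (fsbigE (index_enum I))//=.
- by apply: eq_bigl => i; rewrite in_setT.
- exact: index_enum_uniq.
- by move=> i _; rewrite mem_index_enum.
- exact: finite_finset.
Qed.

Lemma fin_decomp (I : finType) (mu : {measure set T -> \bar R}) (E : I -> set T) A :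
  (forall i, measurable (E i)) -> trivIset setT E -> mu (~` \bigcup_i E i) = 0 ->
  measurable A -> mu A = \sum_i mu (A `&` E i).
Proof.
move=> mE tE E0 mA; have mU : measurable (\bigcup_i E i) by exact: fin_bigcup_measurable.
rewrite -measure_finType_bigcup; last 2 first.
  by move=> i; exact: measurableI.
  exact: trivIset_setIl.
rewrite -setI_bigcupr -[in LHS](setIT A) -(setUv (\bigcup_i E i)) setIUr.
rewrite measureU//; last 3 first.
  exact: measurableI.
  by apply: measurableI => //; exact: measurableC.
  by rewrite setIACA setICr setI0.
rewrite [X in _ + X](_ : _ = 0) ?adde0//.
apply: (null_subset _ _ (@subIsetr _ _ _) E0); last exact: measurableC.
by apply: measurableI => //; exact: measurableC.
Qed.
End finite_decomposition.

Section gluing.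
Context (R : realType) (n : nat).
Local Notation rV := 'rV[R]_n.
Local Notation P := (probability 'rV[R]_n R).
Local Open Scope ereal_scope.

Lemma enorm_eq0 (x : rV) : (enorm x <= 0)%R -> x = 0%R.
Proof.
move=> x0; apply/rowP => i; rewrite mxE; apply/eqP.
by rewrite -normr_le0 (le_trans (coord_le_enorm x i)).
Qed.

Lemma measurable_set1_row (a : rV) : measurable [set a].
Proof.
rewrite (_ : [set a] = [set x | enorm (x - a) <= 0]%R); last first.
  apply/seteqP; split=> [x ->|x /= /enorm_eq0/subr0_eq//].
  by rewrite /= subrr enorm0.
by apply: measurable_le_set => //; apply: measurable_dist.
Qed.

Lemma measurable_seq_row (s : seq rV) : measurable [set` s].
Proof.
elim: s => [|a s ih]; first by rewrite set_nil.
rewrite (_ : [set` _] = [set a] `|` [set` s]).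
  by apply: measurableU => //; exact: measurable_set1_row.
apply/seteqP; split=> x /=; rewrite in_cons.
  by move=> /orP[/eqP|]; [left|right].
by move=> [->|->]; rewrite ?eqxx ?orbT.
Qed.

Definition fin_supp (mu : P) := exists s : seq rV, mu (~` [set` s]) = 0.

Lemma fin_suppP (mu : P) : fin_supp mu ->
  exists k (p : 'I_k -> rV), injective p /\ mu (~` range p) = 0.
Proof.
move=> [s s0]; exists (size (undup s)), (tnth (in_tuple (undup s))); split.
  by apply/tuple_uniqP => /=; exact: undup_uniq.
rewrite (_ : range _ = [set` s])//; apply/seteqP; split=> x.
  by move=> [i _ <-] /=; rewrite -mem_undup; exact: mem_tnth.
by rewrite /= -mem_undup => /(tnthP (in_tuple _))[i ->]; exists i.
Qed.

Lemma measurable_range_row k (p : 'I_k -> rV) : measurable (range p).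
Proof.
rewrite (_ : range p = \bigcup_i [set p i]); last first.
  by apply/seteqP; split=> [_ [i _ <-]|x [i _ ->]]; exists i.
by apply: fin_bigcup_measurable => // i _; exact: measurable_set1_row.
Qed.

Lemma measurable_fst_pre (A : set rV) : measurable A ->
  measurable (fst @^-1` A : set (rV * rV)).
Proof. by move=> mA; rewrite -[X in measurable X]setTI; exact: measurable_fst. Qed.

Lemma measurable_snd_pre (A : set rV) : measurable A ->
  measurable (snd @^-1` A : set (rV * rV)).
Proof. by move=> mA; rewrite -[X in measurable X]setTI; exact: measurable_snd. Qed.

(* As b has finite support, no disintegration is needed: with y_j the atoms of b,
   Q is the sum over j of b{y_j}^-1 (tau1 x tau2) restricted to y = y' = y_j
   (the junk value 0^-1 = 0 discards the null atoms). *)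
Lemma glue (b : P) (tau1 tau2 : probability (rV * rV)%type R) :
  fin_supp b ->
  (forall A, measurable A -> tau1 (snd @^-1` A) = b A) ->
  (forall A, measurable A -> tau2 (fst @^-1` A) = b A) ->
  exists Q : probability ((rV * rV) * (rV * rV))%type R,
  [/\ forall A, measurable A -> Q (fst @^-1` A) = tau1 A,
      forall A, measurable A -> Q (snd @^-1` A) = tau2 A &
      Q (~` [set w | w.1.2 = w.2.1]) = 0].
Proof.
move=> /fin_suppP[k [p [injp b0]]] t1 t2.
pose E (j : 'I_k) := [set p j].
have mE j : measurable (E j) by exact: measurable_set1_row.
pose D j := (snd @^-1` E j : set (rV * rV)) `*` (fst @^-1` E j : set (rV * rV)).
have mD j : measurable (D j).
  by apply: measurableX; [exact: measurable_snd_pre|exact: measurable_fst_pre].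
have bfin j : b (E j) \is a fin_num by exact: fin_num_measure.
have inv0 j : (0 <= (fine (b (E j)))^-1)%R by rewrite invr_ge0 fine_ge0.
pose c j : {nonneg R} := NngNum (inv0 j).
pose q (j : nat) : {measure set ((rV * rV) * (rV * rV)) -> \bar R} :=
  if insub j is Some i then mscale (c i) (mrestr (tau1 \x tau2) (mD i)) else mzero.
pose Q0 := msum q k.
have Q0E X : Q0 X = \sum_(j < k) (c j)%:num%:E * (tau1 \x tau2) (X `&` D j).
  by apply: eq_bigr => j _; rewrite /q (valK j : insub (j : nat) = Some j).
have tE : trivIset setT E by move=> i j _ _ [x [/= -> /injp]].
have cE j (x : \bar R) : 0 <= x -> x <= b (E j) -> (c j)%:num%:E * (x * b (E j)) = x.
  move=> x0 xb; have [bE|bE] := eqVneq (b (E j)) 0.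
    have -> : x = 0 by apply/eqP; rewrite eq_le x0 andbT -bE.
    by rewrite mul0e mule0.
  rewrite muleCA /= -[X in _ * (_ * X)]fineK//.
  rewrite -EFinM mulVf ?mule1// -eqe fineK//.
have Q1 A : measurable A -> Q0 (fst @^-1` A) = tau1 A.
  move=> mA; rewrite Q0E.
  rewrite (@fin_decomp _ _ _ _ tau1 (fun j => snd @^-1` E j))//; last 3 first.
  - by move=> j; exact: measurable_snd_pre.
  - by move=> i j _ _ [z [/= -> /injp]].
  - rewrite -preimage_bigcup preimage_setC.
    apply: (etrans (t1 (~` \bigcup_j E j) _)).
      by apply: measurableC; exact: fin_bigcup_measurable.
    rewrite -[RHS]b0; congr (b (~` _)).
    by apply/seteqP; split=> [x [i _ ->]|_ [i _ <-]]; exists i.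
  apply: eq_bigr => j _.
  rewrite (_ : _ `&` D j = (A `&` snd @^-1` E j) `*` (fst @^-1` E j)); last first.
    by apply/seteqP; split=> [[z w] [/= ? [? ?]]|[z w] [/= [? ?] ?]].
  have mAE : measurable (A `&` snd @^-1` E j).
    by apply: measurableI => //; exact: measurable_snd_pre.
  rewrite product_measure1E//; last exact: measurable_fst_pre.
  have xb : tau1 (A `&` snd @^-1` E j) <= b (E j).
    by rewrite -t1//; apply: le_measure; rewrite ?inE//; exact: measurable_snd_pre.
  by have := cE j _ (measure_ge0 _ _) xb; rewrite -{1}(t2 (E j)).
have Q2 A : measurable A -> Q0 (snd @^-1` A) = tau2 A.
  move=> mA; rewrite Q0E.
  rewrite (@fin_decomp _ _ _ _ tau2 (fun j => fst @^-1` E j))//; last 3 first.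
  - by move=> j; exact: measurable_fst_pre.
  - by move=> i j _ _ [z [/= -> /injp]].
  - rewrite -preimage_bigcup preimage_setC.
    apply: (etrans (t2 (~` \bigcup_j E j) _)).
      by apply: measurableC; exact: fin_bigcup_measurable.
    rewrite -[RHS]b0; congr (b (~` _)).
    by apply/seteqP; split=> [x [i _ ->]|_ [i _ <-]]; exists i.
  apply: eq_bigr => j _.
  rewrite (_ : _ `&` D j = (snd @^-1` E j) `*` (A `&` fst @^-1` E j)); last first.
    by apply/seteqP; split=> [[z w] [/= ? [? ?]]|[z w] [/= ? [? ?]]].
  have mAE : measurable (A `&` fst @^-1` E j).
    by apply: measurableI => //; exact: measurable_fst_pre.
  rewrite product_measure1E//; last exact: measurable_snd_pre.
  have xb : tau2 (A `&` fst @^-1` E j) <= b (E j).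
    by rewrite -t2//; apply: le_measure; rewrite ?inE//; exact: measurable_fst_pre.
  by have := cE j _ (measure_ge0 _ _) xb; rewrite muleC [X in X * _]muleC -{1}(t1 (E j))// muleC.
have QT : Q0 setT = 1.
  by rewrite -(preimage_setT fst) Q1// probability_setT.
exists (HB.pack_for (probability ((rV * rV) * (rV * rV))%type R) Q0
  (Measure_isProbability.Build _ _ _ Q0 QT)); split=> //.
rewrite /= Q0E big1// => j _.
rewrite (_ : _ `&` _ = set0) ?measure0 ?mule0//.
by apply/seteqP; split=> // -[[a y] [y' z]] [/= yy [/= hy hy']]; apply: yy; rewrite hy hy'.
Qed.

(** Two nearly optimal couplings are glued along [b]. The outer coordinates of the result couple [a]
    and [c], and the two middle ones agree almost surely, so the pointwise triangle inequality
    integrates. Infinite distances are set aside first. *)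
Lemma W_triangle_fin (a b c : P) : fin_supp b -> W a c <= W a b + W b c.
Proof.
move=> fb; have [->|] := eqVneq (W a b) +oo.
  by rewrite addye ?leey// gt_eqF// (lt_le_trans _ (W_ge0 _ _)).
rewrite -ltey => Wab; have [->|] := eqVneq (W b c) +oo.
  by rewrite addey ?leey// gt_eqF// (lt_le_trans _ (W_ge0 _ _)).
rewrite -ltey => Wbc.
have Wabf : W a b \is a fin_num by rewrite ge0_fin_numE ?W_ge0.
have Wbcf : W b c \is a fin_num by rewrite ge0_fin_numE ?W_ge0.
apply/lee_addgt0Pr => e e0; have e20 : (0 < e / 2)%R by rewrite divr_gt0.
have [|tau1 [c1 c1'] ct1] := @W_le_coupling _ _ a b (fine (W a b)) (e / 2) _ e20.
  by rewrite fineK.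
have [|tau2 [c2 c2'] ct2] := @W_le_coupling _ _ b c (fine (W b c)) (e / 2) _ e20.
  by rewrite fineK.
have [Q [Q1 Q2 Q3]] := glue fb c1' c2.
have m11 : measurable_fun setT (fun w : (rV * rV) * (rV * rV) => w.1.1).
  exact: (measurableT_comp measurable_fst measurable_fst).
have m12 : measurable_fun setT (fun w : (rV * rV) * (rV * rV) => w.1.2).
  exact: (measurableT_comp measurable_snd measurable_fst).
have m21 : measurable_fun setT (fun w : (rV * rV) * (rV * rV) => w.2.1).
  exact: (measurableT_comp measurable_fst measurable_snd).
have m22 : measurable_fun setT (fun w : (rV * rV) * (rV * rV) => w.2.2).
  exact: (measurableT_comp measurable_snd measurable_snd).
rewrite (le_trans (@W_le_integral _ _ _ _ Q _ _ a c m11 m22 _ _))//.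
- by move=> A mA; exact: (etrans (Q1 _ (measurable_fst_pre mA)) (c1 A mA)).
- by move=> A mA; exact: (etrans (Q2 _ (measurable_snd_pre mA)) (c2' A mA)).
have mN : measurable (~` [set w : (rV * rV) * (rV * rV) | w.1.2 = w.2.1]).
  apply: measurableC.
  rewrite (_ : [set _ | _] = [set w : (rV * rV) * (rV * rV) | enorm (w.1.2 - w.2.1) <= 0]%R).
    by apply: measurable_le_set => //; exact: measurable_dist.
  apply/seteqP; split=> [w /= ->|w /= /enorm_eq0/subr0_eq//].
  by rewrite subrr enorm0.
rewrite (le_trans (@integral_affine_le _ _ _ Q _
   (fun w => enorm (w.1.1 - w.1.2)) (fun w => enorm (w.2.1 - w.2.2)) 1 1 0
   _ mN Q3 _ _ _ _ _ _ _ _ _ _))//.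
- exact: measurable_dist.
- exact: measurable_dist.
- exact: measurable_dist.
- by move=> w; exact: enorm_ge0.
- by move=> w; exact: enorm_ge0.
- by move=> w; exact: enorm_ge0.
- move=> w /contrapT /= ww; rewrite !mul1r addr0 -ww.
  exact: enorm_sub_triangle.
rewrite !mul1e adde0 -[W a b]fineK// -[W b c]fineK//.
have -> : (fine (W a b))%:E + (fine (W b c))%:E + e%:E =
    (fine (W a b) + e / 2)%:E + (fine (W b c) + e / 2)%:E.
  by rewrite -!EFinD; congr (_%:E); rewrite addrACA -splitr.
apply: leeD.
- apply: le_trans ct1; rewrite /transport_cost.
  rewrite (@integral_has_law _ _ _ _ _ Q tau1 fst (fun z => (enorm (z.1 - z.2)%R)%:E))//.
    by apply/measurable_EFinP; exact: measurable_dist.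
  by move=> z; rewrite lee_fin enorm_ge0.
- apply: le_trans ct2; rewrite /transport_cost.
  rewrite (@integral_has_law _ _ _ _ _ Q tau2 snd (fun z => (enorm (z.1 - z.2)%R)%:E))//.
    by apply/measurable_EFinP; exact: measurable_dist.
  by move=> z; rewrite lee_fin enorm_ge0.
Qed.
End gluing.

(** * Rounding to a lattice and the triangle inequality *)

Section rounding.
Context (R : realType) (n : nat).
Local Notation rV := 'rV[R]_n.
Local Notation P := (probability 'rV[R]_n R).

(** The lower corner of the cell of mesh $N^{-p}$ that contains [x]: for $N > 0$ each [grid_cell] is
    a fibre of [rnd]. As for the grids, $p = 2$ is for positions of lattice solutions and $p = 1$
    for velocities. *)
Definition rnd (p N : nat) (x : rV) : rV :=
  \row_i ((Num.floor (x 0 i * (N ^ p)%:R))%:~R / (N ^ p)%:R).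

Definition on_grid (p N : nat) (x : rV) :=
  forall i, exists k : int, x 0 i = k%:~R / (N ^ p)%:R.

Lemma on_grid_rnd p N (x : rV) : on_grid p N (rnd p N x).
Proof. by move=> i; rewrite mxE; eexists; reflexivity. Qed.

Lemma rnd_on_grid p N (x : rV) : (0 < N)%N -> on_grid p N x -> rnd p N x = x.
Proof.
move=> N0 gx; apply/rowP => i; rewrite mxE; have [k ->] := gx i.
rewrite divfK ?pnatr_eq0 -?lt0n ?expn_gt0 ?N0//.
by rewrite intrKfloor.
Qed.

Lemma rnd_itv p N (x : rV) i : (0 < N)%N ->
  rnd p N x 0 i <= x 0 i < rnd p N x 0 i + ((N ^ p)%:R)^-1.
Proof.
move=> N0; rewrite mxE; have N0' : 0 < (N ^ p)%:R :> R by rewrite ltr0n expn_gt0 N0.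
rewrite ler_pdivrMr// floor_le/= -[X in _ + X]mul1r -mulrDl ltr_pdivlMr//.
by have := floorD1_gt (x 0 i * (N ^ p)%:R); rewrite intrD.
Qed.

Lemma rnd_coord_le p N (x : rV) i : (0 < N)%N -> `|x 0 i - rnd p N x 0 i| <= ((N ^ p)%:R)^-1.
Proof.
move=> N0; have /andP[h1 h2] := rnd_itv p x i N0.
by rewrite ger0_norm ?subr_ge0// lerBlDl ltW.
Qed.

Lemma rnd_le p N (x : rV) : (0 < N)%N -> enorm (x - rnd p N x) <= n%:R / (N ^ p)%:R.
Proof.
move=> N0; apply: enorm_le_bound; first by rewrite invr_ge0.
by move=> i; have := rnd_coord_le p x i N0; rewrite !mxE.
Qed.

Lemma measurable_rnd p N : measurable_fun setT (rnd p N).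
Proof.
apply: measurable_row => i.
rewrite (_ : (fun w => _) = (fun w : rV => ((Num.floor (w 0 i * (N ^ p)%:R))%:~R / (N ^ p)%:R))); last first.
  by apply/funext => w; rewrite mxE.
apply: measurable_funM => //.
have mfl : measurable_fun [set: R] (fun x : R => (Num.floor x)%:~R : R).
  by apply: nondecreasing_measurable => // x y xy; rewrite ler_int le_floor.
apply: (measurableT_comp mfl); apply: measurable_funM => //; exact: measurable_coord.
Qed.

Lemma enorm_rnd p N (x : rV) : (0 < N)%N -> enorm (rnd p N x) <= enorm x + n%:R / (N ^ p)%:R.
Proof.
move=> N0; have -> : rnd p N x = x - (x - rnd p N x) by rewrite subKr.
rewrite (le_trans (enorm_triangle _ _))// enormN lerD2l; exact: rnd_le.
Qed.

Lemma fin_supp_grid p N r (mu : P) : (0 < N)%N -> measurable [set x | on_grid p N x] ->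
  mu (~` [set x | on_grid p N x]) = 0%E -> conc r mu -> fin_supp mu.
Proof.
move=> N0 mg g0 cr.
(* A grid point of the ball has integer coordinates of absolute value at most [M]; adding [M]
   numbers them from 0 to $2M$. *)
pose M := (Num.truncn (`|r| * (N ^ p)%:R)).+1.
have N0' : 0 < (N ^ p)%:R :> R by rewrite ltr0n expn_gt0 N0.
pose pt (f : {ffun 'I_n -> 'I_(M.*2.+1)}) : rV :=
  \row_i (((f i)%:R - M%:R) / (N ^ p)%:R).
exists [seq pt f | f <- index_enum {ffun 'I_n -> 'I_(M.*2.+1)}].
apply: (@null_subset _ _ _ mu _ (~` [set x | on_grid p N x] `|` [set x | r < enorm x])).
- by apply: measurableC; exact: measurable_seq_row.
- by apply: measurableU; [exact: measurableC|exact: measurable_enorm_gt].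
- move=> x nx; apply: contrapT => /not_orP[/contrapT gx /negP xr]; apply: nx.
  rewrite -leNgt in xr; have [k kx] := choice gx.
  have kM i : `|k i| <= M%:Z.
    rewrite -(ler_int R) intr_norm /=.
    have -> : (k i)%:~R = x 0 i * (N ^ p)%:R :> R by rewrite kx divfK// gt_eqF.
    rewrite normrM (ger0_norm (ltW N0')) ltW// (le_lt_trans _ (truncnS_gt _))//.
    rewrite ler_pM2r// (le_trans (coord_le_enorm _ _))// (le_trans xr)//; exact: ler_norm.
  have kM' i : (absz (k i + M%:Z)%R < M.*2.+1)%N.
    rewrite ltnS -lez_nat gez0_abs; last first.
      by rewrite -lerBlDr sub0r; have := kM i; rewrite ler_norml => /andP[].
    rewrite -addnn PoszD lerD2r; have := kM i; rewrite ler_norml => /andP[_].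
    by [].
  rewrite /= -/(pt _); apply/mapP; exists [ffun i => Ordinal (kM' i)].
    by rewrite mem_index_enum.
  apply/rowP => i; rewrite mxE ffunE /= kx; congr (_ / _).
  rewrite -[(absz (k i + M%:Z))%:R]/((Posz (absz (k i + M%:Z)))%:~R) gez0_abs; last first.
    by rewrite -lerBlDr sub0r; have := kM i; rewrite ler_norml => /andP[].
  by rewrite intrD addrK.
- apply/eqP; rewrite eq_le measure_ge0 andbT (le_trans (measureU2 _ _ _))//.
  + exact: measurableC.
  + exact: measurable_enorm_gt.
  + by rewrite [X in (X + _)%E]g0 [X in (_ + X)%E]cr adde0.
Qed.

Lemma measurable_on_grid p N : (0 < N)%N -> measurable [set x : rV | on_grid p N x].
Proof.
move=> N0; rewrite (_ : [set _ | _] = [set x | enorm (x - rnd p N x) <= 0]).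
  apply: measurable_le_set => //; apply: measurable_dist => //; exact: measurable_rnd.
apply/seteqP; split=> [x /= gx|x /= /enorm_eq0/subr0_eq ->]; last exact: on_grid_rnd.
by rewrite rnd_on_grid// subrr enorm0.
Qed.

(** With $p = 2$ the initial measure of the lattice solutions; with $p = 1$ a generic approximation
    by measures of finite support. *)
Definition rlaw p N (mu : P) : P := law mu (measurable_rnd p N).

Lemma rlaw_on_grid p N (mu : P) : rlaw p N mu (~` [set x | on_grid p N x]) = 0%E.
Proof.
rewrite /rlaw lawE (_ : _ @^-1` _ = set0) ?measure0//.
by apply/seteqP; split=> // x /=; apply; exact: on_grid_rnd.
Qed.

Lemma rlaw_conc p N r (mu : P) : (0 < N)%N -> conc r mu ->
  conc (r + n%:R / (N ^ p)%:R) (rlaw p N mu).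
Proof.
move=> N0 cr; rewrite /conc /rlaw lawE; apply: (null_subset _ _ _ cr).
- by rewrite -[X in measurable X]setTI; apply: measurable_rnd => //; exact: measurable_enorm_gt.
- exact: measurable_enorm_gt.
- move=> x /= h; rewrite -(ltrD2r (n%:R / (N ^ p)%:R)).
  by rewrite (lt_le_trans h)// enorm_rnd.
Qed.

Lemma rlaw_fin_supp p N r (mu : P) : (0 < N)%N -> conc r mu -> fin_supp (rlaw p N mu).
Proof.
move=> N0 cr; apply: (@fin_supp_grid p N _ _ N0 _ _ (rlaw_conc p N0 cr)).
  exact: measurable_on_grid.
exact: rlaw_on_grid.
Qed.

Local Open Scope ereal_scope.

(** The pair of maps pushes every coupling of [a] and [b] to a coupling of the images, at an extra
    cost of at most [c]. *)
Lemma W_law_le (a b : P) (f g : rV -> rV) (mf : measurable_fun setT f)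
    (mg : measurable_fun setT g) (c : R) : (0 <= c)%R ->
  (forall x y, enorm (f x - g y) <= enorm (x - y) + c)%R ->
  W (law a mf) (law b mg) <= W a b + c%:E.
Proof.
move=> c0 fg; rewrite -leeBlDr//; apply: le_ereal_inf_tmp => _ [tau [c1 c2] <-].
rewrite leeBlDr//.
have mf' : measurable_fun setT (f \o fst : rV * rV -> rV) by exact: measurableT_comp.
have mg' : measurable_fun setT (g \o snd : rV * rV -> rV) by exact: measurableT_comp.
rewrite (le_trans (@W_le_integral _ _ _ _ tau _ _ _ _ mf' mg' _ _))//.
- move=> A mA; apply: (c1 (f @^-1` A)); rewrite -[X in measurable X]setTI; exact: mf.
- move=> A mA; apply: (c2 (g @^-1` A)); rewrite -[X in measurable X]setTI; exact: mg.
rewrite (le_trans (@integral_affine_le _ _ _ tau _ (fun z => enorm (z.1 - z.2))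
  (cst 0%R) 1 0 c set0 _ _ _ _ _ _ _ _ _ _ _ _))//.
- exact: measurable_dist.
- exact: measurable_dist.
- by move=> w; exact: enorm_ge0.
- by move=> w; exact: enorm_ge0.
- by move=> w _ /=; rewrite mul1r mul0r addr0.
- by rewrite mul1e mul0e adde0.
Qed.

Lemma W_rnd_le p N (a : P) : (0 < N)%N -> W a (rlaw p N a) <= (n%:R / (N ^ p)%:R)%:E.
Proof.
move=> N0; rewrite (le_trans (@W_le_integral _ _ _ _ a id (rnd p N) _ _ _ _ _ _))//.
  exact: measurable_rnd.
apply: (@integral_const_le _ _ _ a _ _ set0) => //.
- apply: measurable_dist => //; exact: measurable_rnd.
- by move=> w; exact: enorm_ge0.
- by move=> w _; exact: rnd_le.
Qed.

Lemma W_rlaw2_le p N (a b : P) : (0 < N)%N ->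
  W (rlaw p N a) (rlaw p N b) <= W a b + (2 * (n%:R / (N ^ p)%:R))%:E.
Proof.
move=> N0; apply: W_law_le; first by rewrite mulr_ge0 ?divr_ge0.
move=> x y; have h1 := rnd_le p x N0; have h2 := rnd_le p y N0.
rewrite enormBC in h1; have t1 := enorm_sub_triangle (rnd p N x) x (rnd p N y).
have t2 := enorm_sub_triangle x y (rnd p N y).
apply: (le_trans t1); apply: (le_trans (lerD h1 t2)).
rewrite addrCA lerD2l; apply: (le_trans (lerD (lexx _) h2)).
by rewrite [leRHS]mulr_natl mulr2n.
Qed.

(* Rounding b moves it by a map, which changes W by a direct coupling and reduces
   the inequality to a middle measure of finite support. *)
Lemma W_triangle (r : R) (a b c : P) : conc r b -> W a c <= W a b + W b c.
Proof.
move=> cr; apply/lee_addgt0Pr => e e0.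
pose k := (Num.truncn (2 * n%:R / e)).+1.
have k0 : (0 < k)%N by [].
have ke : (n%:R / (k ^ 1)%:R <= e / 2)%R.
  rewrite expn1 ler_pdivrMr ?ltr0n// -ler_pdivrMl ?divr_gt0// invf_div.
  by rewrite mulrAC ltW// truncnS_gt.
rewrite (le_trans (W_triangle_fin _ _ (rlaw_fin_supp 1 k0 cr)))//.
have h1 : W a (rlaw 1 k b) <= W a b + (e / 2)%:E.
  rewrite (_ : W a (rlaw 1 k b) = W (law a (@measurable_id _ _ setT)) (rlaw 1 k b)); last exact: W_eqm.
  apply: W_law_le => [|x y]; first by rewrite divr_ge0// ltW.
  apply: (le_trans (enorm_sub_triangle _ y _)); rewrite lerD2l.
  exact: (le_trans (rnd_le 1 y k0) ke).
have h2 : W (rlaw 1 k b) c <= W b c + (e / 2)%:E.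
  rewrite (_ : W (rlaw 1 k b) c = W (rlaw 1 k b) (law c (@measurable_id _ _ setT))); last exact: W_eqm.
  apply: W_law_le => [|x y]; first by rewrite divr_ge0// ltW.
  apply: (le_trans (enorm_sub_triangle _ x _)); rewrite addrC lerD2l enormBC.
  exact: (le_trans (rnd_le 1 x k0) ke).
by rewrite (le_trans (leeD h1 h2))// addeACA -EFinD -splitr.
Qed.

End rounding.

(** * Completeness *)

Section splitting.
Context (R : realType).
Local Open Scope ereal_scope.

(** Sierpinski's intermediate value property of atomless measures. *)
Definition splittable d (Om : measurableType d) (Q : probability Om R) :=
  forall (A : set Om) (a : R), measurable A -> (0 <= a)%R -> a%:E <= Q A ->
  exists B, [/\ measurable B, B `<=` A & Q B = a%:E].

Lemma uniform_le_lebesgue (B : set R) : measurable B ->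
  uniform_prob (@ltr01 R) B <= lebesgue_measure (B `&` `[0%R, 1%R]).
Proof.
move=> mB; rewrite /uniform_prob integral_uniform_pdf.
have mB' : measurable (B `&` `[0%R, 1%R]) by exact: measurableI.
apply: (@le_trans _ _ (\int[lebesgue_measure]_(x in B `&` `[0%R, 1%R]) 1)).
  apply: ge0_le_integral => //=.
  - by move=> x _; rewrite lee_fin uniform_pdf_ge0.
  - by apply/measurable_EFinP/measurable_funTS; exact: measurable_uniform_pdf.
  - move=> x [_ /=]; rewrite in_itv/= /uniform_pdf => ->.
    by rewrite subr0 invr1.
by rewrite integral_cst// mul1e.
Qed.

(** The mass [F t] of the part of [A] below [t] is nondecreasing and 1-Lipschitz in [t], vanishes at
    0 and is the mass of [A] at 1; the intermediate value theorem gives the cut. *)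
Lemma uniform_splittable : splittable (uniform_prob (@ltr01 R)).
Proof.
move=> A a mA a0 aA; set U := uniform_prob _ in aA *.
have fU B : measurable B -> U B \is a fin_num by move=> mB; exact: fin_num_measure.
pose F (t : R) := fine (U (A `&` `]-oo, t])).
have mI t : measurable (A `&` `]-oo, t]) by exact: measurableI.
have Fst s t : (s <= t)%R -> (F s <= F t <= F s + (t - s))%R.
  move=> st; apply/andP; split.
    rewrite fine_le ?fU//; apply: le_measure; rewrite ?inE//.
    by apply: setIS; apply: subset_itvl; rewrite bnd_simp.
  rewrite -lee_fin EFinD fineK ?fU// fineK ?fU//.
  apply: (@le_trans _ _ (U (A `&` `]-oo, s] `|` `]s, t]))).
    apply: le_measure; rewrite ?inE//; first exact: measurableU.
    move=> x [Ax /=]; rewrite !in_itv/= => xt; have [xs|sx] := leP x s; [left|right].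
      by split.
    by rewrite xt.
  rewrite (le_trans (measureU2 _ _ _))// leeD2l//.
  rewrite (le_trans (uniform_le_lebesgue _))//.
  apply: (@le_trans _ _ (lebesgue_measure `]s, t])).
    by apply: le_measure; rewrite ?inE//; exact: measurableI.
  rewrite lebesgue_measure_itv/= lte_fin; case: ifPn => // _.
  by rewrite lee_fin subr_ge0.
have cF : continuous F.
  move=> t; apply/cvgrPdist_le => e e0.
  apply: filterS (nbhsx_ballx t e e0) => s; rewrite /ball/= => /ltW.
  have [st|ts] := leP s t.
    have /andP[h1 h2] := Fst _ _ st.
    by rewrite !ger0_norm ?subr_ge0//; move: h2; lra.
  have /andP[h1 h2] := Fst _ _ (ltW ts).
  by rewrite !ler0_norm ?subr_le0 ?(ltW ts)//; move: h2; lra.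
have F0 : F 0%R = 0%R.
  rewrite /F; apply/eqP; rewrite eq_le fine_ge0 ?measure_ge0// andbT -lee_fin fineK ?fU//.
  apply: (le_trans (uniform_le_lebesgue (mI _))).
  rewrite [leRHS](_ : _ = lebesgue_measure ([set 0%R] : set R)); last first.
    by rewrite lebesgue_measure_set1.
  apply: le_measure; rewrite ?inE//.
    exact: measurableI.
  move=> x [[_ /=]]; rewrite !in_itv/= => x0 /andP[x0' _].
  by apply/eqP; rewrite eq_le x0.
have F1 : (F 1%R)%:E = U A.
  rewrite /F fineK ?fU//; apply/eqP; rewrite eq_le; apply/andP; split.
    by apply: le_measure; rewrite ?inE.
  rewrite -[leRHS]adde0.
  apply: (@le_trans _ _ (U (A `&` `]-oo, 1%R] `|` `]1%R, +oo[))).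
    apply: le_measure; rewrite ?inE//; first exact: measurableU.
    move=> x Ax; have [xs|sx] := leP x 1%R; [left|right].
      by split=> //=; rewrite in_itv.
    by rewrite /= ?in_itv/= sx.
  rewrite (le_trans (measureU2 _ _ _))// leeD2l//.
  rewrite (le_trans (uniform_le_lebesgue _))//.
  rewrite (_ : _ `&` _ = set0) ?measure0//; apply/seteqP; split=> // x [/=].
  by rewrite !in_itv/= andbT => x1 /andP[_]; rewrite leNgt x1.
have [||t _ Ft] := @IVT R F 0%R 1%R a ler01.
- exact: continuous_subspaceT.
- by rewrite F0 ge_min a0/= le_max orbC -lee_fin F1 aA.
exists (A `&` `]-oo, t]); split => //.
by rewrite -Ft /F fineK ?fU.
Qed.

End splitting.

Section transfer.
Context (R : realType) (n : nat).
Local Notation rV := 'rV[R]_n.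
Local Notation P := (probability 'rV[R]_n R).
Local Open Scope ereal_scope.

(** Induction on [k]: the piece of mass [m k] is cut out of [A] and the remainder is split into the
    others. With indices in [nat] the new piece is inserted at [k] without changing the type of the
    family. *)
Lemma split_seq d (Om : measurableType d) (Q : probability Om R) (k : nat)
    (m : nat -> R) (A : set Om) :
  splittable Q -> measurable A -> (forall j, (0 <= m j)%R) ->
  \sum_(j < k) (m j)%:E <= Q A ->
  exists B : nat -> set Om, [/\ forall j, measurable (B j), trivIset setT B,
    forall j, B j `<=` A & forall j, (j < k)%N -> Q (B j) = (m j)%:E].
Proof.
move=> sQ; elim: k A => [|k ih] A mA m0 mQ.
  by exists (fun=> set0); split => //; [apply/classical_sets.trivIsetP => i j _ _ _; exact: set0I|move=> j; exact: sub0set].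
rewrite big_ord_recr/= in mQ.
have kA : (m k)%:E <= Q A.
  by apply: le_trans mQ; rewrite leeDr// sume_ge0// => j _; rewrite lee_fin.
have [Bk [mBk BkA QBk]] := sQ _ _ mA (m0 k) kA.
have [|//||B [mB tB BA QB]] := ih (A `\` Bk).
  exact: measurableD.
  rewrite measureD//; last by rewrite -ge0_fin_numE// fin_num_measure.
  by rewrite setIidr// [X in _ - X]QBk leeBrDr.
exists (fun j => if j == k then Bk else B j); split.
- by move=> j; case: eqP.
- apply/classical_sets.trivIsetP => i j _ _ ij.
  move/classical_sets.trivIsetP : tB => tB.
  case: eqP => ik; case: eqP => jk.
  + by rewrite ik jk eqxx in ij.
  + by apply/seteqP; split=> // w [wk /BA[_ nk]]; exact: (nk wk).
  + by apply/seteqP; split=> // w [/BA[_ nk] wk]; exact: (nk wk).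
  + exact: tB.
- by move=> j; case: eqP => // _ w /BA[].
- move=> j; rewrite ltnS leq_eqVlt; case: eqP => [-> _|jk /= jk']; first exact: QBk.
  exact: QB.
Qed.

Lemma split_ord d (Om : measurableType d) (Q : probability Om R) (k : nat)
    (m : 'I_k -> R) (A : set Om) :
  splittable Q -> measurable A -> (forall j, (0 <= m j)%R) ->
  \sum_j (m j)%:E <= Q A ->
  exists B : 'I_k -> set Om, [/\ forall j, measurable (B j), trivIset setT B,
    forall j, B j `<=` A & forall j, Q (B j) = (m j)%:E].
Proof.
move=> sQ mA m0 mQ; pose m' (j : nat) := if insub j is Some i then m i else 0%R.
have m'E (j : 'I_k) : m' j = m j by rewrite /m' (valK j : insub (j : nat) = Some j).
have [||B [mB tB BA QB]] := @split_seq _ _ Q k m' A sQ mA.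
- by move=> j; rewrite /m'; case: insub.
- by rewrite (eq_bigr (fun j => (m j)%:E))// => j _; rewrite m'E.
exists (fun j => B j); split => //.
- apply/classical_sets.trivIsetP => i j _ _ ij; move/trivIsetP : tB; apply => //.
- by move=> j; rewrite QB// m'E.
Qed.

(** The given variable [X] is kept and only [Y] is constructed, on the same sample space. This is
    what chains successive couplings into one sequence of random variables. *)
Lemma transfer d (Om : measurableType d) (Q : probability Om R) (b c : P)
    (tau : probability (rV * rV)%type R) (X : Om -> rV) :
  splittable Q -> fin_supp b -> fin_supp c -> coupling b c tau ->
  measurable_fun setT X -> (forall A, measurable A -> Q (X @^-1` A) = b A) ->
  exists Y : Om -> rV, measurable_fun setT Y /\
    forall A, measurable A -> Q ((fun w => (X w, Y w)) @^-1` A) = tau A.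
Proof.
move=> sQ /fin_suppP[k1 [p [injp b0]]] /fin_suppP[k2 [q [injq c0]]] [c1 c2] mX lX.
pose E (ij : 'I_k1 * 'I_k2) : set (rV * rV) := [set p ij.1] `*` [set q ij.2].
have mE ij : measurable (E ij) by apply: measurableX; exact: measurable_set1_row.
have tE : trivIset setT E.
  by move=> [i j] [i' j'] _ _ [[x y] [[/= -> ->] [/= /injp -> /injq ->]]].
have mp := measurable_range_row p; have mq := measurable_range_row q.
have E0 : tau (~` \bigcup_ij E ij) = 0.
  apply: (@null_subset _ _ _ tau _ (fst @^-1` (~` range p) `|` snd @^-1` (~` range q))).
  - by apply: measurableC; exact: fin_bigcup_measurable.
  - by apply: measurableU; [apply: measurable_fst_pre|apply: measurable_snd_pre];
      exact: measurableC.
  - move=> [x y] /= h; apply: contrapT => /not_orP[/contrapT[i _ ix] /contrapT[j _ jy]].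
    by apply: h; exists (i, j) => //; split => /=.
  - apply/eqP; rewrite eq_le measure_ge0 andbT (le_trans (measureU2 _ _ _))//.
    + by apply: measurable_fst_pre; exact: measurableC.
    + by apply: measurable_snd_pre; exact: measurableC.
    + have h1 : tau (fst @^-1` (~` range p)) = 0.
        by apply: (etrans (c1 _ _) b0); exact: measurableC.
      have h2 : tau (snd @^-1` (~` range q)) = 0.
        by apply: (etrans (c2 _ _) c0); exact: measurableC.
      by rewrite [X in X + _]h1 [X in _ + X]h2 adde0.
have fE ij : tau (E ij) \is a fin_num by exact: fin_num_measure.
have mA i : measurable (X @^-1` [set p i]).
  by rewrite -[X in measurable X]setTI; apply: mX => //; exact: measurable_set1_row.
have ex i : exists B : 'I_k2 -> set Om, [/\ forall j, measurable (B j),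
    trivIset setT B, forall j, B j `<=` X @^-1` [set p i] &
    forall j, Q (B j) = tau (E (i, j))].
  have [//|||B [mB tB BA QB]] := @split_ord _ _ Q k2 (fun j => fine (tau (E (i, j))))
      (X @^-1` [set p i]) sQ.
  - by move=> j; rewrite fine_ge0.
  (* The prescribed masses fit into the level set: the [E (i, j)] are disjoint parts of the set of
     pairs with first coordinate [p i], whose mass is that of [p i] under [b], the law of [X]. *)
  - rewrite (eq_bigr (fun j => tau (E (i, j)))); last by move=> j _; rewrite fineK.
    rewrite -measure_finType_bigcup//; last first.
      by move=> j j' _ _ [[x y] [[/= _ ->] [/= _ /injq]]].
    rewrite lX -?c1; [|exact: measurable_set1_row..].
    apply: le_measure; rewrite ?inE.
    + exact: fin_bigcup_measurable.
    + by apply: measurable_fst_pre; exact: measurable_set1_row.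
    + by move=> [x y] [j _ []].
  - by exists B; split => // j; rewrite QB fineK.
have [B BP] := choice ex.
have mB i j : measurable (B i j) by have [] := BP i.
pose F (ij : 'I_k1 * 'I_k2) := B ij.1 ij.2.
have FX ij w : F ij w -> X w = p ij.1 by have [_ _ h _] := BP ij.1; exact: h.
have QF ij : Q (F ij) = tau (E ij) by case: ij => i j; have [_ _ _] := BP i; exact.
have tF : trivIset setT F.
  move=> [i j] [i' j'] _ _ [w [Fw Fw']].
  have /injp : p i = p i' by rewrite -(FX _ _ Fw) (FX _ _ Fw').
  move=> ii'; subst i'; have [_ tB _ _] := BP i.
  by rewrite (tB j j' I I)//; exists w.
(* [Y] is [q j] on the piece [F (i, j)], and 0 on the null set outside all pieces, where the sum
   vanishes. *)
pose Y w := (\sum_ij \1_(F ij) w *: q ij.2)%R.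
have YF ij w : F ij w -> Y w = q ij.2.
  move=> Fw; rewrite /Y (bigD1 ij)//= big1 ?addr0.
    by rewrite indicE mem_set// scale1r.
  move=> ij' ne; rewrite indicE memNset ?scale0r// => Fw'.
  by move/negP : ne; apply; apply/eqP; apply: tF => //; exists w.
have mY : measurable_fun setT Y.
  rewrite /Y; apply: measurable_row => i.
  rewrite (_ : (fun w => _) = (fun w => \sum_ij \1_(F ij) w * q ij.2 0%R i)%R); last first.
    by apply/funext => w; rewrite summxE; apply: eq_bigr => ij _; rewrite mxE.
  by apply: measurable_sum => ij; apply: measurable_funM => //; apply: measurable_indic; exact: mB.
exists Y; split => // A mA'.
have F0 : Q (~` \bigcup_ij F ij) = 0.
  rewrite probability_setC; last by apply: fin_bigcup_measurable => // ij _; exact: mB.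
  rewrite measure_finType_bigcup//; last by move=> ij; exact: mB.
  rewrite (eq_bigr (fun ij => tau (E ij))) => [|ij _]; last exact: QF.
  rewrite -measure_finType_bigcup//.
  have mU : measurable (\bigcup_ij E ij) by exact: fin_bigcup_measurable.
  by rewrite -probability_setC.
rewrite (@fin_decomp _ _ _ _ Q F)//; last 2 first.
- by move=> ij; exact: mB.
- rewrite -[X in measurable X]setTI.
  exact: (measurable_fun_pair mX mY).
rewrite (@fin_decomp _ _ _ _ tau E)//; apply: eq_bigr => ij _.
have [Aij|nAij] := pselect (A (p ij.1, q ij.2)).
- have -> : (fun w => (X w, Y w)) @^-1` A `&` F ij = F ij.
    apply/seteqP; split=> [w []//|w Fw]; split => //=.
    by rewrite (FX _ _ Fw) (YF _ _ Fw).
  have -> : A `&` E ij = E ij.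
    by apply/seteqP; split=> [z []//|[x y] [/= -> ->]].
  exact: QF.
- have -> : (fun w => (X w, Y w)) @^-1` A `&` F ij = set0.
    by apply/seteqP; split=> // w [/= Aw Fw]; move: Aw; rewrite (FX _ _ Fw) (YF _ _ Fw).
  have -> : A `&` E ij = set0.
    by apply/seteqP; split=> // -[x y] [/= Axy [/= xp yq]]; apply: nAij; rewrite -xp -yq.
  by rewrite !measure0.
Qed.
End transfer.

Section completeness.
Context (R : realType) (n : nat).
Local Notation rV := 'rV[R]_n.
Local Notation P := (probability 'rV[R]_n R).

Lemma cvg_of_summable (x : nat -> R) (D : nat -> R) (S : R) :
  (forall j, `|x j.+1 - x j| <= D j) -> (forall k, \sum_(0 <= j < k) D j <= S) ->
  cvgn x.
Proof.
move=> xD DS; pose u j := x j.+1 - x j.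
have cu : cvgn (series u).
  apply: normed_cvg; apply: nondecreasing_is_cvgn.
    by apply: nondecreasing_series => j _ _; rewrite normr_ge0.
  exists S => _ [k _ <-] /=; rewrite (le_trans _ (DS k))//.
  by rewrite /series/=; apply: ler_sum => j _; exact: xD.
have -> : x = (fun k => x 0%N + series u k).
  apply/funext => k; rewrite /series/= telescope_sumr// addrC subrK//.
by apply: is_cvgD => //; exact: is_cvg_cst.
Qed.

Lemma norm_sub_le_sum (x D : nat -> R) (m k : nat) :
  (forall j, `|x j.+1 - x j| <= D j) ->
  `|x m - x (m + k)%N| <= \sum_(0 <= j < k) D (m + j)%N.
Proof.
move=> xD; elim: k => [|k ih]; first by rewrite addn0 subrr normr0 big_geq.
rewrite big_nat_recr//= addnS.
rewrite (_ : _ - _ = (x m - x (m + k)%N) - (x (m + k).+1 - x (m + k)%N)); last ring.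
by rewrite (le_trans (ler_normB _ _))// lerD.
Qed.

Local Open Scope ereal_scope.

Lemma W_complete (rho : nat -> P) : (forall k, fin_supp (rho k)) ->
  (forall k, W (rho k) (rho k.+1) < ((2 ^ k.+1)%:R^-1)%:E) ->
  exists mu, forall k, W (rho k) mu <= (n%:R / (2 ^ k)%:R)%:E.
Proof.
move=> frho Wrho.
pose Om := [the measurableType _ of measurableTypeR R].
pose Q : probability Om R := uniform_prob (@ltr01 R).
have sQ : splittable Q by exact: uniform_splittable.
pose good k (X : Om -> rV) := measurable_fun setT X /\
  forall A, measurable A -> Q (X @^-1` A) = rho k A.
pose near k (X Y : Om -> rV) :=
  \int[Q]_w (enorm (X w - Y w)%R)%:E <= ((2 ^ k.+1)%:R^-1)%:E.
(* The first variable also comes from [transfer], applied to the constant 0 and to the law of $(0,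
   x)$ under [rho 0]. *)
have init : exists X, good 0%N X.
  have fs0 : fin_supp (dirac (0%R : rV) : P).
    exists [:: 0%R]; rewrite [LHS]diracE memNset//= => h; apply: h.
    by rewrite /= inE.
  have m0 : measurable_fun setT (fun x : rV => (0%R : rV, x)).
    by apply: measurable_fun_pair => //; exact: measurable_cst.
  have c0 : coupling (dirac (0%R : rV) : P) (rho 0%N) (law (rho 0%N) m0).
    split=> A mA.
      rewrite /pushforward lawE [RHS]diracE; case: (boolP (0%R \in A)) => A0.
        rewrite (_ : _ @^-1` _ = setT) ?probability_setT//.
        by apply/seteqP; split=> // x _ /=; rewrite -in_setE.
      rewrite (_ : _ @^-1` _ = set0) ?measure0//.
      by apply/seteqP; split=> // x /=; move: A0; rewrite notin_setE.
    by rewrite /pushforward/= lawE.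
  have lX A : measurable A -> Q ((cst (0%R : rV)) @^-1` A) = dirac (0%R : rV) A.
    move=> mA; rewrite preimage_cst [RHS]diracE.
    by case: (_ \in _); rewrite ?probability_setT ?measure0.
  have mc : measurable_fun setT (cst (0%R : rV) : Om -> rV) by exact: measurable_cst.
  have [Y [mY lY]] := transfer sQ fs0 (frho 0%N) c0 mc lX.
  exists Y; split => // A mA.
  exact: (etrans (lY _ (measurable_snd_pre mA)) (c0.2 A mA)).
have step k X : good k X -> exists Y, good k.+1 Y /\ near k X Y.
  move=> [mX lX].
  have [tau ctau tk] := W_lt_coupling (Wrho k).
  have [Y [mY lY]] := transfer sQ (frho k) (frho k.+1) ctau mX lX.
  exists Y; split; first split => // A mA.
    exact: (etrans (lY _ (measurable_snd_pre mA)) (ctau.2 A mA)).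
  rewrite /near (le_trans _ (ltW tk))// /transport_cost.
  rewrite (@integral_has_law _ _ _ _ _ Q tau (fun w => (X w, Y w))
    (fun z => (enorm (z.1 - z.2)%R)%:E))//.
  - exact: measurable_fun_pair.
  - by apply/measurable_EFinP; exact: measurable_dist.
  - by move=> z; rewrite lee_fin enorm_ge0.
have [X0 gX0] := init.
(* Choosing a successor for every pair $(k, X)$, good or not, makes [X] an ordinary recursion; the
   goodness of each term is proved afterwards. *)
have /choice[f fP] : forall kX : nat * (Om -> rV), exists Y,
    good kX.1 kX.2 -> good kX.1.+1 Y /\ near kX.1 kX.2 Y.
  move=> [k X]; have [/step[Y YP]|ng] := pselect (good k X); first by exists Y.
  by exists X => /ng.
pose X := fix X k := if k is j.+1 then f (j, X j) else X0.
have gX k : good k (X k) by elim: k => //= k /(fP (k, X k))[].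
have mX k : measurable_fun setT (X k) by case: (gX k).
have nX k : near k (X k) (X k.+1) by case: (fP (k, X k) (gX k)).
pose D k w := enorm (X k w - X k.+1 w).
have mD k : measurable_fun setT (D k) by exact: measurable_dist.
have D0 k w : (0 <= D k w)%R by exact: enorm_ge0.
(* The tail of the path length from time [m] on; it dominates every coordinate of the remaining
   displacement. *)
pose S m w := \sum_(0 <= j <oo) (D (m + j)%N w)%:E.
have mS m : measurable_fun setT (S m).
  apply: (@ge0_emeasurable_sum _ _ _ _ (fun j w => (D (m + j)%N w)%:E) xpredT).
    by move=> k w _ _; rewrite lee_fin.
  by move=> k _; exact/measurable_EFinP.
have S0 m w : 0 <= S m w by apply: nneseries_ge0 => j _ _; rewrite lee_fin.
have IS m : \int[Q]_w S m w <= ((2 ^ m)%:R^-1)%:E.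
  rewrite integral_nneseries//; last 2 first.
  - by move=> j; exact/measurable_EFinP.
  - by move=> j w _; rewrite lee_fin.
  (* The $j$-th displacement of the tail costs at most $2^{-m}2^{-(j+1)}$, and these bounds sum to
     $2^{-m}$. *)
  apply: le_trans (epsilon_trick0 xpredT (_ : (0 <= (2 ^ m)%:R^-1 :> R)%R)) => //.
  apply: lee_nneseries => [j _ _|j _].
    by apply: integral_ge0 => w _; rewrite lee_fin.
  rewrite (le_trans (nX (m + j)%N))// lee_fin -invfM -natrM -expnD addnS //.
have finS m : {ae Q, forall w, S m w \is a fin_num}.
  have iS : Q.-integrable setT (S m).
    apply/integrableP; split => //.
    under eq_integral do rewrite gee0_abs//.
    by rewrite (le_lt_trans (IS m))// ltry.
  by apply: filterS (integrable_ae measurableT iS) => w; exact.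
have mG : measurable [set w | S 0%N w \is a fin_num].
  by rewrite -[X in measurable X]setTI; exact: emeasurable_fin_num.
pose G := [set w | S 0%N w \is a fin_num].
(* With the indicator of [G] the coordinates converge at every point, to 0 where the path length is
   infinite, so the limit is measurable on the whole space. *)
pose x i k w := (\1_G w * X k w 0 i)%R.
have xD i w j : (`|x i j.+1 w - x i j w| <= \1_G w * D j w)%R.
  rewrite /x -mulrBr normrM ger0_norm// ler_wpM2l// /D enormBC.
  by have := coord_le_enorm (X j.+1 w - X j w) i; rewrite !mxE.
have sumG w m k : G w -> (\sum_(0 <= j < k) \1_G w * D (m + j)%N w)%:E <= S m w.
  move=> Gw; rewrite -sumEFin indicE mem_set//.
  under eq_bigr do rewrite mul1r.
  by apply: nneseries_lim_ge => j _ _; rewrite lee_fin.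
have cx i w : cvgn (x i ^~ w).
  have [Gw|Gw] := pselect (G w).
    apply: (@cvg_of_summable _ (fun j => \1_G w * D j w)%R (fine (S 0%N w))) => // k.
    rewrite -lee_fin fineK//; have := sumG w 0%N k Gw.
    by under eq_bigr do rewrite add0n.
  apply/cvg_ex; exists 0%R; rewrite (_ : x i ^~ w = cst 0%R); first exact: cvg_cst.
  by apply/funext => k; rewrite /x indicE memNset// mul0r.
pose Xl w : rV := \row_i limn (x i ^~ w).
have mXl : measurable_fun setT Xl.
  apply: measurable_row => i.
  apply: (@measurable_fun_cvg _ _ _ setT (x i)) => [m|w _].
    apply: measurable_funM; first exact: measurable_indic.
    exact: (measurableT_comp (measurable_coord i)).
  by rewrite mxE; exact: cx.
exists (law Q mXl) => m.
have [_ lm] := gX m.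
rewrite (le_trans (@W_le_integral _ _ _ _ Q (X m) Xl (rho m) (law Q mXl) _ _ lm _))//.
(* Each of the $n$ coordinates of the displacement is at most [S m], which costs the factor $n$ for
   the Euclidean norm. *)
apply: (@le_trans _ _ (\int[Q]_w (n%:R%:E * S m w))); last first.
  rewrite ge0_integralZl_EFin// EFinM; apply: lee_wpmul2l; first by rewrite lee_fin.
  exact: IS.
apply: ae_ge0_le_integral => //.
- by move=> w _; rewrite lee_fin enorm_ge0.
- by apply/measurable_EFinP; exact: measurable_dist.
- by move=> w _; rewrite mule_ge0.
- exact: measurable_funeM.
apply: filterS2 (finS 0%N) (finS m) => w Gw Sm _.
rewrite -(fineK Sm) -EFinM lee_fin; apply: enorm_le_bound; first by rewrite fine_ge0.
move=> i; rewrite !mxE.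
have -> : X m w 0%R i = x i m w by rewrite /x indicE mem_set// mul1r.
have ct : (`|x i m w - x i (m + k)%N w|)%R @[k --> \oo] -->
    (`|x i m w - limn (x i ^~ w)|)%R.
  apply: cvg_norm; apply: cvgB; first exact: cvg_cst.
  under eq_fun do rewrite addnC.
  have := cx i w; rewrite -(cvg_shiftn m); exact.
apply: (cvgr_to_le ct); apply: nearW => k.
rewrite (le_trans (norm_sub_le_sum m k (xD i w)))//.
by rewrite -lee_fin fineK//; exact: sumG.
Qed.
End completeness.

(** * Lattice approximate solutions *)

Section one_step.
Context (R : realType) (n : nat).
Local Notation rV := 'rV[R]_n.
Local Notation P := (probability 'rV[R]_n R).
Local Notation PT := (probability 'TR[R]_n R).
Implicit Types (V : P -> PT) (mu nu : P).

Lemma pvf_fst V mu A : is_pvf V -> measurable A -> V mu (fst @^-1` A) = mu A.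
Proof. by move=> [_ h] mA; have := h mu A mA. Qed.

Lemma pvf_eqm V mu nu : is_pvf V -> mu ≡μ nu -> V mu ≡μ V nu.
Proof. by move=> [h _]; exact: h. Qed.

(** The local Lipschitz condition at a single radius, in terms of closed balls, so that one [K] can
    be fixed for all lattice solutions that stay within [r]. *)
Definition WV_lip V (r K : R) := 0 < K /\ forall mu nu, conc r mu -> conc r nu ->
  (WV (V mu) (V nu) <= K%:E * W mu nu)%E.

Lemma WV_lip_ex V r : locally_WV_lipschitz V -> exists K, WV_lip V r K.
Proof.
(* The hypothesis is about open balls of positive radius; [Num.max r 0 + 1] is positive and strictly
   above [r]. *)
move=> lV; have r0 : 0 < Num.max r 0 + 1 by rewrite ltr_wpDl// le_max lexx orbT.
have [K K0 KP] := lV _ r0; exists K; split => // mu nu cm cn; apply: KP.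
  by apply: conc_Supp_eball cm; rewrite ltr_pwDr// le_max lexx.
by apply: conc_Supp_eball cn; rewrite ltr_pwDr// le_max lexx.
Qed.

(* The infimum defining WV ranges over plans whose positions are optimally
   coupled; finiteness of WV alone provides them. *)
Lemma WV_coupling V r K mu nu a e : is_pvf V -> WV_lip V r K -> conc r mu -> conc r nu ->
  (W mu nu <= a%:E)%E -> 0 < e ->
  exists T : probability ('TR[R]_n * 'TR[R]_n)%type R,
  [/\ coupling (V mu) (V nu) T,
     (\int[T]_z (enorm (z.1.2 - z.2.2)%R)%:E <= (K * a + e)%:E)%E &
     (\int[T]_z (enorm (z.1.1 - z.2.1)%R)%:E <= a%:E)%E].
Proof.
move=> pV [K0 KP] cm cn Wa e0.
have : (WV (V mu) (V nu) < (K * a + e)%:E)%E.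
  rewrite (le_lt_trans (KP _ _ cm cn))//.
  apply: (@le_lt_trans _ _ (K%:E * a%:E)%E).
    by apply: lee_wpmul2l => //; rewrite lee_fin ltW.
  by rewrite -EFinM lte_fin ltrDl.
move=> /ereal_inf_lt[_ [T [cT [coT optT]] <-] lt]; exists T; split => //.
  exact: ltW.
apply: (le_trans _ Wa).
have -> : W mu nu = W (distribution (V mu) (@pi1 R n)) (distribution (V nu) (@pi1 R n)).
  by apply: W_eqm => A mA; have := pV.2 _ A mA => ->.
apply: le_ereal_inf_tmp => _ [tau ctau <-].
rewrite (le_trans _ (optT _ ctau))// /transport_cost.
rewrite (@integral_has_law _ _ _ _ _ T _ (@pi13 R n) (fun z => (enorm (z.1 - z.2)%R)%:E))//.
  by apply/measurable_EFinP; exact: measurable_dist.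
by move=> z; rewrite lee_fin enorm_ge0.
Qed.

(* Each velocity is rounded to the corner v_j of its cell; positions are not
   rounded, since lattice solutions have their positions on the grid. *)
Definition step (N : nat) (t : R) (z : 'TR[R]_n) : rV := z.1 + t *: rnd 1 N z.2.

Lemma measurable_step N t : measurable_fun setT (step N t).
Proof.
apply: measurable_rowD => //; apply: measurable_rowZ.
exact: (measurableT_comp (measurable_rnd 1 N) measurable_snd).
Qed.

(** An Euler step: the map from $\mu^N(l/N)$ to $\mu^N(l/N + t)$ for $0 \le t \le 1/N$. *)
Definition push V N t mu : P := law (V mu) (measurable_step N t).

Lemma push_eqm V N t mu nu : is_pvf V -> mu ≡μ nu -> push V N t mu ≡μ push V N t nu.
Proof.
move=> pV mn A mA; have h := pvf_eqm pV mn.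
have := h (step N t @^-1` A); apply.
by rewrite -[X in measurable X]setTI; exact: measurable_step.
Qed.

Lemma push0 V N mu : is_pvf V -> push V N 0 mu ≡μ mu.
Proof.
move=> pV A mA; apply: (etrans _ (pvf_fst mu pV mA)).
rewrite -[LHS]/(V mu (step N 0 @^-1` A)); congr (V mu _).
by apply/seteqP; split=> z; rewrite /= /step scale0r addr0.
Qed.

Section with_velocity_bound.
Context (V : P -> PT) (C : R) (pV : is_pvf V) (C0 : 0 <= C)
  (sV : support_sublinear C V).

(** Bound for the rounded velocities: the sublinear growth of $V$ on the ball of radius [r] plus the
    rounding error. *)
Definition vel (r : R) (N : nat) := C * (1 + r) + n%:R / N%:R.

(** One exceptional null set for the pointwise estimates: off it the position and the velocity are
    both bounded. *)
Definition escape (r : R) : set 'TR[R]_n :=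
  [set z | r < enorm z.1] `|` [set z | C * (1 + r) < enorm z.2].

Lemma measurable_escape r : measurable (escape r).
Proof.
apply: measurableU.
  exact: (measurable_fst_pre (@measurable_enorm_gt R n r)).
exact: (measurable_snd_pre (@measurable_enorm_gt R n _)).
Qed.

Lemma escape_null r mu : conc r mu -> V mu (escape r) = 0%E.
Proof.
move=> cr; apply/eqP; rewrite eq_le measure_ge0 andbT (le_trans (measureU2 _ _ _))//.
- exact: (measurable_fst_pre (@measurable_enorm_gt R n r)).
- exact: (measurable_snd_pre (@measurable_enorm_gt R n _)).
- rewrite [X in (X + _)%E](_ : _ = 0%E); last first.
    by have := pvf_fst mu pV (@measurable_enorm_gt R n r); rewrite cr.
  by rewrite add0e [X in (X <= _)%E](sublinear_null C0 sV cr).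
Qed.

Lemma not_escape r z : ~ escape r z -> enorm z.1 <= r /\ enorm z.2 <= C * (1 + r).
Proof.
by move=> /not_orP[/negP h1 /negP h2]; split; [rewrite leNgt h1|rewrite leNgt h2].
Qed.

Lemma vel_le r N z : (0 < N)%N -> ~ escape r z -> enorm (rnd 1 N z.2) <= vel r N.
Proof.
move=> N0 /not_escape[_ h]; rewrite (le_trans (enorm_rnd 1 z.2 N0))// expn1 lerD2r.
exact: h.
Qed.

Lemma push_conc r N t mu : (0 < N)%N -> 0 <= t -> conc r mu ->
  conc (r + t * vel r N) (push V N t mu).
Proof.
move=> N0 t0 cr; rewrite /conc -[LHS]/(V mu (step N t @^-1` [set x | r + t * vel r N < enorm x])).
apply: (null_subset _ (measurable_escape r) _ (escape_null cr)).
  rewrite -[X in measurable X]setTI; apply: measurable_step => //.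
  exact: measurable_enorm_gt.
move=> z /= h; apply: contrapT => nz; move: h; apply/negP; rewrite -leNgt.
rewrite /step (le_trans (enorm_triangle _ _))// lerD//; first by case: (not_escape nz).
by rewrite enormZ ger0_norm// ler_wpM2l// vel_le.
Qed.

Lemma vel_ge0 r N mu : conc r mu -> 0 <= vel r N.
Proof.
move=> cr; rewrite /vel addr_ge0 ?divr_ge0// mulr_ge0//.
by rewrite addr_ge0// (conc_ge0 cr).
Qed.

Lemma push_time r N t s mu : (0 < N)%N -> conc r mu ->
  (W (push V N t mu) (push V N s mu) <= (`|t - s| * vel r N)%:E)%E.
Proof.
move=> N0 cr.
have mt := measurable_step N t; have ms := measurable_step N s.
rewrite (le_trans (@W_le_integral _ _ _ _ (V mu) _ _ _ _ mt ms _ _))//.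
apply: (@integral_const_le _ _ _ (V mu) _ _ (escape r)).
- exact: measurable_escape.
- exact: escape_null.
- exact: measurable_dist.
- by move=> w; exact: enorm_ge0.
- by rewrite mulr_ge0// (vel_ge0 _ cr).
- move=> z nz; rewrite /step opprD addrACA subrr add0r -scalerBl enormZ.
  by rewrite ler_wpM2l// vel_le.
Qed.

(** One plan between [V mu] and [V nu] controls everything: $|x-y|$ integrates to at most [a],
    $|v-w|$ to at most [K * a] up to a slack, and rounding both velocities adds at most $2n/N$ to
    their difference. *)
Lemma push_stab r K N t mu nu a : (0 < N)%N -> 0 <= t -> WV_lip V r K ->
  conc r mu -> conc r nu -> (W mu nu <= a%:E)%E ->
  (W (push V N t mu) (push V N t nu) <=
     ((1 + K * t) * a + t * (2 * (n%:R / N%:R)))%:E)%E.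
Proof.
move=> N0 t0 lip cm cn Wa; apply/lee_addgt0Pr => e e0.
(* The slack concerns velocities and is multiplied by [t], so this choice contributes at most
   [e]. *)
have d0 : 0 < e / (t + 1) by rewrite divr_gt0// ltr_wpDl.
have [T [[cT1 cT2] T2 T1]] := WV_coupling pV lip cm cn Wa d0.
have m1 : measurable_fun setT (step N t \o fst : 'TR[R]_n * 'TR[R]_n -> rV).
  by apply: measurableT_comp => //; exact: measurable_step.
have m2 : measurable_fun setT (step N t \o snd : 'TR[R]_n * 'TR[R]_n -> rV).
  by apply: measurableT_comp => //; exact: measurable_step.
rewrite (le_trans (@W_le_integral _ _ _ _ T _ _ _ _ m1 m2 _ _))//.
- move=> A mA; apply: (cT1 (step N t @^-1` A)).
  by rewrite -[X in measurable X]setTI; exact: measurable_step.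
- move=> A mA; apply: (cT2 (step N t @^-1` A)).
  by rewrite -[X in measurable X]setTI; exact: measurable_step.
rewrite (le_trans (@integral_affine_le _ _ _ T _ (fun z => enorm (z.1.1 - z.2.1))
   (fun z => enorm (z.1.2 - z.2.2)) 1 t (t * (2 * (n%:R / N%:R))) set0 _ _ _ _ _ _ _ _ _ _ _ _))//.
- exact: measurable_dist.
- apply: measurable_dist.
    exact: (measurableT_comp measurable_fst measurable_fst).
  exact: (measurableT_comp measurable_fst measurable_snd).
- apply: measurable_dist.
    exact: (measurableT_comp measurable_snd measurable_fst).
  exact: (measurableT_comp measurable_snd measurable_snd).
- by move=> w; exact: enorm_ge0.
- by move=> w; exact: enorm_ge0.
- by move=> w; exact: enorm_ge0.
- by rewrite mulr_ge0// mulr_ge0// divr_ge0.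
- move=> [[x v] [y w]] _ /=; rewrite mul1r /step/= opprD addrACA -scalerBr.
  rewrite (le_trans (enorm_triangle _ _))// -addrA lerD2l enormZ ger0_norm// -mulrDr.
  rewrite ler_wpM2l//.
  have h1 := rnd_le 1 v N0; have h2 := rnd_le 1 w N0; rewrite expn1 in h1 h2.
  rewrite enormBC in h1; have t1 := enorm_sub_triangle (rnd 1 N v) v (rnd 1 N w).
  have t2 := enorm_sub_triangle v w (rnd 1 N w).
  apply: (le_trans t1); apply: (le_trans (lerD h1 t2)).
  rewrite addrCA lerD2l; apply: (le_trans (lerD (lexx _) h2)).
  by rewrite [leRHS]mulr_natl mulr2n.
rewrite mul1e.
apply: (@le_trans _ _ (a%:E + t%:E * (K * a + e / (t + 1))%:E + (t * (2 * (n%:R / N%:R)))%:E)%E).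
  by rewrite leeD2r// leeD// lee_wpmul2l.
rewrite -EFinM -!EFinD lee_fin mulrDr.
have : t * (e / (t + 1)) <= e.
  rewrite mulrA ler_pdivrMr ?ltr_wpDl// mulrC ler_wpM2l ?(ltW e0)// lerDl.
  exact: ler01.
move: (t * (2 * _)) (t * (e / _)) => A B; lra.
Qed.

End with_velocity_bound.
End one_step.

(** * Iterated lattice steps: supports, stability and dependence on time *)

Section lattice_dynamics.
Context (R : realType) (n : nat).
Local Notation rV := 'rV[R]_n.
Local Notation P := (probability 'rV[R]_n R).
Local Notation PT := (probability 'TR[R]_n R).
Context (V : P -> PT) (C : R) (pV : is_pvf V) (C0 : 0 <= C)
  (sV : support_sublinear C V).

(* The lattice solution as iterated pushforwards, hence a probability for every
   N; it satisfies is_LAS only when no mass leaves the grids. *)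
Fixpoint Ldisc (N : nat) (mu : P) (l : nat) : P :=
  if l is l'.+1 then push V N (N%:R^-1) (Ldisc N mu l') else rlaw 2 N mu.

Definition Lcan (N : nat) (mu : P) (t : R) : P :=
  let l := Num.truncn (t * N%:R) in push V N (t - l%:R / N%:R) (Ldisc N mu l).

(** The case $s = 1/N$ needs care: the truncation then returns $l+1$, and the curve is the next node
    followed by a push of length 0, which is the identity up to [≡μ]. *)
Lemma Lcan_push N mu l s : (0 < N)%N -> 0 <= s <= N%:R^-1 ->
  Lcan N mu (l%:R / N%:R + s) ≡μ push V N s (Ldisc N mu l).
Proof.
move=> N0 /andP[s0]; have N0' : 0 < N%:R :> R by rewrite ltr0n.
rewrite le_eqVlt => /orP[/eqP ->|sN].
  have -> : l%:R / N%:R + N%:R^-1 = l.+1%:R / N%:R :> R.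
    by rewrite -natr1 mulrDl mul1r.
  rewrite /Lcan divfK ?gt_eqF// natrK subrr.
  exact: push0.
rewrite /Lcan (@truncn_def _ _ l); last first.
  rewrite mulrDl divfK ?gt_eqF// lerDl mulr_ge0 ?(ltW N0')//= -natr1 ltrD2l.
  by rewrite -ltr_pdivlMr// mul1r.
by rewrite addrAC subrr add0r.
Qed.

Lemma Lcan_disc N mu l : (0 < N)%N -> Lcan N mu (l%:R / N%:R) ≡μ Ldisc N mu l.
Proof.
move=> N0 A mA; have := @Lcan_push N mu l 0 N0; rewrite lexx invr_ge0 ler0n addr0.
by move=> /(_ isT A mA) ->; exact: push0.
Qed.

Lemma time_decomp (N : nat) (t : R) : (0 < N)%N -> 0 <= t ->
  exists (l : nat) (s : R), [/\ t = l%:R / N%:R + s, 0 <= s <= N%:R^-1 & l%:R / N%:R <= t].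
Proof.
move=> N0 t0; have N0' : 0 < N%:R :> R by rewrite ltr0n.
exists (Num.truncn (t * N%:R)), (t - (Num.truncn (t * N%:R))%:R / N%:R).
have /truncn_itv/andP[h1 h2] : 0 <= t * N%:R by rewrite mulr_ge0// ltW.
have h3 : (Num.truncn (t * N%:R))%:R / N%:R <= t by rewrite ler_pdivrMr.
split => //; first by rewrite addrC subrK.
rewrite subr_ge0 h3/= lerBlDl -[X in _ + X]mul1r -mulrDl natr1.
by rewrite ler_pdivlMr// ltW.
Qed.

(* Discrete Gronwall bound for a quantity that starts below B + c and grows in
   time s from x to at most (1 + K s) x + s c. *)
Definition growth (K B c t : R) := expR (K * t) * (B + (1 + t) * c).

(** $1 + Ks \le e^{Ks}$ absorbs the multiplicative part. The term $sc$ is the increment of $(1+t)c$,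
    and the exponential in front of it is at least 1. *)
Lemma growth_step K B c t s : 0 <= K -> 0 <= B -> 0 <= c -> 0 <= t -> 0 <= s ->
  (1 + K * s) * growth K B c t + s * c <= growth K B c (t + s).
Proof.
move=> K0 B0 c0 t0 s0; rewrite /growth [K * (t + s)]mulrDr expRD.
have h : (1 + K * s) <= expR (K * s) by exact: expR_ge1Dx.
have e1 : 1 <= expR (K * t) by rewrite -expR0 ler_expR mulr_ge0.
have e2 : 1 <= expR (K * s) by rewrite -expR0 ler_expR mulr_ge0.
have -> : B + (1 + (t + s)) * c = (B + (1 + t) * c) + s * c by ring.
rewrite [leRHS]mulrDr lerD//.
  rewrite mulrCA -mulrA ler_wpM2l ?expR_ge0// ler_wpM2r//.
  by rewrite addr_ge0// mulr_ge0// addr_ge0.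
rewrite ler_peMl ?mulr_ge0// -[leLHS]mulr1 ler_pM//.
Qed.

Lemma growth_ge0 K B c t : 0 <= B -> 0 <= c -> 0 <= t -> 0 <= growth K B c t.
Proof. by move=> *; rewrite mulr_ge0 ?expR_ge0// addr_ge0// mulr_ge0// addr_ge0. Qed.

Lemma growth_le K B c c' t t' : 0 <= K -> 0 <= B -> 0 <= c -> c <= c' -> 0 <= t ->
  t <= t' -> growth K B c t <= growth K B c' t'.
Proof.
move=> K0 B0 c0 cc t0 tt; have t0' := le_trans t0 tt.
rewrite ler_pM ?expR_ge0 ?ler_expR ?ler_wpM2l//.
  by rewrite addr_ge0// mulr_ge0// addr_ge0.
by rewrite lerD2l ler_pM ?addr_ge0// lerD2l.
Qed.

Lemma ratio_le1 N : (0 < N)%N -> n%:R / N%:R <= n%:R :> R.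
Proof.
move=> N0; rewrite ler_pdivrMr ?ltr0n// ler_peMr ?ler0n//.
by rewrite -[1]/(1%:R) ler_nat.
Qed.

Lemma ratio_sqr N : (0 < N)%N -> n%:R / (N ^ 2)%:R <= n%:R / N%:R :> R.
Proof.
move=> N0; rewrite ler_wpM2l ?ler0n// lef_pV2 ?posrE ?ltr0n ?expn_gt0 ?N0//.
by rewrite ler_nat expnS expn1 leq_pmulr.
Qed.

(** If $\rho$ is a radius, one step of length $s$ adds $s(C(1+\rho) + n/N)$ to it, so $1+\rho$ obeys
    the recursion of [growth] with $K = C$ and $c = n/N$. *)
Definition bnd (r : R) (N : nat) (t : R) := growth C (1 + r) (n%:R / N%:R) t - 1.

Lemma bnd_step r N t s : 0 <= r -> 0 <= t -> 0 <= s ->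
  bnd r N t + s * vel n C (bnd r N t) N <= bnd r N (t + s).
Proof.
move=> r0 t0 s0; rewrite /bnd /vel.
have c0 : 0 <= n%:R / N%:R :> R by rewrite divr_ge0.
have := @growth_step C (1 + r) _ t s C0 (addr_ge0 ler01 r0) c0 t0 s0.
set a := growth _ _ _ t; set b := growth _ _ _ (t + s); set c := n%:R / N%:R; lra.
Qed.

Lemma Ldisc_conc r N mu l : (0 < N)%N -> 0 <= r -> conc r mu ->
  conc (bnd r N (l%:R / N%:R)) (Ldisc N mu l).
Proof.
move=> N0 r0 cr; elim: l => [|l ih].
  apply: conc_le (rlaw_conc 2 N0 cr); rewrite mul0r /bnd /growth mulr0 expR0.
  have := ratio_sqr N0; move: (n%:R / (N ^ 2)%:R : R) (n%:R / N%:R : R) => a b; lra.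
have := push_conc pV C0 sV N0 _ ih; move=> /(_ N%:R^-1).
rewrite invr_ge0 ler0n => /(_ isT); apply: conc_le.
have := @bnd_step r N (l%:R / N%:R) N%:R^-1 r0.
rewrite divr_ge0 ?ler0n// invr_ge0 ler0n => /(_ isT isT) h.
by apply: (le_trans h); rewrite -natr1 mulrDl mul1r.
Qed.

Lemma Lcan_conc r N mu t : (0 < N)%N -> 0 <= r -> 0 <= t -> conc r mu ->
  conc (bnd r N t) (Lcan N mu t).
Proof.
move=> N0 r0 t0 cr; have [l [s [tE sN _]]] := time_decomp N0 t0.
rewrite tE; have /andP[s0 _] := sN.
have e : push V N s (Ldisc N mu l) ≡μ Lcan N mu (l%:R / N%:R + s).
  by move=> A mA; apply/esym; exact: Lcan_push.
apply: (conc_eqm e).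
apply: conc_le (push_conc pV C0 sV N0 s0 (Ldisc_conc l N0 r0 cr)).
by apply: bnd_step => //; rewrite divr_ge0.
Qed.

(** Radius common to all $N \ge 1$ and all times up to [T]: in [bnd], the term $n/N$ is replaced by
    $n$ and the $-1$ is dropped. [Mvel] is the corresponding bound for the speed. *)
Definition Rmax (T r : R) := growth C (1 + r) n%:R T.
Definition Mvel (T r : R) := C * (1 + Rmax T r) + n%:R.

Lemma bnd_Rmax T r N t : (0 < N)%N -> 0 <= r -> 0 <= t -> t <= T -> bnd r N t <= Rmax T r.
Proof.
move=> N0 r0 t0 tT; rewrite /bnd lerBlDr ler_wpDr//.
by rewrite growth_le ?addr_ge0 ?divr_ge0 ?ratio_le1.
Qed.

Lemma Rmax_ge T r : 0 <= r -> 0 <= T -> r <= Rmax T r.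
Proof.
move=> r0 T0; rewrite /Rmax /growth.
have e1 : 1 <= expR (C * T) by rewrite -expR0 ler_expR mulr_ge0.
apply: (@le_trans _ _ (1 + r + (1 + T) * n%:R)).
  by rewrite addrAC lerDr addr_ge0// mulr_ge0// addr_ge0.
by rewrite ler_peMl// addr_ge0 ?addr_ge0// mulr_ge0// addr_ge0.
Qed.

Lemma vel_Mvel T r N : (0 < N)%N -> vel n C (Rmax T r) N <= Mvel T r.
Proof. by move=> N0; rewrite lerD2l ratio_le1. Qed.

Context (T : R) (T0 : 0 <= T).

Lemma Ldisc_Rmax r N mu l : (0 < N)%N -> 0 <= r -> conc r mu -> l%:R / N%:R <= T ->
  conc (Rmax T r) (Ldisc N mu l).
Proof.
move=> N0 r0 cr lT; apply: conc_le (Ldisc_conc l N0 r0 cr).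
by apply: bnd_Rmax => //; rewrite divr_ge0.
Qed.

Lemma Lcan_Rmax r N mu t : (0 < N)%N -> 0 <= r -> conc r mu -> 0 <= t -> t <= T ->
  conc (Rmax T r) (Lcan N mu t).
Proof.
move=> N0 r0 cr t0 tT; apply: conc_le (Lcan_conc N0 r0 t0 cr).
exact: bnd_Rmax.
Qed.

(** In the factor $1 + t$ of [growth], the 1 pays for rounding the two initial data, at mesh
    $N^{-2}$, and $t$ for rounding the velocities. *)
Lemma Ldisc_stab r K N mu nu a l : (0 < N)%N -> 0 <= r -> 0 <= a ->
  WV_lip V (Rmax T r) K -> conc r mu -> conc r nu -> (W mu nu <= a%:E)%E ->
  l%:R / N%:R <= T ->
  (W (Ldisc N mu l) (Ldisc N nu l) <=
    (growth K a (2 * (n%:R / N%:R)) (l%:R / N%:R))%:E)%E.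
Proof.
move=> N0 r0 a0 lip cm cn Wa; have [K0 _] := lip.
have c0 : 0 <= 2 * (n%:R / N%:R) :> R by rewrite mulr_ge0// divr_ge0.
elim: l => [_|l ih lT].
  rewrite mul0r /growth mulr0 expR0 addr0 !mul1r.
  rewrite (le_trans (W_rlaw2_le 2 _ _ N0))// EFinD leeD//.
  by rewrite lee_fin ler_wpM2l// ratio_sqr.
have lT' : l%:R / N%:R <= T.
  by rewrite (le_trans _ lT)// ler_wpM2r ?invr_ge0// ler_nat.
have iN : 0 <= N%:R^-1 :> R by rewrite invr_ge0.
have := push_stab pV N0 iN lip (Ldisc_Rmax N0 r0 cm lT') (Ldisc_Rmax N0 r0 cn lT') (ih lT').
move=> /le_trans; apply; rewrite lee_fin.
have := @growth_step K a _ (l%:R / N%:R) N%:R^-1 (ltW K0) a0 c0.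
rewrite divr_ge0// => /(_ isT iN) /le_trans; apply.
by rewrite -[l.+1%:R]natr1 [(l%:R + 1) / _]mulrDl mul1r.
Qed.

Lemma Lcan_stab r K N mu nu a t : (0 < N)%N -> 0 <= r -> 0 <= a ->
  WV_lip V (Rmax T r) K -> conc r mu -> conc r nu -> (W mu nu <= a%:E)%E ->
  0 <= t -> t <= T ->
  (W (Lcan N mu t) (Lcan N nu t) <= (growth K a (2 * (n%:R / N%:R)) t)%:E)%E.
Proof.
move=> N0 r0 a0 lip cm cn Wa t0 tT; have [K0 _] := lip.
have [l [s [tE sN lt]]] := time_decomp N0 t0.
have lT := le_trans lt tT; have /andP[s0 _] := sN.
have c0 : 0 <= 2 * (n%:R / N%:R) :> R by rewrite mulr_ge0// divr_ge0.
rewrite tE (W_eqm (Lcan_push mu l N0 sN) (Lcan_push nu l N0 sN)).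
have := push_stab pV N0 s0 lip (Ldisc_Rmax N0 r0 cm lT) (Ldisc_Rmax N0 r0 cn lT)
  (Ldisc_stab N0 r0 a0 lip cm cn Wa lT).
move=> /le_trans; apply; rewrite lee_fin.
by apply: growth_step => //; exact: ltW.
Qed.

Lemma push_time_Mvel r N t s mu : (0 < N)%N -> conc (Rmax T r) mu ->
  (W (push V N t mu) (push V N s mu) <= (`|t - s| * Mvel T r)%:E)%E.
Proof.
move=> N0 cm; rewrite (le_trans (push_time pV C0 sV _ _ N0 cm))//.
by rewrite lee_fin ler_wpM2l// vel_Mvel.
Qed.

Lemma Mvel_ge0 r : 0 <= r -> 0 <= Mvel T r.
Proof.
move=> r0; rewrite /Mvel addr_ge0// mulr_ge0// addr_ge0// growth_ge0// addr_ge0//.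
Qed.

(** Path lengths add up over the steps, so the Lipschitz constant in time does not depend on their
    number. The induction descends from the node to the interval that contains [s]. *)
Lemma Lcan_disc_time r N mu s l : (0 < N)%N -> 0 <= r -> conc r mu ->
  0 <= s -> s <= l%:R / N%:R -> l%:R / N%:R <= T ->
  (W (Lcan N mu s) (Ldisc N mu l) <= ((l%:R / N%:R - s) * Mvel T r)%:E)%E.
Proof.
move=> N0 r0 cr s0; have N0' : 0 < N%:R :> R by rewrite ltr0n.
elim: l => [|l ih] sl lT.
  have -> : s = 0 by apply/eqP; rewrite eq_le s0 andbT (le_trans sl)// mul0r.
  rewrite mul0r subrr mul0r W_refl//.
  by have := Lcan_disc mu 0 N0; rewrite mul0r.
have lE : l.+1%:R / N%:R = l%:R / N%:R + N%:R^-1 :> R by rewrite -natr1 mulrDl mul1r.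
have lT' : l%:R / N%:R <= T.
  by rewrite (le_trans _ lT)// ler_wpM2r ?invr_ge0// ler_nat.
have cl := Ldisc_Rmax N0 r0 cr lT'.
have [sl'|ls] := leP s (l%:R / N%:R).
  have h1 : (W (Ldisc N mu l) (Ldisc N mu l.+1) <= (N%:R^-1 * Mvel T r)%:E)%E.
    rewrite (@W_eqm _ _ _ (push V N 0 (Ldisc N mu l)) _ (Ldisc N mu l.+1))//; last first.
      by move=> A mA; rewrite (push0 N (Ldisc N mu l) pV mA).
    have := @push_time_Mvel r N 0 N%:R^-1 (Ldisc N mu l) N0 cl.
    by rewrite sub0r normrN gtr0_norm// invr_gt0.
  rewrite (le_trans (W_triangle _ _ cl))// (le_trans (leeD (ih sl' lT') h1))//.
  by rewrite -EFinD lee_fin -mulrDl lE addrAC.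
have sE : s = l%:R / N%:R + (s - l%:R / N%:R) by rewrite addrC subrK.
have sN : 0 <= s - l%:R / N%:R <= N%:R^-1.
  by rewrite subr_ge0 (ltW ls)/= lerBlDl -lE.
rewrite [X in W (Lcan N mu X)]sE (W_eqm (Lcan_push mu l N0 sN) (fun _ _ => erefl)).
rewrite (le_trans (@push_time_Mvel r N _ N%:R^-1 (Ldisc N mu l) N0 cl))//.
rewrite lee_fin ler0_norm ?subr_le0; last by case/andP : sN.
by rewrite opprB lE opprB addrCA addrA.
Qed.

Lemma Lcan_time r N mu s t : (0 < N)%N -> 0 <= r -> conc r mu ->
  0 <= s -> s <= t -> t <= T ->
  (W (Lcan N mu s) (Lcan N mu t) <= ((t - s) * Mvel T r)%:E)%E.
Proof.
move=> N0 r0 cr s0 st tT; have t0 := le_trans s0 st.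
have [l [h [tE hN lt]]] := time_decomp N0 t0.
have lT := le_trans lt tT; have cl := Ldisc_Rmax N0 r0 cr lT.
have [sl|ls] := leP s (l%:R / N%:R).
  have h1 : (W (Ldisc N mu l) (Lcan N mu t) <= (h * Mvel T r)%:E)%E.
    rewrite (@W_eqm _ _ _ (push V N 0 (Ldisc N mu l)) _ (push V N h (Ldisc N mu l))).
    - have := @push_time_Mvel r N 0 h (Ldisc N mu l) N0 cl.
      by rewrite sub0r normrN ger0_norm//; case/andP : hN.
    - by move=> A mA; rewrite (push0 N (Ldisc N mu l) pV mA).
    - by rewrite tE; exact: Lcan_push.
  rewrite (le_trans (W_triangle _ _ cl))//.
  rewrite (le_trans (leeD (Lcan_disc_time N0 r0 cr s0 sl lT) h1))//.
  by rewrite -EFinD lee_fin -mulrDl tE addrAC.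
have sE : s = l%:R / N%:R + (s - l%:R / N%:R) by rewrite addrC subrK.
have sN : 0 <= s - l%:R / N%:R <= N%:R^-1.
  rewrite subr_ge0 (ltW ls)/= lerBlDl (le_trans st)// tE lerD2l.
  by case/andP : hN.
rewrite (@W_eqm _ _ _ (push V N (s - l%:R / N%:R) (Ldisc N mu l)) _ (push V N h (Ldisc N mu l))).
- rewrite (le_trans (@push_time_Mvel r N _ h (Ldisc N mu l) N0 cl))//.
  rewrite lee_fin distrC ger0_norm.
    by rewrite ler_wpM2r ?Mvel_ge0// tE opprB addrCA addrA.
  by rewrite subr_ge0 lerBlDl -tE.
- by rewrite {1}sE; exact: Lcan_push.
- by rewrite tE; exact: Lcan_push.
Qed.

Lemma rlaw_grid p N (mu : P) : (0 < N)%N -> mu (~` [set x | on_grid p N x]) = 0%E ->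
  rlaw p N mu ≡μ mu.
Proof.
move=> N0 g0 A mA; have mg := @measurable_on_grid R n p N N0.
have mr : measurable (rnd p N @^-1` A).
  by rewrite -[X in measurable X]setTI; exact: measurable_rnd.
have cut (B : set rV) : measurable B -> mu B = mu (B `&` [set x | on_grid p N x]).
  move=> mB; rewrite -[in LHS](setIT B) -(setUv [set x | on_grid p N x]) setIUr.
  rewrite measureU//; last 3 first.
  - exact: measurableI.
  - by apply: measurableI => //; exact: measurableC.
  - by rewrite setIACA setICr setI0.
  rewrite [X in (_ + X)%E](_ : _ = 0%E) ?adde0//.
  apply: (null_subset _ _ (@subIsetr _ _ _) g0); last exact: measurableC.
  by apply: measurableI => //; exact: measurableC.
rewrite -[LHS]/(mu (rnd p N @^-1` A)) cut// [RHS]cut//; congr (mu _).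
by apply/seteqP; split=> x [/= Ax gx]; split => //; move: Ax; rewrite /= rnd_on_grid.
Qed.

(** This is where the two meshes fit together: a velocity in $\mathbb{Z}/N$ during a time $1/N$ is a
    displacement in $\mathbb{Z}/N^2$, so positions never leave the lattice. *)
Lemma Ldisc_grid N mu l : (0 < N)%N -> Ldisc N mu l (~` [set x | on_grid 2 N x]) = 0%E.
Proof.
move=> N0; have mg := @measurable_on_grid R n 2 N N0.
elim: l => [|l ih]; first exact: rlaw_on_grid.
rewrite /= -[LHS]/(V (Ldisc N mu l) (step N (N%:R^-1) @^-1` (~` [set x | on_grid 2 N x]))).
have h : V (Ldisc N mu l) (fst @^-1` (~` [set x | on_grid 2 N x])) = 0%E.
  by rewrite (etrans (pvf_fst _ pV (measurableC mg)) ih).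
apply: (null_subset _ _ _ h).
- by rewrite -[X in measurable X]setTI; apply: measurable_step => //; exact: measurableC.
- by apply: measurable_fst_pre; exact: measurableC.
- move=> z /= ng gz; apply: ng => i; have [k kE] := gz i.
  exists (k + Num.floor (z.2 0 i * (N ^ 1)%:R)).
  rewrite /step !mxE kE intrD mulrDl; congr (_ + _).
  by rewrite expn1 expnS expn1 natrM invfM mulrCA.
Qed.

(** A restart rounds its initial datum again, which changes nothing for a measure already carried by
    the lattice. *)
Lemma Ldisc_restart N mu l k : (0 < N)%N ->
  Ldisc N (Ldisc N mu l) k ≡μ Ldisc N mu (l + k).
Proof.
move=> N0; elim: k => [|k ih].
  by rewrite addn0; apply: rlaw_grid => //; exact: Ldisc_grid.
by rewrite addnS /=; exact: push_eqm.
Qed.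

Lemma Lcan_restart N mu l t : (0 < N)%N -> 0 <= t ->
  Lcan N (Ldisc N mu l) t ≡μ Lcan N mu (l%:R / N%:R + t).
Proof.
move=> N0 t0 A mA; have [k [s [tE sN _]]] := time_decomp N0 t0.
rewrite tE (Lcan_push _ _ N0 sN mA) addrA -mulrDl -natrD.
rewrite (Lcan_push _ _ N0 sN mA).
by apply: (push_eqm _ _ pV) mA; exact: Ldisc_restart.
Qed.

End lattice_dynamics.

(** * The explicit curve as a Lattice Approximate Solution *)

Section lattice_solutions.
Context (R : realType) (n : nat).
Local Notation rV := 'rV[R]_n.
Local Notation P := (probability 'rV[R]_n R).
Local Notation PT := (probability 'TR[R]_n R).

(** Rounding and the lattice step are constant on each of finitely many disjoint cells that carry
    all the mass. Both formulas of [is_LAS] are instances. *)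
Lemma discrete_law d (Om : measurableType d) (Q : {measure set Om -> \bar R}) (I : finType)
    (E : I -> set Om) (f : Om -> rV) (p : I -> rV) (A : set rV) :
  (forall i, measurable (E i)) -> trivIset setT E -> Q (~` \bigcup_i E i) = 0%E ->
  measurable_fun setT f -> (forall i w, E i w -> f w = p i) -> measurable A ->
  Q (f @^-1` A) = (\sum_i Q (E i) * \d_(p i) A)%E.
Proof.
move=> mE tE E0 mf fE mA.
rewrite (@fin_decomp _ _ _ _ Q E)//; last by rewrite -[X in measurable X]setTI; exact: mf.
apply: eq_bigr => i _; rewrite diracE; case: (boolP (p i \in A)) => [/set_mem pA|/negP pA].
  rewrite mule1; congr (Q _); apply/seteqP; split=> [w []//|w Ew].
  by split => //=; rewrite (fE _ _ Ew).
rewrite mule0 (_ : _ `&` _ = set0) ?measure0//.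
by apply/seteqP; split=> // w [/= Af Ew]; apply: pA; rewrite -(fE _ _ Ew); exact: mem_set.
Qed.

Lemma grid_cellE p N (k : grid_idx n p N) : (0 < N)%N ->
  @grid_cell R n p N k = rnd p N @^-1` [set grid_pt R k].
Proof.
move=> N0; have N0' : 0 < (N ^ p)%:R :> R by rewrite ltr0n expn_gt0 N0.
apply/seteqP; split=> [y ky|y /= ky i]; last by rewrite -ky rnd_itv.
apply/rowP => i; have := ky i; rewrite !mxE => /andP[h1 h2]; congr (_ / _).
have -> : (k i)%:R - (N ^ p.+1)%:R = ((k i)%:Z - (N ^ p.+1)%:Z)%:~R :> R.
  by rewrite intrB.
congr (_%:~R); apply: floor_def; rewrite [(_ + 1)%:~R]intrD !intrB /=; apply/andP; split.
  by rewrite -ler_pdivrMr.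
by rewrite -ltr_pdivlMr// mulrDl mul1r.
Qed.

Lemma grid_pt_inj p N : (0 < N)%N -> injective (@grid_pt R n p N).
Proof.
move=> N0 k k' /rowP kk; have N0' : (N ^ p)%:R != 0 :> R.
  by rewrite pnatr_eq0 -lt0n expn_gt0 N0.
apply/ffunP => i; have := kk i; rewrite !mxE => /(mulIf (invr_neq0 N0')) /addIr.
by move=> /eqP; rewrite eqr_nat => /eqP/val_inj.
Qed.

Lemma measurable_grid_cell p N (k : grid_idx n p N) : (0 < N)%N ->
  measurable (@grid_cell R n p N k).
Proof.
move=> N0; rewrite grid_cellE// -[X in measurable X]setTI.
by apply: measurable_rnd => //; exact: measurable_set1_row.
Qed.

Lemma grid_cell_ex p N (y : rV) : (0 < N)%N -> enorm y < N%:R ->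
  exists k : grid_idx n p N, rnd p N y = grid_pt R k.
Proof.
move=> N0 yN; have N0' : 0 < (N ^ p)%:R :> R by rewrite ltr0n expn_gt0 N0.
pose M := (N ^ p.+1)%N.
have zM i : (- M%:Z <= Num.floor (y 0 i * (N ^ p)%:R) <= M%:Z).
  have : `|y 0 i * (N ^ p)%:R| < M%:R.
    rewrite normrM (ger0_norm (ltW N0')) /M expnS natrM ltr_pM2r//.
    by rewrite (le_lt_trans (coord_le_enorm y i)).
  rewrite ltr_norml => /andP[h1 h2].
  rewrite floor_ge_int intrN (ltW h1)/= -(ler_int R).
  by rewrite (le_trans (floor_le _))// ltW.
have zM0 i : 0 <= Num.floor (y 0 i * (N ^ p)%:R) + M%:Z.
  by have /andP[h _] := zM i; rewrite -lerBlDr sub0r.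
have kM i : (absz (Num.floor (y 0 i * (N ^ p)%:R) + M%:Z)%R < M.*2.+1)%N.
  rewrite ltnS -lez_nat gez0_abs// -addnn PoszD lerD2r.
  by case/andP : (zM i).
exists [ffun i => Ordinal (kM i)]; apply/rowP => i; rewrite !mxE ffunE /=.
congr (_ / _).
rewrite -[(absz _)%:R]/((Posz (absz (Num.floor (y 0 i * (N ^ p)%:R) + M%:Z)))%:~R) gez0_abs//.
by rewrite intrD addrK.
Qed.

Context (V : P -> PT) (C T : R) (pV : is_pvf V) (C0 : 0 <= C)
  (sV : support_sublinear C V) (T0 : 0 <= T).

(** Once the uniform bounds on positions and on velocities are below [N], every point that carries
    mass falls into a cell of the finite grids, so no mass is lost in the double sum. *)
Lemma is_LAS_Lcan r N mu : (0 < N)%N -> 0 <= r -> conc r mu ->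
  Rmax n C T r < N%:R -> C * (1 + Rmax n C T r) < N%:R ->
  is_LAS T V mu N (Lcan V N mu).
Proof.
move=> N0 r0 cr RN CN.
have rN : r < N%:R by apply: le_lt_trans RN; exact: Rmax_ge.
split=> [A mA|l t tN lT A mA].
  have := Lcan_disc pV mu 0 N0; rewrite mul0r => /(_ A mA) ->.
  apply: (@discrete_law _ _ mu _ (@grid_cell R n 2 N) (rnd 2 N)) => //.
  - by move=> k; exact: measurable_grid_cell.
  - move=> k k' _ _ [y []]; rewrite !grid_cellE//= => -> ; exact: grid_pt_inj.
  - apply: (null_subset _ _ _ cr).
    + by apply: measurableC; apply: fin_bigcup_measurable => // k _; exact: measurable_grid_cell.
    + exact: measurable_enorm_gt.
    + move=> y ny /=; rewrite ltNge; apply/negP => yr; apply: ny.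
      have [k kE] := grid_cell_ex 2 N0 (le_lt_trans yr rN).
      by exists k => //; rewrite grid_cellE.
  - exact: measurable_rnd.
  - by move=> k w; rewrite grid_cellE.
have lT' : l%:R / N%:R <= T.
  by case/andP : tN => t0 _; rewrite (le_trans _ lT)// lerDl.
set nu := Ldisc V N mu l.
have cnu : conc (Rmax n C T r) nu by exact: Ldisc_Rmax.
have gnu : nu (~` [set x | on_grid 2 N x]) = 0%E by exact: Ldisc_grid.
have Vnu : V (Lcan V N mu (l%:R / N%:R)) ≡μ V nu.
  by apply: pvf_eqm => //; exact: Lcan_disc.
rewrite (Lcan_push pV mu l N0 tN mA).
pose E (ij : grid_idx n 2 N * grid_idx n 1 N) : set 'TR[R]_n :=
  [set grid_pt R ij.1] `*` grid_cell ij.2.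
have mE ij : measurable (E ij).
  by apply: measurableX; [exact: measurable_set1_row|exact: measurable_grid_cell].
rewrite pair_big/= (eq_bigr (fun ij => V nu (E ij) *
    \d_(grid_pt R ij.1 + t *: grid_pt R ij.2)%R A)%E); last first.
  by move=> ij _; congr (_ * _)%E; apply: Vnu; exact: mE.
rewrite -[LHS]/(V nu (step N t @^-1` A)).
have mg2 := @measurable_on_grid R n 2 N N0.
apply: (@discrete_law _ _ (V nu) _ E (step N t)
  (fun ij => grid_pt R ij.1 + t *: grid_pt R ij.2)) => //.
- move=> [i j] [i' j'] _ _ [[x v] []]; rewrite /E/= !grid_cellE//=.
  by move=> [/= -> ->] [/= /(grid_pt_inj N0) -> /(grid_pt_inj N0) ->].
- apply: (@null_subset _ _ _ (V nu) _ (escape C (Rmax n C T r) `|`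
    fst @^-1` (~` [set x | on_grid 2 N x]))).
  + by apply: measurableC; exact: fin_bigcup_measurable.
  + apply: measurableU; first exact: measurable_escape.
    by apply: measurable_fst_pre; exact: measurableC.
  + move=> [x v] nE; apply: contrapT => /not_orP[/not_escape[/= xR vR] /contrapT /= gx].
    apply: nE.
    have [i iE] := grid_cell_ex 2 N0 (le_lt_trans xR RN).
    have [j jE] := grid_cell_ex 1 N0 (le_lt_trans vR CN).
    exists (i, j) => //; split => /=; last by rewrite grid_cellE.
    by rewrite -iE rnd_on_grid.
  + apply/eqP; rewrite eq_le measure_ge0 andbT (le_trans (measureU2 _ _ _))//.
    * exact: measurable_escape.
    * by apply: measurable_fst_pre; exact: measurableC.
    * rewrite [X in (X + _)%E](escape_null pV C0 sV cnu) add0e.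
      by rewrite [X in (X <= _)%E](etrans (pvf_fst nu pV (measurableC mg2)) gnu).
- exact: measurable_step.
- move=> [i j] [x v]; rewrite /E/= grid_cellE//= => -[/= -> vj].
  by rewrite /step/= vj.
Qed.

(** Needed because [LAS_cvg] only provides some curve satisfying [is_LAS]. The equations fix the
    measures on Borel sets, and $V$ respects [≡μ], so the recursion carries equality from node to
    node. *)
Lemma is_LAS_unique N mu (m m' : R -> P) t : (0 < N)%N ->
  is_LAS T V mu N m -> is_LAS T V mu N m' -> 0 <= t -> t <= T -> m t ≡μ m' t.
Proof.
move=> N0 [m0 mS] [m0' mS'] t0 tT.
have key l s : m (l%:R / N%:R) ≡μ m' (l%:R / N%:R) -> 0 <= s <= N%:R^-1 ->
    l%:R / N%:R + s <= T -> m (l%:R / N%:R + s) ≡μ m' (l%:R / N%:R + s).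
  move=> h sN lT A mA; apply: (etrans (mS _ _ sN lT A mA)).
  apply/esym; apply: (etrans (mS' _ _ sN lT A mA)); apply/esym.
  apply: eq_bigr => i _; apply: eq_bigr => j _; congr (_ * _)%E.
  apply: (pvf_eqm pV h); apply: measurableX; first exact: measurable_set1_row.
  exact: measurable_grid_cell.
have disc l : l%:R / N%:R <= T -> m (l%:R / N%:R) ≡μ m' (l%:R / N%:R).
  elim: l => [_|l ih lT]; first by rewrite mul0r => A mA; exact: (etrans (m0 A mA) (esym (m0' A mA))).
  have lE : l.+1%:R / N%:R = l%:R / N%:R + N%:R^-1 :> R by rewrite -natr1 mulrDl mul1r.
  rewrite lE in lT *; apply: key => //.
    by apply: ih; rewrite (le_trans _ lT)// lerDl invr_ge0.
  by rewrite invr_ge0 ler0n lexx.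
have [l [s [tE sN lt]]] := time_decomp N0 t0; rewrite tE in tT *.
apply: key => //; apply: disc; apply: le_trans tT.
by rewrite lerDl; case/andP : sN.
Qed.

End lattice_solutions.

(** * Limits of Cauchy sequences of measures *)

Section cauchy_limits.
Context (R : realType) (n : nat).
Local Notation rV := 'rV[R]_n.
Local Notation P := (probability 'rV[R]_n R).

Lemma near_ratio_le (x e : R) : 0 < e -> \forall N \near \oo, x / N%:R <= e.
Proof.
move=> e0; exists (Num.truncn (`|x| / e)).+1 => // N /= xN.
have N0 : 0 < N%:R :> R by rewrite ltr0n (leq_trans _ xN).
rewrite ler_pdivrMr// (le_trans (ler_norm x))// -ler_pdivrMl// mulrC.
by rewrite (le_trans (ltW (truncnS_gt _)))// ler_nat.
Qed.

Lemma near_pos : \forall N \near \oo, (0 < N)%N.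
Proof. by exists 1%N. Qed.

Lemma near_nat_gt (x : R) : \forall N \near \oo, x < N%:R.
Proof.
exists (Num.truncn x).+1 => // N /= xN.
by rewrite (lt_le_trans (truncnS_gt _))// ler_nat.
Qed.

Lemma growth_small (K T e : R) : 0 <= K -> 0 <= T -> 0 < e ->
  exists2 d, 0 < d & forall a c t, 0 <= a <= d -> 0 <= c <= d -> 0 <= t <= T ->
    growth K a c t <= e.
Proof.
move=> K0 T0 e0; exists (e / (expR (K * T) * (2 + T))).
  by rewrite divr_gt0// mulr_gt0 ?expR_gt0// ltr_wpDr.
move=> a c t /andP[a0 ad] /andP[c0 cd] /andP[t0 tT].
set d := e / _ in ad cd.
apply: (@le_trans _ _ (expR (K * T) * (d + (1 + T) * d))).
  rewrite /growth ler_pM ?expR_ge0 ?ler_expR ?ler_wpM2l//.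
    by rewrite addr_ge0// mulr_ge0// addr_ge0.
  by rewrite lerD// ler_pM ?addr_ge0// lerD2l.
have -> : d + (1 + T) * d = (2 + T) * d by ring.
by rewrite mulrA /d mulrCA divff ?mulr1// gt_eqF// mulr_gt0 ?expR_gt0// ltr_wpDr.
Qed.

(** The rounding part of [growth] is a constant over $N$ and disappears in the limit. *)
Lemma growth_cvg_le (K a t : R) (w : \bar R) : (forall e, 0 < e ->
  \forall N \near \oo, (w <= (growth K a (2 * (n%:R / N%:R)) t + e)%:E)%E) -> 0 <= t ->
  (w <= (expR (K * t) * a)%:E)%E.
Proof.
move=> h t0; apply/lee_addgt0Pr => e e0; have e2 : 0 < e / 2 by rewrite divr_gt0.
have [N [N1 N2]] : exists N, (w <= (growth K a (2 * (n%:R / N%:R)) t + e / 2)%:E)%E /\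
   (expR (K * t) * ((1 + t) * (2 * n%:R))) / N%:R <= e / 2.
  exact: filter_ex (filterI (h _ e2)
    (near_ratio_le (expR (K * t) * ((1 + t) * (2 * n%:R))) e2)).
rewrite (le_trans N1)// -EFinD lee_fin /growth mulrDr -addrA lerD2l [leRHS]splitr lerD2r.
by apply: le_trans N2; rewrite !mulrA.
Qed.

(** [W_complete] asks for finite supports and geometrically small consecutive distances. A
    subsequence is extracted and its terms are rounded finely enough; the Cauchy property then
    carries the limit over to the whole sequence. *)
Lemma W_cauchy_limit (r : R) (rho : nat -> P) :
  (\forall N \near \oo, conc r (rho N)) ->
  (forall e : R, 0 < e -> exists N0, forall N M, (N0 <= N)%N -> (N0 <= M)%N ->
     (W (rho N) (rho M) <= e%:E)%E) ->
  exists mu, forall e : R, 0 < e -> \forall N \near \oo, (W (rho N) mu <= e%:E)%E.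
Proof.
move=> [N1 _ crho] cauchy.
(* Consecutive rounded measures are joined by four distances of at most [e k], and their sum has to
   stay strictly below $2^{-(k+1)}$, which is five times [e k]. *)
pose e (k : nat) : R := (2 ^ k.+1)%:R^-1 / 5.
have e0 k : 0 < e k by rewrite divr_gt0// invr_gt0 ltr0n expn_gt0.
have eS k : e k.+1 <= e k.
  by rewrite ler_pM2r ?invr_gt0// lef_pV2 ?posrE ?ltr0n ?expn_gt0// ler_nat leq_exp2l.
have /choice[phi phiP] : forall k, exists N0, (N1 <= N0)%N /\
    forall N M, (N0 <= N)%N -> (N0 <= M)%N -> (W (rho N) (rho M) <= (e k)%:E)%E.
  move=> k; have [N0 N0P] := cauchy _ (e0 k); exists (maxn N0 N1).
  split; first exact: leq_maxr.
  by move=> N M; rewrite !geq_max => /andP[hN _] /andP[hM _]; exact: N0P.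
have cphi k : conc r (rho (phi k)) by apply: crho => /=; case: (phiP k).
have /choice[M MP] : forall k, exists M, (0 < M)%N /\ n%:R / M%:R <= e k.
  by move=> k; exact: filter_ex (filterI near_pos (near_ratio_le n%:R (e0 k))).
pose rho' k := rlaw 1 (M k) (rho (phi k)).
have fin' k : fin_supp (rho' k) by apply: rlaw_fin_supp (cphi k); case: (MP k).
have close k : (W (rho (phi k)) (rho' k) <= (e k)%:E)%E.
  have [M0 Me] := MP k; rewrite (le_trans (W_rnd_le 1 _ M0))// expn1 lee_fin//.
have step k : (W (rho' k) (rho' k.+1) < ((2 ^ k.+1)%:R^-1)%:E)%E.
  pose N := maxn (phi k) (phi k.+1).
  have cN : conc r (rho N).
    by apply: crho => /=; rewrite (leq_trans _ (leq_maxl _ _))//; case: (phiP k).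
  have h1 : (W (rho' k) (rho (phi k)) <= (e k)%:E)%E by rewrite W_sym.
  have h2 : (W (rho (phi k)) (rho N) <= (e k)%:E)%E.
    by apply: (phiP k).2 => //; exact: leq_maxl.
  have h3 : (W (rho N) (rho (phi k.+1)) <= (e k)%:E)%E.
    apply: le_trans ((phiP k.+1).2 _ _ _ _) _ => //; first exact: leq_maxr.
    by rewrite lee_fin.
  have h4 : (W (rho (phi k.+1)) (rho' k.+1) <= (e k)%:E)%E.
    by rewrite (le_trans (close _))// lee_fin.
  rewrite (le_lt_trans (W_triangle _ _ (cphi k)))//.
  rewrite (le_lt_trans (leeD h1 (le_trans (W_triangle _ _ cN)
    (leeD h2 (le_trans (W_triangle _ _ (cphi k.+1)) (leeD h3 h4))))))//.
  rewrite -!EFinD lte_fin.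
  have := e0 k; have -> : (2 ^ k.+1)%:R^-1 = 5 * e k by rewrite /e mulrC divfK.
  lra.
have [mu muP] := W_complete fin' step; exists mu => d d0.
(* One [e k] for the passage to the subsequence, one for the rounding, and $n/2^k$ from
   [W_complete]. *)
have [k [k1 k2]] : exists k, 2 * e k <= d / 2 /\ n%:R / (2 ^ k)%:R <= d / 2.
  have d2 : 0 < d / 2 by rewrite divr_gt0.
  have [k [kA kB]] := filter_ex (filterI (near_ratio_le n%:R d2)
    (filterI near_pos (near_ratio_le 1 d2))).
  case: kB => k0 kB; have kk : k%:R <= (2 ^ k)%:R :> R by rewrite ler_nat ltnW// ltn_expl.
  have k0' : 0 < k%:R :> R by rewrite ltr0n.
  have k2 : 0 < (2 ^ k)%:R :> R by rewrite ltr0n expn_gt0.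
  exists k; split.
    apply: le_trans kB; rewrite div1r /e expnS natrM invfM.
    apply: (@le_trans _ _ ((2 ^ k)%:R^-1)); last by rewrite lef_pV2.
    have : 0 <= (2 ^ k)%:R^-1 :> R by rewrite invr_ge0 ltW.
    by move: (_^-1) => x; lra.
  by apply: le_trans kA; rewrite ler_wpM2l// lef_pV2.
exists (phi k) => // N /= kN.
have h1 : (W (rho N) (rho (phi k)) <= (e k)%:E)%E by exact: (phiP k).2.
have c' : conc (r + n%:R / (M k ^ 1)%:R) (rho' k).
  by apply: rlaw_conc => //; case: (MP k).
rewrite (le_trans (W_triangle _ _ (cphi k)))//.
rewrite (le_trans (leeD h1 (le_trans (W_triangle _ _ c') (leeD (close k) (muP k)))))//.
rewrite -!EFinD lee_fin; move: k1 k2; set x := n%:R / _; lra.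
Qed.

Lemma fin_supp_dirac (mu : P) : fin_supp mu -> finite_dirac_sum mu.
Proof.
move=> /fin_suppP[k [p [injp p0]]].
pose E i := [set p i].
have mE i : measurable (E i) by exact: measurable_set1_row.
have tE : trivIset setT E by move=> i j _ _ [x [/= -> /injp]].
have E0 : mu (~` \bigcup_i E i) = 0%E.
  rewrite -[RHS]p0; congr (mu (~` _)).
  by apply/seteqP; split=> [x [i _ ->]|_ [i _ <-]]; exists i.
have fE i : mu (E i) \is a fin_num by exact: fin_num_measure.
(* [finite_dirac_sum] wants positive weights, so the atoms of mass 0 are dropped and the others
   renumbered. *)
pose J := [pred i : 'I_k | mu (E i) != 0%E].
have key A : measurable A -> mu A =
    (\sum_(i < #|J|) (fine (mu (E (enum_val i))))%:E * \d_(p (enum_val i)) A)%E.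
  move=> mA; transitivity (\sum_i mu (E i) * \d_(p i) A)%E.
    by apply: (@discrete_law R n _ _ mu _ E id p A) => // i w.
  rewrite (bigID J)/= [X in (_ + X)%E]big1 ?adde0; last first.
    by move=> i /negPn/eqP ->; rewrite mul0e.
  rewrite -(@big_enum_val _ _ _ _ J (fun i => (fine (mu (E i)))%:E * \d_(p i) A)%E).
  by apply: eq_bigr => i _; rewrite fineK.
exists #|J|, (fun i => fine (mu (E (enum_val i)))), (fun i => p (enum_val i)); split => //.
- move=> i; rewrite fine_gt0// -ge0_fin_numE// fE andbT lt0e measure_ge0 andbT.
  by have := enum_valP i.
- apply/EFin_inj; rewrite -sumEFin -(@probability_setT _ _ _ mu) key//.
  by apply: eq_bigr => i _; rewrite diracT mule1.
Qed.

End cauchy_limits.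

(** * The limit semigroup *)

Section semigroup.
Context (R : realType) (n : nat).
Local Notation rV := 'rV[R]_n.
Local Notation P := (probability 'rV[R]_n R).
Local Notation PT := (probability 'TR[R]_n R).
Context (V : P -> PT) (C T : R) (pV : is_pvf V) (C_gt0 : 0 < C)
  (sV : support_sublinear C V) (lV : locally_WV_lipschitz V) (T_gt0 : 0 < T)
  (dcv : forall mu : P, finite_dirac_sum mu -> LAS_cvg_unique T V mu).

Let C0 : 0 <= C := ltW C_gt0.
Let T0 : 0 <= T := ltW T_gt0.
Local Notation L := (Lcan V).
Local Notation RM := (Rmax n C T).
Local Notation MV := (Mvel n C T).

Lemma near_is_LAS r mu : 0 <= r -> conc r mu ->
  \forall N \near \oo, is_LAS T V mu N (L N mu).
Proof.
move=> r0 cr; apply: filterS (filterI near_pos (filterI (near_nat_gt (RM r))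
  (near_nat_gt (C * (1 + RM r))))) => N [N0 [N1 N2]]; exact: is_LAS_Lcan cr N1 N2.
Qed.

Lemma conc_Lcan_limit r mu rho t : 0 <= r -> conc r mu -> 0 <= t -> t <= T ->
  (forall e : R, 0 < e -> \forall N \near \oo, (W (L N mu t) rho <= e%:E)%E) ->
  conc (RM r) rho.
Proof.
move=> r0 cr t0 tT h; apply: conc_W_limit => e e0.
have [N [N0 hN]] := filter_ex (filterI near_pos (h _ e0)).
by exists (L N mu t) => //; exact: (Lcan_Rmax pV C0 sV _ r0 cr t0 tT).
Qed.

(** Translates the convergence hypothesis to the explicit curve: for large [N], the curves it
    provides agree with [Lcan] by [is_LAS_unique]. *)
Lemma dirac_limit r mu : 0 <= r -> conc r mu -> fin_supp mu -> exists m : R -> P,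
  forall e : R, 0 < e -> \forall N \near \oo, forall t, 0 <= t -> t <= T ->
    (W (L N mu t) (m t) <= e%:E)%E.
Proof.
move=> r0 cr /fin_supp_dirac/dcv[m cvm _]; exists m => e e0.
have [k0 k0P] := cvm e e0.
have hk : \forall N \near \oo, (k0 <= N)%N by exists k0.
apply: filterS (filterI (filterI near_pos (near_is_LAS r0 cr)) hk) =>
  N [[N0 LN] /k0P[m' Lm' hm']] t t0 tT.
have <- : W (m' t) (m t) = W (L N mu t) (m t).
  by apply: W_eqm => //; exact: (is_LAS_unique pV N0 Lm' LN).
by apply: hm'; rewrite in_itv/= t0.
Qed.

(** The stability estimate is uniform in $N$, so the approximation [muk] of the datum is fixed
    before $N$ grows. Passing from one index to the other goes through [muk] and its limit [m], in
    four distances of at most $e/4$. *)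
Lemma Lcan_cauchy r mu : 0 <= r -> conc r mu -> forall e : R, 0 < e ->
  exists N0, (0 < N0)%N /\ forall N M t, (N0 <= N)%N -> (N0 <= M)%N -> 0 <= t -> t <= T ->
    (W (L N mu t) (L M mu t) <= e%:E)%E.
Proof.
(* The radius $r + n$ holds the datum and its roundings at every mesh $1/k$, so the constants can be
   chosen before $k$. *)
move=> r0 cr e e0; pose r' := r + n%:R; have r'0 : 0 <= r' by rewrite addr_ge0.
have [K lip] := WV_lip_ex (RM r') lV; have K0 := ltW lip.1.
have e4 : 0 < e / 4 by rewrite divr_gt0.
have [d d0 dP] := growth_small K0 T0 e4.
have [k [k0 kd]] := filter_ex (filterI near_pos (near_ratio_le n%:R d0)).
pose muk := rlaw 1 k mu.
have ck : conc r' muk.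
  by apply: conc_le (rlaw_conc 1 k0 cr); rewrite lerD2l expn1 ratio_le1.
have cr' : conc r' mu by apply: conc_le cr; rewrite lerDl.
have Wk : (W mu muk <= (n%:R / k%:R)%:E)%E by have := W_rnd_le 1 mu k0; rewrite expn1.
have Wk' : (W muk mu <= (n%:R / k%:R)%:E)%E by rewrite W_sym.
have [m mP] := dirac_limit r'0 ck (rlaw_fin_supp 1 k0 cr).
have cm t : 0 <= t -> t <= T -> conc (RM r') (m t).
  move=> t0 tT; apply: (conc_Lcan_limit r'0 ck t0 tT) => h h0.
  by apply: filterS (mP _ h0) => N; apply.
have a0 : 0 <= n%:R / k%:R :> R by rewrite divr_ge0.
have [N0 _ N0P] := filterI near_pos (filterI (near_ratio_le (2 * n%:R) d0) (mP _ e4)).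
exists (maxn N0 1); split; first by rewrite leq_maxr.
have half N t : (maxn N0 1 <= N)%N -> 0 <= t -> t <= T ->
    [/\ (W (L N mu t) (L N muk t) <= (e / 4)%:E)%E, (W (L N muk t) (m t) <= (e / 4)%:E)%E
      & (0 < N)%N].
  rewrite geq_max => /andP[/N0P[N_gt0 [Nd NP]] _] t0 tT; split => //; last exact: NP.
  rewrite (le_trans (Lcan_stab pV C0 sV N_gt0 r'0 a0 lip cr' ck Wk t0 tT))//.
  rewrite lee_fin dP ?a0 ?t0//; rewrite mulrA Nd andbT.
  by rewrite divr_ge0// mulr_ge0.
move=> N M t hN hM t0 tT.
have [h1 h2 N_gt0] := half N t hN t0 tT; have [h4 h3 M_gt0] := half M t hM t0 tT.
rewrite W_sym in h3; rewrite W_sym in h4.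
have cN := Lcan_Rmax pV C0 sV N_gt0 r'0 ck t0 tT.
have cM := Lcan_Rmax pV C0 sV M_gt0 r'0 ck t0 tT.
rewrite (le_trans (W_triangle _ _ cN))//.
rewrite (le_trans (leeD h1 (le_trans (W_triangle _ _ (cm t t0 tT))
  (leeD h2 (le_trans (W_triangle _ _ cM) (leeD h3 h4))))))//.
by rewrite -!EFinD lee_fin; lra.
Qed.

Lemma limit_ex r mu t : 0 <= r -> conc r mu -> 0 <= t -> t <= T -> exists rho,
  forall e : R, 0 < e -> \forall N \near \oo, (W (L N mu t) rho <= e%:E)%E.
Proof.
move=> r0 cr t0 tT; apply: (@W_cauchy_limit _ _ (RM r)).
  by apply: filterS near_pos => N N0; exact: (Lcan_Rmax pV C0 sV _ r0 cr t0 tT).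
move=> e e0; have [N0 [_ h]] := Lcan_cauchy r0 cr e0.
by exists N0 => N M hN hM; exact: h.
Qed.

(* The value mu is junk, for mu without compact support or t outside [0, T]. *)
Definition semigroup (t : R) (mu : P) : P :=
  if pselect (exists rho, forall e : R, 0 < e ->
    \forall N \near \oo, (W (L N mu t) rho <= e%:E)%E) is left h
  then sval (cid h) else mu.
Local Notation S := semigroup.

Lemma semigroup_cvg_pt r mu t : 0 <= r -> conc r mu -> 0 <= t -> t <= T ->
  forall e : R, 0 < e -> \forall N \near \oo, (W (L N mu t) (S t mu) <= e%:E)%E.
Proof.
move=> r0 cr t0 tT; rewrite /S; case: pselect => [h|]; first exact: (svalP (cid h)).
by move=> h; exfalso; apply: h; exact: limit_ex cr t0 tT.
Qed.

(** Convergence at each time becomes uniform: the auxiliary index [M] may depend on [t], while the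
    Cauchy threshold [N0] does not. *)
Lemma semigroup_cvg r mu : 0 <= r -> conc r mu -> forall e : R, 0 < e ->
  \forall N \near \oo, forall t, 0 <= t -> t <= T -> (W (L N mu t) (S t mu) <= e%:E)%E.
Proof.
move=> r0 cr e e0; have e2 : 0 < e / 2 by rewrite divr_gt0.
have [N0 [N0_gt0 N0P]] := Lcan_cauchy r0 cr e2; exists N0 => // N /= hN t t0 tT.
have hM : \forall M \near \oo, (N0 <= M)%N by exists N0.
have [M [M1 M2]] := filter_ex (filterI hM (semigroup_cvg_pt r0 cr t0 tT e2)).
have cM := Lcan_Rmax pV C0 sV (leq_trans N0_gt0 M1) r0 cr t0 tT.
rewrite (le_trans (W_triangle _ _ cM))// (le_trans (leeD (N0P _ _ _ hN M1 t0 tT) M2))//.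
by rewrite -EFinD -splitr.
Qed.

Lemma semigroup_Rmax r mu t : 0 <= r -> conc r mu -> 0 <= t -> t <= T ->
  conc (RM r) (S t mu).
Proof.
move=> r0 cr t0 tT; apply: (conc_Lcan_limit r0 cr t0 tT).
by move=> e e0; exact: (semigroup_cvg_pt r0 cr t0 tT e0).
Qed.

(** The limit of [bnd] would be $e^{Ct}(1+r) - 1$. Half of the 1 absorbs the rounding term for large
    $N$; the other half leaves strict room for the open ball required of the semigroup. *)
Lemma semigroup_conc r mu t : 0 <= r -> conc r mu -> 0 <= t -> t <= T ->
  conc (expR (C * t) * (1 + r) - 2^-1) (S t mu).
Proof.
move=> r0 cr t0 tT; apply: conc_W_limit => e e0.
have h2 : 0 < 2^-1 :> R by rewrite invr_gt0.
have [N [N0 [N1 N2]]] := filter_ex (filterI near_pos (filterI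
  (near_ratio_le (expR (C * t) * ((1 + t) * n%:R)) h2) (semigroup_cvg_pt r0 cr t0 tT e0))).
exists (L N mu t) => //; apply: conc_le (Lcan_conc pV C0 sV N0 r0 t0 cr).
rewrite /bnd /growth mulrDr !mulrA in N1 *; lra.
Qed.

Lemma semigroup_lip r K mu nu t : 0 <= r -> WV_lip V (RM r) K -> conc r mu -> conc r nu ->
  0 <= t -> t <= T -> (W (S t mu) (S t nu) <= (expR (K * t))%:E * W mu nu)%E.
Proof.
move=> r0 lip cm cn t0 tT; have [->|] := eqVneq (W mu nu) +oo%E.
  by rewrite gt0_muley ?leey// lte_fin expR_gt0.
rewrite -ltey -ge0_fin_numE ?W_ge0// => Wf; set a := fine (W mu nu).
have Wa : (W mu nu <= a%:E)%E by rewrite fineK.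
have a0 : 0 <= a by rewrite fine_ge0 ?W_ge0.
rewrite -(fineK Wf) -EFinM; apply: (growth_cvg_le (n := n)) => // e e0.
have e2 : 0 < e / 2 by rewrite divr_gt0.
apply: filterS (filterI near_pos (filterI (semigroup_cvg_pt r0 cm t0 tT e2)
  (semigroup_cvg_pt r0 cn t0 tT e2))) => N [N0 [h1 h2]]; rewrite W_sym in h1.
have cm' := Lcan_Rmax pV C0 sV N0 r0 cm t0 tT.
have cn' := Lcan_Rmax pV C0 sV N0 r0 cn t0 tT.
rewrite (le_trans (W_triangle _ _ cm'))//.
rewrite (le_trans (leeD h1 (le_trans (W_triangle _ _ cn') (leeD
  (Lcan_stab pV C0 sV N0 r0 a0 lip cm cn Wa t0 tT) h2))))//.
by rewrite -!EFinD lee_fin addrCA -splitr.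
Qed.

Lemma semigroup_time_le r mu s t : 0 <= r -> conc r mu -> 0 <= s -> s <= t -> t <= T ->
  (W (S s mu) (S t mu) <= ((t - s) * MV r)%:E)%E.
Proof.
move=> r0 cr s0 st tT; apply/lee_addgt0Pr => e e0.
have t0 := le_trans s0 st; have sT := le_trans st tT.
have e2 : 0 < e / 2 by rewrite divr_gt0.
have [N [N0 [h1 h2]]] := filter_ex (filterI near_pos (filterI
  (semigroup_cvg_pt r0 cr s0 sT e2) (semigroup_cvg_pt r0 cr t0 tT e2))).
rewrite W_sym in h1.
have cs := Lcan_Rmax pV C0 sV N0 r0 cr s0 sT.
have ct := Lcan_Rmax pV C0 sV N0 r0 cr t0 tT.
rewrite (le_trans (W_triangle _ _ cs))//.
rewrite (le_trans (leeD h1 (le_trans (W_triangle _ _ ct) (leeD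
  (Lcan_time pV C0 sV T0 N0 r0 cr s0 st tT) h2))))//.
by rewrite -!EFinD lee_fin addrCA -splitr.
Qed.

Lemma semigroup_time r mu s t : 0 <= r -> conc r mu -> 0 <= s -> s <= T -> 0 <= t -> t <= T ->
  (W (S s mu) (S t mu) <= (MV r * `|s - t|)%:E)%E.
Proof.
move=> r0 cr s0 sT t0 tT; have [st|ts] := leP s t.
  by rewrite (le_trans (semigroup_time_le r0 cr s0 st tT))// lee_fin mulrC ler0_norm ?subr_le0// opprB.
rewrite W_sym (le_trans (semigroup_time_le r0 cr t0 (ltW ts) sT))// lee_fin mulrC.
by rewrite ger0_norm// subr_ge0 ltW.
Qed.

Lemma semigroup0 r mu : 0 <= r -> conc r mu -> S 0 mu ≡μ mu.
Proof.
move=> r0 cr; apply: W_eq0_eqm => e e0; have e2 : 0 < e / 2 by rewrite divr_gt0.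
have [N [N0 [h1 h2]]] := filter_ex (filterI near_pos (filterI
  (semigroup_cvg_pt r0 cr (lexx 0) T0 e2) (near_ratio_le n%:R e2))).
rewrite W_sym in h1; have cN := Lcan_Rmax pV C0 sV N0 r0 cr (lexx 0) T0.
rewrite (le_trans (W_triangle _ _ cN))// (splitr e) EFinD leeD//.
rewrite (@W_eqm _ _ _ (rlaw 2 N mu) _ mu)//; last first.
  by have := Lcan_disc pV mu 0 N0; rewrite mul0r.
by rewrite W_sym (le_trans (W_rnd_le 2 _ N0))// lee_fin (le_trans _ h2)// ratio_sqr.
Qed.

(** As [s] need not be a multiple of $1/N$, it is replaced by the node $l/N$ before it. This costs
    at most [MV r / N] twice: in the datum from which the solution restarts ([hs]), and in the final
    time ([k3]). *)
Lemma semigroup_add r mu t s : 0 <= r -> conc r mu -> 0 <= t -> 0 <= s -> t + s <= T ->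
  S t (S s mu) ≡μ S (t + s) mu.
Proof.
move=> r0 cr t0 s0 tsT; apply: W_eq0_eqm => e e0.
have tT : t <= T by rewrite (le_trans _ tsT)// lerDl.
have sT : s <= T by rewrite (le_trans _ tsT)// lerDr.
have ts0 : 0 <= t + s by rewrite addr_ge0.
(* Lattice solutions are restarted from measures in the ball of radius [RM r], so the stability
   constant is taken on the ball of radius [RM r1]. *)
pose r1 := RM r; have r10 : 0 <= r1 by rewrite (le_trans r0)//; exact: Rmax_ge.
have cs : conc r1 (S s mu) by exact: semigroup_Rmax.
have [K lip] := WV_lip_ex (RM r1) lV; have K0 := ltW lip.1.
have e4 : 0 < e / 4 by rewrite divr_gt0.
have [d d0 dP] := growth_small K0 T0 e4; have d2 : 0 < d / 2 by rewrite divr_gt0.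
have [N [N0 [h1 [h2 [h3 [h4 [h5 h6]]]]]]] := filter_ex (filterI near_pos (filterI
  (semigroup_cvg_pt r10 cs t0 tT e4) (filterI (semigroup_cvg_pt r0 cr s0 sT d2) (filterI
  (semigroup_cvg_pt r0 cr ts0 tsT e4) (filterI (near_ratio_le (2 * n%:R) d0)
  (filterI (near_ratio_le (MV r) d2) (near_ratio_le (MV r) e4))))))).
have [l [h [sE hN ls]]] := time_decomp N0 s0; have /andP[h0 hN'] := hN.
have lT := le_trans ls sT; have l0 : 0 <= l%:R / N%:R :> R by rewrite divr_ge0.
have cl := Ldisc_Rmax pV C0 sV N0 r0 cr lT.
have ltT : l%:R / N%:R + t <= T by rewrite addrC (le_trans _ tsT)// lerD2l.
have M0 : 0 <= MV r by exact: Mvel_ge0.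
have gap x : x <= N%:R^-1 -> x * MV r <= MV r / N%:R by move=> xN; rewrite mulrC ler_wpM2l.
have hs : (W (S s mu) (Ldisc V N mu l) <= d%:E)%E.
  have csN := Lcan_Rmax pV C0 sV N0 r0 cr s0 sT.
  rewrite (le_trans (W_triangle _ _ csN))// (splitr d) EFinD leeD//; first by rewrite W_sym.
  rewrite W_sym (@W_eqm _ _ _ (L N mu (l%:R / N%:R)) _ (L N mu s))//; last first.
    by move=> A mA; have := Lcan_disc pV mu l N0 mA => ->.
  rewrite (le_trans (Lcan_time pV C0 sV T0 N0 r0 cr l0 ls sT))// lee_fin (le_trans _ h5)//.
  by apply: gap; rewrite sE addrAC subrr add0r.
have k1 := h1; rewrite W_sym in k1.
have k2 : (W (L N (S s mu) t) (L N (Ldisc V N mu l) t) <= (e / 4)%:E)%E.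
  rewrite (le_trans (Lcan_stab pV C0 sV N0 r10 (ltW d0) lip cs cl hs t0 tT))//.
  rewrite lee_fin dP ?(ltW d0) ?lexx ?t0//; rewrite mulrA h4 andbT.
  by rewrite divr_ge0// mulr_ge0.
have k3 : (W (L N (Ldisc V N mu l) t) (L N mu (t + s)) <= (e / 4)%:E)%E.
  rewrite (@W_eqm _ _ _ (L N mu (l%:R / N%:R + t)) _ (L N mu (t + s)))//; last first.
    exact: Lcan_restart.
  have lt0 : 0 <= l%:R / N%:R + t by rewrite addr_ge0.
  have lts : l%:R / N%:R + t <= t + s by rewrite addrC lerD2l.
  rewrite (le_trans (Lcan_time pV C0 sV T0 N0 r0 cr lt0 lts tsT))// lee_fin (le_trans _ h6)//.
  by apply: gap; rewrite sE; move: hN'; lra.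
have c1 := Lcan_Rmax pV C0 sV N0 r10 cs t0 tT.
have c2 := Lcan_Rmax pV C0 sV N0 r10 cl t0 tT.
have c3 := Lcan_Rmax pV C0 sV N0 r0 cr ts0 tsT.
rewrite (le_trans (W_triangle _ _ c1))//.
rewrite (le_trans (leeD k1 (le_trans (W_triangle _ _ c2) (leeD k2
  (le_trans (W_triangle _ _ c3) (leeD k3 h3))))))//.
by rewrite -!EFinD lee_fin; lra.
Qed.

Lemma semigroup_LAS_limits : trajectories_LAS_limits T V S.
Proof.
move=> mu /compact_conc[r r0 cr]; exists id => // e e0.
have [k0 _ k0P] := filterI (near_is_LAS (ltW r0) cr) (semigroup_cvg (ltW r0) cr e0).
exists k0 => k /k0P[Lk hk]; exists (L k mu) => // t; rewrite in_itv/= => /andP[t0 tT].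
exact: hk.
Qed.

Lemma LAS_limit_unique S' (mu : P) t : trajectories_LAS_limits T V S' -> compact_supp mu ->
  0 <= t -> t <= T -> S' t mu ≡μ S t mu.
Proof.
move=> trS' cmu t0 tT; have [r /ltW r0 cr] := compact_conc cmu.
have [phi phiH cvS'] := trS' mu cmu.
apply: W_eq0_eqm => e e0; have e2 : 0 < e / 2 by rewrite divr_gt0.
have [k0 k0P] := cvS' _ e2.
have [N1 _ N1P] := filterI near_pos (filterI (near_is_LAS r0 cr) (semigroup_cvg r0 cr e2)).
(* The subsequence eventually uses only indices for which [Lcan] is a Lattice Approximate Solution
   close to the semigroup. *)
have phik k : (k <= phi k)%N.
  by elim: k => // k ih; rewrite (leq_ltn_trans ih)// phiH.
pose k := maxn k0 N1.
have [N0 [LN hN]] : [set N | (0 < N)%N /\ is_LAS T V mu N (L N mu) /\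
   forall t, 0 <= t -> t <= T -> (W (L N mu t) (S t mu) <= (e / 2)%:E)%E] (phi k).
  by apply: N1P => /=; rewrite (leq_trans _ (phik k))// leq_maxr.
have [m Lm hm] := k0P k (leq_maxl _ _).
have cN := Lcan_Rmax pV C0 sV N0 r0 cr t0 tT.
rewrite (le_trans (W_triangle _ _ cN))// (splitr e) EFinD leeD//; last exact: hN.
rewrite W_sym (@W_eqm _ _ _ (m t) _ (S' t mu))//; last first.
  exact: (is_LAS_unique pV N0 LN Lm).
by apply: hm; rewrite in_itv/= t0.
Qed.

End semigroup.

(** * Weak solutions *)

Section test_function_calculus.
Context (R : realType) (n : nat).
Local Notation rV := 'rV[R]_n.
Local Notation e_ i := (delta_mx 0 i : rV).

Lemma is_derive_line (h : rV -> R) (y v : rV) (s : R) :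
  derivable h (y + s *: v) v -> is_derive s 1 (fun s => h (y + s *: v)) ('D_v h (y + s *: v)).
Proof.
move=> dh.
have E : (fun k => k^-1 *: (((fun s => h (y + s *: v)) \o shift s) (k *: 1) - h (y + s *: v))) =
    (fun k => k^-1 *: ((h \o shift (y + s *: v)) (k *: v) - h (y + s *: v))).
  apply/funext => k /=; congr (_ *: (h _ - _)).
  by rewrite [k *: 1]mulr1 scalerDl addrCA.
apply: DeriveDef; first by rewrite /derivable E.
by rewrite /derive E.
Qed.

Lemma line_MVT (g dg : R -> R) (w : R) : (forall s : R, is_derive s 1 g (dg s)) ->
  exists2 c, `|c| <= `|w| & g w - g 0 = dg c * w.
Proof.
move=> dP.
have cg : continuous g.
  by move=> s; apply/differentiable_continuous/derivable1_diffP; have [] := dP s.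
have [w0|w0] := leP 0 w.
  have [c] := @MVT_segment R g dg 0 w w0 (fun s _ => dP s) (continuous_subspaceT cg).
  rewrite in_itv/= => /andP[c0 cw] ->; exists c; last by rewrite subr0.
  by rewrite !ger0_norm.
have [c] := @MVT_segment R g dg w 0 (ltW w0) (fun s _ => dP s) (continuous_subspaceT cg).
rewrite in_itv/= => /andP[wc c0] gE; exists c.
  by rewrite !ler0_norm ?(ltW w0)// lerN2.
by rewrite -[LHS]opprB gE sub0r mulrN opprK.
Qed.

(* Changing the coordinates one at a time needs only the partial derivatives,
   not the total differentiability of h. *)
Lemma telescoping_MVT (h : rV -> R) (x w : rV) :
  (forall i y, derivable h y (e_ i)) ->
  exists xi : 'I_n -> rV, h (x + w) - h x = \sum_i partial i h (xi i) * w 0 i /\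
    forall i j, `|xi i 0 j - x 0 j| <= `|w 0 j|.
Proof.
move=> dh.
pose y (k : nat) : rV := x + \row_j (if (j < k)%N then w 0 j else 0).
have yS (i : 'I_n) : y i.+1 = y i + w 0 i *: e_ i.
  rewrite /y -addrA; congr (_ + _); apply/rowP => j; rewrite !mxE eqxx/= ltnS.
  have [->|ji] := eqVneq j i; first by rewrite leqnn ltnn add0r mulr1.
  by rewrite mulr0 addr0 leq_eqVlt; case: eqP => // ji'; move/eqP: ji; case; exact: val_inj.
have /choice[c cP] (i : 'I_n) : exists c, `|c| <= `|w 0 i| /\
    h (y i.+1) - h (y i) = partial i h (y i + c *: e_ i) * w 0 i.
  have [c cw cE] := @line_MVT (fun s => h (y i + s *: e_ i))
    (fun s => 'D_(e_ i) h (y i + s *: e_ i)) (w 0 i)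
    (fun s => is_derive_line (dh i _)).
  by exists c; split => //; rewrite yS -cE scale0r addr0.
exists (fun i : 'I_n => y i + c i *: e_ i); split.
  have -> : x + w = y n.
    by rewrite /y; congr (_ + _); apply/rowP => j; rewrite mxE ltn_ord.
  have -> : x = y 0%N.
    by rewrite /y -[LHS]addr0; congr (_ + _); apply/rowP => j; rewrite !mxE.
  rewrite -(telescope_sumr (fun k => h (y k)))// big_mkord.
  by apply: eq_bigr => i _; case: (cP i).
move=> i j; rewrite !mxE eqxx/=.
have [->|ji] := eqVneq j i.
  by rewrite ltnn addr0 mulr1 addrAC subrr add0r; case: (cP i).
by rewrite mulr0 addr0 addrAC subrr add0r; case: ifP => //; rewrite normr0.
Qed.

Lemma lipschitz_of_partial (h : rV -> R) (M : R) : 0 <= M ->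
  (forall i y, derivable h y (e_ i)) -> (forall i y, `|partial i h y| <= M) ->
  forall x y, `|h x - h y| <= n%:R * M * enorm (x - y).
Proof.
move=> M0 dh hM x y; have [xi [hE _]] := telescoping_MVT y (x - y) dh.
rewrite (_ : x = y + (x - y)) ?hE; last by rewrite addrC subrK.
rewrite (_ : y + (x - y) - y = x - y); last by rewrite addrAC subrr add0r.
rewrite (le_trans (ler_norm_sum _ _ _))//.
rewrite (le_trans (ler_sum _ (_ : forall i, true -> _ <= M * enorm (x - y))))//.
  by move=> i _; rewrite normrM ler_pM//; exact: coord_le_enorm.
by rewrite sumr_const card_ord -mulrA mulr_natl.
Qed.

Lemma continuous_cvanish_bounded (g : rV -> R) (K : set rV) : compact K ->
  continuous g -> (forall x, ~ K x -> g x = 0) -> exists2 M, 0 <= M & forall x, `|g x| <= M.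
Proof.
move=> cK cg g0.
have := @continuous_compact _ _ g K (continuous_subspaceT cg) cK.
move=> /compact_bounded[M [_ hM]].
exists (`|M| + 1) => [|x]; first by rewrite addr_ge0.
have [Kx|nKx] := pselect (K x); last by rewrite g0// normr0 addr_ge0.
by apply: (hM (`|M| + 1)); [rewrite ltr_pwDr// ler_norm|exists x].
Qed.

(** The complement of the closed support is open, so near each of its points a derivative is that of
    the constant 0, which lets the induction continue. *)
Lemma iter_partial_vanish (f : rV -> R) (s : seq 'I_n) x :
  ~ closure [set x | f x != 0] x -> iter_partial s f x = 0.
Proof.
have oU : open (~` closure [set x | f x != 0]).
  by apply: closed_openC; exact: closed_closure.
elim: s x => [|i s ih] x nx /=.
  by apply/eqP; apply: contrapT => /negP fx; apply: nx; exact: subset_closure.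
rewrite /partial -[RHS](derive_cst (0 : R) x (e_ i)).
apply: near_eq_derive; apply: filterS (open_nbhs_nbhs (conj oU nx)) => z /= nz.
exact: ih.
Qed.

(** Each iterated partial derivative is continuous and vanishes off a compact set, hence is bounded;
    summing the finitely many bounds replaces taking their maximum. *)
Lemma test_function_bounds (f : rV -> R) : test_function f ->
  exists M, [/\ 0 <= M, forall x, `|f x| <= M, forall i x, `|partial i f x| <= M &
    forall i j x, `|partial j (partial i f) x| <= M].
Proof.
move=> [sf cf].
have bd s : exists2 M, 0 <= M & forall x, `|iter_partial s f x| <= M.
  by apply: (continuous_cvanish_bounded cf (sf s).1) => x; exact: iter_partial_vanish.
have [M0 M00 M0P] := bd [::].
have /choice[M1 M1P] i : exists M, 0 <= M /\ forall x, `|partial i f x| <= M.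
  by have [M MM0 MP] := bd [:: i]; exists M.
have /choice[M2 M2P] (ij : 'I_n * 'I_n) : exists M, 0 <= M /\
    forall x, `|partial ij.2 (partial ij.1 f) x| <= M.
  by have [M MM0 MP] := bd [:: ij.2; ij.1]; exists M.
have s1 : 0 <= \sum_i M1 i by apply: sumr_ge0 => i _; case: (M1P i).
have s2 : 0 <= \sum_ij M2 ij by apply: sumr_ge0 => i _; case: (M2P i).
exists (M0 + \sum_i M1 i + \sum_ij M2 ij); split.
- by rewrite !addr_ge0.
- by move=> x; rewrite (le_trans (M0P x))// -addrA lerDl addr_ge0.
- move=> i x; rewrite (le_trans ((M1P i).2 x))// addrAC (bigD1 i)//= addrCA lerDl.
  by rewrite !addr_ge0// sumr_ge0// => j _; case: (M1P j).
- move=> i j x; rewrite (le_trans ((M2P (i, j)).2 x))// (bigD1 (i, j))//= addrCA lerDl.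
  by rewrite !addr_ge0// sumr_ge0// => k _; case: (M2P k).
Qed.

Lemma measurable_grad_dot (f : rV -> R) : smooth f ->
  measurable_fun setT (grad_dot f : 'TR[R]_n -> R).
Proof.
move=> sf; rewrite /grad_dot; apply: measurable_sum => i; apply: measurable_funM.
  have ci : continuous (partial i f) by case: (sf [:: i]).
  exact: (measurableT_comp (measurable_continuous_row ci) measurable_fst).
exact: (measurableT_comp (measurable_coord i) measurable_snd).
Qed.

Lemma grad_dot_le (f : rV -> R) M z : 0 <= M -> (forall i x, `|partial i f x| <= M) ->
  `|grad_dot f z| <= n%:R * M * enorm z.2.
Proof.
move=> M0 hM; rewrite /grad_dot (le_trans (ler_norm_sum _ _ _))//.
rewrite (le_trans (ler_sum _ (_ : forall i, true -> _ <= M * enorm z.2)))//.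
  by move=> i _; rewrite normrM ler_pM//; exact: coord_le_enorm.
by rewrite sumr_const card_ord -mulrA mulr_natl.
Qed.

Lemma grad_dot_sub_le (f : rV -> R) M z w : 0 <= M ->
  (forall i x, `|partial i f x| <= M) ->
  (forall i j x, derivable (partial i f) x (e_ j)) ->
  (forall i j x, `|partial j (partial i f) x| <= M) ->
  `|grad_dot f z - grad_dot f w| <=
    n%:R * (n%:R * M * enorm (z.1 - w.1) * enorm z.2 + M * enorm (z.2 - w.2)).
Proof.
move=> M0 hM dM hM2; rewrite /grad_dot -sumrB (le_trans (ler_norm_sum _ _ _))//.
set b := _ + _; rewrite (le_trans (ler_sum _ (_ : forall i, true -> _ <= b)))//; last first.
  by rewrite sumr_const card_ord mulr_natl.
move=> i _.
rewrite (_ : _ - _ = (partial i f z.1 - partial i f w.1) * z.2 0 i +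
  partial i f w.1 * (z.2 - w.2) 0 i); last by rewrite !mxE; ring.
rewrite (le_trans (ler_normD _ _))// !normrM lerD// ler_pM//.
- exact: lipschitz_of_partial.
- exact: coord_le_enorm.
- exact: coord_le_enorm.
Qed.

(** The point moves along the rounded velocity [w], while the derivative is taken along the true
    velocity [v]. The first error term is of second order, from mean value points within $s|w|$ of
    [x] in each coordinate; the second is the rounding. *)
Lemma taylor_le (f : rV -> R) M x v s w : 0 <= M -> 0 <= s ->
  (forall i x, derivable f x (e_ i)) ->
  (forall i x, `|partial i f x| <= M) ->
  (forall i j x, derivable (partial i f) x (e_ j)) ->
  (forall i j x, `|partial j (partial i f) x| <= M) ->
  `|f (x + s *: w) - (f x + s * grad_dot f (x, v))| <=
    s * (n%:R * (n%:R * M * (n%:R * (s * enorm w)) * enorm w + M * enorm (w - v))).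
Proof.
move=> M0 s0 df hM dM hM2; have [xi [fE xiP]] := telescoping_MVT x (s *: w) df.
rewrite opprD addrA fE /grad_dot mulr_sumr -sumrB (le_trans (ler_norm_sum _ _ _))//.
set b := _ + _.
rewrite (le_trans (ler_sum _ (_ : forall i, true -> _ <= s * b)))//; last first.
  by rewrite sumr_const card_ord -[X in X <= _]mulr_natl mulrCA.
move=> i _; rewrite /= mxE.
rewrite (_ : _ - _ = s * ((partial i f (xi i) - partial i f x) * w 0 i +
  partial i f x * (w - v) 0 i)); last by rewrite !mxE; ring.
rewrite normrM ger0_norm// ler_wpM2l// (le_trans (ler_normD _ _))// !normrM lerD// ler_pM//.
- rewrite (le_trans (lipschitz_of_partial M0 (dM i) (hM2 i) _ _))//.
  rewrite ler_wpM2l ?mulr_ge0// enorm_le_bound ?mulr_ge0 ?enorm_ge0// => j.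
  have := xiP i j; rewrite !mxE => /le_trans; apply.
  by rewrite normrM ger0_norm// ler_wpM2l//; exact: coord_le_enorm.
- exact: coord_le_enorm.
- exact: coord_le_enorm.
Qed.

End test_function_calculus.

(** * Integrals of test functions *)

Section real_integrals.
Context d (Om : measurableType d) (R : realType) (Q : probability Om R).

Lemma bounded_integrable (f : Om -> R) (M : R) (N : set Om) : measurable N -> Q N = 0%E ->
  measurable_fun setT f -> (forall w, ~ N w -> `|f w| <= M) ->
  Q.-integrable setT (EFin \o f).
Proof.
move=> mN N0 mf fM; apply/integrableP; split; first exact/measurable_EFinP.
apply: (@le_lt_trans _ _ `|M|%:E); last exact: ltry.
apply: (@integral_const_le _ _ _ Q (fun w => `|f w|) _ N) => //.
- exact: measurableT_comp.
- by move=> w /fM/le_trans; apply; exact: ler_norm.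
Qed.

Lemma Rintegral_law d' (Om' : measurableType d') (m : probability Om' R) (X : Om -> Om')
    (f : Om' -> R) : measurable_fun setT X ->
  (forall A, measurable A -> Q (X @^-1` A) = m A) -> measurable_fun setT f ->
  Q.-integrable setT (EFin \o (f \o X)) ->
  \int[m]_x f x = \int[Q]_w f (X w).
Proof.
move=> mX lX mf iX; rewrite /Rintegral; congr fine.
rewrite (@eq_measure_integral _ _ _ _ (law Q mX)) => [|A mA _]; last exact: esym (lX _ mA).
by rewrite integral_distribution//; exact/measurable_EFinP.
Qed.

Lemma Rintegral_sub_le (f g h : Om -> R) (a : R) (N : set Om) :
  measurable N -> Q N = 0%E ->
  Q.-integrable setT (EFin \o f) -> Q.-integrable setT (EFin \o g) ->
  measurable_fun setT h -> (forall w, 0 <= h w) ->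
  (forall w, ~ N w -> `|f w - g w| <= h w) -> (\int[Q]_w (h w)%:E <= a%:E)%E ->
  `|\int[Q]_w f w - \int[Q]_w g w| <= a.
Proof.
move=> mN N0 fi gi mh h0 fgh ha; rewrite -RintegralB//.
have mf : measurable_fun setT f by apply/measurable_EFinP; case/integrableP : fi.
have mg : measurable_fun setT g by apply/measurable_EFinP; case/integrableP : gi.
have ifg : Q.-integrable setT (EFin \o (fun w => f w - g w)).
  rewrite (_ : EFin \o _ = (fun w => ((EFin \o f) w - (EFin \o g) w)%E))//.
  exact: integrableB.
rewrite (le_trans (le_normr_Rintegral _ _))//.
have le : (\int[Q]_w (`|f w - g w|)%:E <= a%:E)%E.
  apply: le_trans ha.
  rewrite (le_trans (@integral_affine_le _ _ _ Q _ h (cst 0) 1 0 0 N mN N0 _ _ _ _ _ _ _ _ _ _))//.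
  - by apply: measurableT_comp => //; exact: measurable_funB.
  - by move=> w /fgh; rewrite mul1r mul0r !addr0.
  - by rewrite mul1e mul0e !adde0.
have ge : (0 <= \int[Q]_w (`|f w - g w|)%:E)%E.
  by apply: integral_ge0 => w _; rewrite lee_fin.
by rewrite /Rintegral; move: le ge; case: (integral _ _ _) => [x|//|//]; rewrite lee_fin.
Qed.

Lemma eqm_Rintegral (m1 m2 : probability Om R) (f : Om -> R) : m1 ≡μ m2 ->
  \int[m1]_x f x = \int[m2]_x f x.
Proof.
by move=> m12; rewrite /Rintegral; congr fine; apply: eq_measure_integral => A mA _; exact: m12.
Qed.

End real_integrals.

Section test_function_integrals.
Context (R : realType) (n : nat).
Local Notation rV := 'rV[R]_n.
Local Notation P := (probability 'rV[R]_n R).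
Local Notation PT := (probability 'TR[R]_n R).
Context (f : rV -> R) (tf : test_function f) (M : R) (M0 : 0 <= M)
  (fM : forall x, `|f x| <= M) (dfM : forall i x, `|partial i f x| <= M)
  (ddfM : forall i j x, `|partial j (partial i f) x| <= M).

Let sf : smooth f := tf.1.
Let cf : continuous f. Proof. by case: (sf [::]). Qed.
Let mf : measurable_fun setT f. Proof. exact: measurable_continuous_row. Qed.
Let df i x : derivable f x (delta_mx 0 i). Proof. by case: (sf [::]). Qed.
Let ddf i j x : derivable (partial i f) x (delta_mx 0 j).
Proof. by case: (sf [:: i]). Qed.
Let mgd : measurable_fun setT (grad_dot f : 'TR[R]_n -> R).
Proof. exact: measurable_grad_dot. Qed.

Lemma test_comp_integrable d (Om : measurableType d) (Q : probability Om R) (X : Om -> rV) :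
  measurable_fun setT X -> Q.-integrable setT (EFin \o (f \o X)).
Proof.
move=> mX; apply: (@bounded_integrable _ _ _ Q _ M set0) => //.
- exact: measurableT_comp.
- by move=> w _; exact: fM.
Qed.

Lemma test_integral_lip (mu nu : P) a : (W mu nu <= a%:E)%E ->
  `|\int[mu]_x f x - \int[nu]_x f x| <= n%:R * M * a.
Proof.
move=> Wa; apply/ler_addgt0Pr => e e0.
have nM0 : 0 <= n%:R * M by rewrite mulr_ge0.
have d0 : 0 < e / (n%:R * M + 1) by rewrite divr_gt0// ltr_wpDl.
have [tau [c1 c2] ct] := W_le_coupling Wa d0.
rewrite (@Rintegral_law _ _ _ tau _ _ mu fst f)//; last exact: test_comp_integrable.
rewrite (@Rintegral_law _ _ _ tau _ _ nu snd f)//; last exact: test_comp_integrable.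
apply: (@Rintegral_sub_le _ _ _ tau _ _ (fun z => n%:R * M * enorm (z.1 - z.2)) _ set0) => //.
- exact: (test_comp_integrable _ measurable_fst).
- exact: (test_comp_integrable _ measurable_snd).
- by apply: measurable_funM => //; exact: measurable_dist.
- by move=> z; rewrite mulr_ge0// enorm_ge0.
- by move=> z _; exact: lipschitz_of_partial.
under eq_integral do rewrite EFinM.
rewrite ge0_integralZl_EFin//=; last 2 first.
- by move=> z _; rewrite lee_fin enorm_ge0.
- by apply/measurable_EFinP; exact: measurable_dist.
apply: (@le_trans _ _ ((n%:R * M)%:E * (a + e / (n%:R * M + 1))%:E)%E).
  by apply: lee_wpmul2l; rewrite ?lee_fin.
rewrite -EFinM lee_fin mulrDr lerD2l mulrA ler_pdivrMr ?ltr_wpDl//.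
by rewrite mulrC ler_wpM2l ?(ltW e0)// lerDl.
Qed.

Context (V : P -> PT) (C : R) (pV : is_pvf V) (C0 : 0 <= C)
  (sV : support_sublinear C V).

Lemma grad_dot_integrable r (mu : P) : conc r mu ->
  (V mu).-integrable setT (EFin \o grad_dot f).
Proof.
move=> cr; apply: (@bounded_integrable _ _ _ (V mu) _ (n%:R * M * (C * (1 + r))) (escape C r)) => //.
- exact: measurable_escape.
- exact: escape_null.
- move=> z /not_escape[_ hz]; rewrite (le_trans (grad_dot_le z M0 dfM))//.
  by rewrite ler_wpM2l// mulr_ge0.
Qed.

(** The increment splits into a change of gradient times a velocity, bounded by $C(1+r)$ off
    [escape], and a gradient times a change of velocity. The plan of [WV_coupling] integrates both
    differences, and its slack costs at most [e]. *)
Lemma grad_integral_lip r K (mu nu : P) a : WV_lip V r K -> conc r mu -> conc r nu ->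
  (W mu nu <= a%:E)%E ->
  `|\int[V mu]_z grad_dot f z - \int[V nu]_z grad_dot f z| <=
    n%:R * (n%:R * M * (C * (1 + r)) + M * K) * a.
Proof.
move=> lip cm cn Wa; have r0 := conc_ge0 cm; have K0 := ltW lip.1.
have B0 : 0 <= C * (1 + r) by rewrite mulr_ge0// addr_ge0.
apply/ler_addgt0Pr => e e0.
have nM0 : 0 <= n%:R * M by rewrite mulr_ge0.
have d0 : 0 < e / (n%:R * M + 1) by rewrite divr_gt0// ltr_wpDl.
have [T [[c1 c2] T2 T1]] := WV_coupling pV lip cm cn Wa d0.
have mesc := @measurable_escape R n C r.
have mN1 : measurable (fst @^-1` escape C r : set ('TR[R]_n * 'TR[R]_n)).
  by rewrite -[X in measurable X]setTI; exact: measurable_fst.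
have mN2 : measurable (snd @^-1` escape C r : set ('TR[R]_n * 'TR[R]_n)).
  by rewrite -[X in measurable X]setTI; exact: measurable_snd.
have N1 : T (fst @^-1` escape C r) = 0%E.
  by apply: (etrans (c1 _ mesc)); exact: escape_null.
have N2 : T (snd @^-1` escape C r) = 0%E.
  by apply: (etrans (c2 _ mesc)); exact: escape_null.
have i1 : T.-integrable setT (EFin \o (grad_dot f \o fst)).
  apply: (@bounded_integrable _ _ _ T _ (n%:R * M * (C * (1 + r))) (fst @^-1` escape C r)) => //.
  - exact: measurableT_comp.
  - move=> z /not_escape[_ hz]; rewrite (le_trans (grad_dot_le z.1 M0 dfM))//.
    by rewrite ler_wpM2l.
have i2 : T.-integrable setT (EFin \o (grad_dot f \o snd)).
  apply: (@bounded_integrable _ _ _ T _ (n%:R * M * (C * (1 + r))) (snd @^-1` escape C r)) => //.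
  - exact: measurableT_comp.
  - move=> z /not_escape[_ hz]; rewrite (le_trans (grad_dot_le z.2 M0 dfM))//.
    by rewrite ler_wpM2l.
rewrite (@Rintegral_law _ _ _ T _ _ (V mu) fst (grad_dot f))//.
rewrite (@Rintegral_law _ _ _ T _ _ (V nu) snd (grad_dot f))//.
have md1 : measurable_fun setT (fun z : 'TR[R]_n * 'TR[R]_n => enorm (z.1.1 - z.2.1)).
  apply: measurable_dist.
    exact: (measurableT_comp measurable_fst measurable_fst).
  exact: (measurableT_comp measurable_fst measurable_snd).
have md2 : measurable_fun setT (fun z : 'TR[R]_n * 'TR[R]_n => enorm (z.1.2 - z.2.2)).
  apply: measurable_dist.
    exact: (measurableT_comp measurable_snd measurable_fst).
  exact: (measurableT_comp measurable_snd measurable_snd).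
pose A1 := n%:R * (n%:R * M * (C * (1 + r))); pose A2 := n%:R * M.
have A10 : 0 <= A1 by rewrite !mulr_ge0// addr_ge0.
apply: (@Rintegral_sub_le _ _ _ T _ _
  (fun z => A1 * enorm (z.1.1 - z.2.1) + A2 * enorm (z.1.2 - z.2.2)) _ (fst @^-1` escape C r)) => //.
- by apply: measurable_funD; apply: measurable_funM.
- by move=> z; rewrite addr_ge0// mulr_ge0// enorm_ge0.
- move=> z /not_escape[_ hz].
  rewrite (le_trans (grad_dot_sub_le z.1 z.2 M0 dfM ddf ddfM))// mulrDr lerD//.
    set dxy := enorm (z.1.1 - z.2.1).
    rewrite [leLHS](_ : _ = n%:R * (n%:R * M * enorm z.1.2) * dxy); last by rewrite /dxy; ring.
    by rewrite ler_wpM2r ?enorm_ge0// ler_wpM2l// ler_wpM2l.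
  by rewrite mulrA.
under eq_integral do rewrite EFinD !EFinM.
rewrite ge0_integralD//=; last 4 first.
- by move=> z _; rewrite mule_ge0// lee_fin enorm_ge0.
- by apply/measurable_funeM/measurable_EFinP.
- by move=> z _; rewrite mule_ge0// lee_fin enorm_ge0.
- by apply/measurable_funeM/measurable_EFinP.
rewrite !ge0_integralZl_EFin//=; last 4 first.
- by move=> z _; rewrite lee_fin enorm_ge0.
- exact/measurable_EFinP.
- by move=> z _; rewrite lee_fin enorm_ge0.
- exact/measurable_EFinP.
apply: (@le_trans _ _ (A1%:E * a%:E + A2%:E * (K * a + e / (n%:R * M + 1))%:E)%E).
  by apply: leeD; apply: lee_wpmul2l; rewrite ?lee_fin.
rewrite -!EFinM -EFinD lee_fin.
have h : A2 * (e / (n%:R * M + 1)) <= e.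
  rewrite mulrA ler_pdivrMr ?ltr_wpDl// mulrC ler_wpM2l ?(ltW e0)//.
  by rewrite lerDl.
rewrite mulrDr addrA lerD// le_eqVlt; apply/orP; left; apply/eqP.
by rewrite /A1 /A2; ring.
Qed.

(** [taylor_le] integrated against [V mu]. As $s \le 1/N$, the second-order error and the rounding
    error are both $s$ times a constant over $N$. *)
Lemma push_taylor r N s (mu : P) : (0 < N)%N -> 0 <= s <= N%:R^-1 -> conc r mu ->
  `|\int[push V N s mu]_x f x - (\int[mu]_x f x + s * \int[V mu]_z grad_dot f z)| <=
    s * (n%:R * (n%:R * M * n%:R * (C * (1 + r) + n%:R) ^+ 2 + M * n%:R) / N%:R).
Proof.
move=> N0 /andP[s0 sN] cr; have r0 := conc_ge0 cr; have N0' : 0 < N%:R :> R by rewrite ltr0n.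
set Mv := C * (1 + r) + n%:R.
have Mv0 : 0 <= Mv by rewrite addr_ge0// mulr_ge0// addr_ge0.
have gi := grad_dot_integrable cr.
have mst := measurable_step N s : measurable_fun setT (step N s : 'TR[R]_n -> rV).
have ist := test_comp_integrable (V mu) mst.
have ifst := test_comp_integrable (V mu) (@measurable_fst _ _ rV rV).
rewrite (@Rintegral_law _ _ _ (V mu) _ _ (push V N s mu) (step N s) f)//.
rewrite (@Rintegral_law _ _ _ (V mu) _ _ mu fst f)//; last by move=> A mA; exact: pvf_fst.
have isg : (V mu).-integrable setT (EFin \o (fun z => s * grad_dot f z)).
  rewrite (_ : EFin \o _ = (fun z => (s%:E * (EFin \o grad_dot f) z)%E))//.
  exact: integrableZl.
rewrite -RintegralZl// -RintegralD//.
set b := s * _.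
have b0 : 0 <= b.
  by rewrite /b mulr_ge0// divr_ge0// mulr_ge0// addr_ge0 ?mulr_ge0// exprn_ge0.
apply: (@Rintegral_sub_le _ _ _ (V mu) _ _ (cst b) b (escape C r)) => //.
- exact: measurable_escape.
- exact: escape_null.
- rewrite (_ : EFin \o _ = (fun z => ((EFin \o (f \o fst)) z + s%:E * (EFin \o grad_dot f) z)%E)).
    by apply: integrableD => //; exact: integrableZl.
  by apply/funext => z /=.
- move=> [x v] nz; rewrite /step/=; set w := rnd 1 N v.
  have wM : enorm w <= Mv.
    by rewrite (le_trans (vel_le N0 nz))// lerD2l ratio_le1.
  have wv : enorm (w - v) <= n%:R / N%:R.
    by rewrite enormBC (le_trans (rnd_le 1 v N0))// expn1.
  rewrite (le_trans (taylor_le x v w M0 s0 df dfM ddf ddfM))// ler_wpM2l//.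
  rewrite [leRHS](_ : _ = n%:R * (n%:R * M * n%:R * ((N%:R^-1 * Mv) * Mv) +
    M * (n%:R / N%:R))); last by ring.
  rewrite ler_wpM2l// lerD//; last by rewrite ler_wpM2l.
  rewrite [leLHS](_ : _ = n%:R * M * n%:R * ((s * enorm w) * enorm w)); last by ring.
  have sw : s * enorm w <= N%:R^-1 * Mv by rewrite ler_pM// enorm_ge0.
  rewrite ler_wpM2l ?mulr_ge0// ler_pM// ?enorm_ge0// mulr_ge0// enorm_ge0//.
by apply: (@integral_const_le _ _ _ (V mu) (cst b) b set0).
Qed.

End test_function_integrals.

(** * Differentiability and absolute continuity of real curves *)

Section real_curves.
Context (R : realType).

Lemma is_derive_quadratic (F : R -> R) (t G A d : R) : 0 < d -> 0 <= A ->
  (forall h, `|h| < d -> `|F (t + h) - (F t + h * G)| <= A * h ^+ 2) ->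
  is_derive t 1 F G.
Proof.
move=> d0 A0 hF.
have cv : h^-1 *: ((F \o shift t) (h *: 1) - F t) @[h --> 0^'] --> G.
  apply/cvgrPdist_le => e e0.
  have m0 : 0 < Num.min d (e / (A + 1)) by rewrite lt_min d0 divr_gt0// ltr_wpDl.
  near=> h.
  have hd : `|h| < Num.min d (e / (A + 1)) by near: h; exact: dnbhs0_lt.
  have h0 : h != 0 by near: h; exact: nbhs_dnbhs_neq.
  move: hd; rewrite lt_min => /andP[hd he].
  rewrite /= [h *: 1]mulr1 distrC [h + t]addrC.
  have -> : h^-1 *: (F (t + h) - F t) - G = h^-1 * (F (t + h) - (F t + h * G)).
    by rewrite [_ *: _]/(_ * _) opprD addrA mulrBr mulKf.
  rewrite normrM normfV mulrC ler_pdivrMr ?normr_gt0// (le_trans (hF _ hd))//.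
  rewrite -(real_normK (num_real h)) expr2 mulrA ler_wpM2r// ltW//.
  apply: (@le_lt_trans _ _ ((A + 1) * `|h|)); first by rewrite ler_wpM2r// lerDl.
  by rewrite mulrC -ltr_pdivlMr// ltr_wpDl.
apply: DeriveDef; first by apply/cvg_ex; exists G.
exact: cvg_lim.
Unshelve. all: by end_near. Qed.

(** The Taylor estimate runs forward in time only. For $h < 0$ it is applied from $t + h$ to $t$,
    with the derivative at $t + h$; the second hypothesis exchanges that derivative for the one at
    $t$. *)
Lemma backward_error (a b c d h e1 e2 q : R) :
  `|a - (b + - h * c)| <= e1 * q -> `|(- h) * (d - c)| <= e2 * q ->
  `|b - (a + h * d)| <= (e1 + e2) * q.
Proof.
move=> h1 h2; rewrite -normrN in h1.
rewrite (_ : b - _ = - (a - (b + - h * c)) + (- h) * (d - c)); last by ring.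
by rewrite mulrDl (le_trans (ler_normD _ _))// lerD.
Qed.

Lemma lipschitz_continuous_within (g : R -> R) (a b c : R) : 0 <= c ->
  (forall s t, a <= s <= b -> a <= t <= b -> `|g s - g t| <= c * `|s - t|) ->
  {within `[a, b], continuous g}.
Proof.
move=> c0 gl; apply/subspace_continuousP => x; rewrite /= in_itv/= => xab.
apply/cvgrPdist_le => e e0; have d0 : 0 < e / (c + 1) by rewrite divr_gt0// ltr_wpDl.
apply: filterS (nbhsx_ballx x _ d0) => y; rewrite /ball/= => xy; rewrite in_itv/= => yab.
rewrite (le_trans (gl _ _ xab yab))//.
apply: (@le_trans _ _ ((c + 1) * (e / (c + 1)))).
  by rewrite ler_pM// ?lerDl// ltW.
by rewrite mulrC divfK// gt_eqF// ltr_wpDl.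
Qed.

Lemma lipschitz_absolutely_continuous (g : R -> R) (a b c : R) : 0 <= c ->
  (forall s t, a <= s <= b -> a <= t <= b -> `|g s - g t| <= c * `|s - t|) ->
  absolutely_continuous a b g.
Proof.
move=> c0 gl e e0; have d0 : 0 < e / (c + 1) by rewrite divr_gt0// ltr_wpDl.
exists (e / (c + 1)) => // k u v uv _ sd.
apply: (@le_lt_trans _ _ (c * \sum_(i < k) (v i - u i))).
  rewrite mulr_sumr; apply: ler_sum => i _; have [au [uvi vb]] := uv i.
  rewrite (le_trans (gl _ _ _ _))//.
  - by rewrite vb (le_trans au).
  - by rewrite au (le_trans uvi).
  - by rewrite ger0_norm// subr_ge0.
apply: (@le_lt_trans _ _ (c * (e / (c + 1)))); first by rewrite ler_wpM2l// ltW.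
by rewrite mulrA ltr_pdivrMr ?ltr_wpDl// mulrC ltr_pM2l// ltrDl.
Qed.

End real_curves.

(** * The semigroup solves the equation *)

Section semigroup_solutions.
Context (R : realType) (n : nat).
Local Notation rV := 'rV[R]_n.
Local Notation P := (probability 'rV[R]_n R).
Local Notation PT := (probability 'TR[R]_n R).
Context (V : P -> PT) (C T : R) (pV : is_pvf V) (C_gt0 : 0 < C)
  (sV : support_sublinear C V) (lV : locally_WV_lipschitz V) (T_gt0 : 0 < T)
  (dcv : forall mu : P, finite_dirac_sum mu -> LAS_cvg_unique T V mu).
Let C0 : 0 <= C := ltW C_gt0.
Let T0 : 0 <= T := ltW T_gt0.
Local Notation L := (Lcan V).
Local Notation RM := (Rmax n C T).
Local Notation MV := (Mvel n C T).
Local Notation S := (semigroup V).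

Section with_test_function.
Context (f : rV -> R) (tf : test_function f) (M : R) (M0 : 0 <= M)
  (fM : forall x, `|f x| <= M) (dfM : forall i x, `|partial i f x| <= M)
  (ddfM : forall i j x, `|partial j (partial i f) x| <= M).
Local Notation F mu := (\int[mu]_x f x).
Local Notation G mu := (\int[V mu]_z grad_dot f z).

(** The constants of [push_taylor] and, for [grad_const], of [grad_integral_lip]. *)
Definition push_const r := n%:R * (n%:R * M * n%:R * (C * (1 + r) + n%:R) ^+ 2 + M * n%:R).
Definition grad_const r K := n%:R * (n%:R * M * (C * (1 + r)) + M * K).

Lemma push_const_ge0 r : 0 <= push_const r.
Proof.
rewrite /push_const; have := sqr_ge0 (C * (1 + r) + n%:R).
by move: (_ ^+ 2) => q q0; rewrite mulr_ge0// addr_ge0// ?mulr_ge0.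
Qed.

Lemma grad_const_ge0 r K : 0 <= r -> 0 <= K -> 0 <= grad_const r K.
Proof. by move=> r0 K0; rewrite mulr_ge0// addr_ge0 ?mulr_ge0// addr_ge0. Qed.

(** Each step adds its own Taylor error and the error of freezing $G$ at [nu]. For the latter, all
    nodes up to time [h] are within $n/N$ (initial rounding) plus [MV r * h] (motion) of [nu]. The
    base value is that of the rounded datum. *)
Lemma Lcan_taylor r K N (nu : P) h : (0 < N)%N -> 0 <= r -> WV_lip V (RM r) K ->
  conc r nu -> 0 <= h -> h <= T ->
  `|F (L N nu h) - (F (Ldisc V N nu 0) + h * G nu)| <=
    h * (push_const (RM r) / N%:R + grad_const (RM r) K * (n%:R / N%:R + MV r * h)).
Proof.
move=> N0 r0 lip cr h0 hT; have N0' : 0 < N%:R :> R by rewrite ltr0n.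
have K0 := ltW lip.1; have R0 : 0 <= RM r by rewrite (le_trans r0)//; exact: Rmax_ge.
have cr' : conc (RM r) nu by apply: conc_le cr; exact: Rmax_ge.
have MV0 : 0 <= MV r by exact: Mvel_ge0.
set A := push_const _; set B := grad_const _ _; set D := A / N%:R + _.
have A0 : 0 <= A by exact: push_const_ge0.
have B0 : 0 <= B by exact: grad_const_ge0.
have step l s : l%:R / N%:R <= h -> 0 <= s <= N%:R^-1 ->
    `|F (Ldisc V N nu l) - (F (Ldisc V N nu 0) + l%:R / N%:R * G nu)| <= l%:R / N%:R * D ->
    `|F (push V N s (Ldisc V N nu l)) -
      (F (Ldisc V N nu 0) + (l%:R / N%:R + s) * G nu)| <= (l%:R / N%:R + s) * D.
  move=> lh sN ih; have lT := le_trans lh hT; have /andP[s0 _] := sN.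
  have cl := Ldisc_Rmax pV C0 sV N0 r0 cr lT.
  have h1 := push_taylor tf M0 fM dfM ddfM pV C0 sV N0 sN cl.
  have l0 : 0 <= l%:R / N%:R :> R by rewrite divr_ge0.
  have Wl : (W (Ldisc V N nu l) nu <= (n%:R / N%:R + MV r * h)%:E)%E.
    rewrite W_sym; have cd0 := Ldisc_Rmax pV C0 sV N0 r0 cr (_ : 0%:R / N%:R <= T).
    rewrite mul0r in cd0; rewrite (le_trans (W_triangle _ _ (cd0 T0)))// EFinD leeD//.
      by rewrite (le_trans (W_rnd_le 2 _ N0))// lee_fin ratio_sqr.
    have E0 : L N nu 0 ≡μ Ldisc V N nu 0.
      by have := Lcan_disc pV nu 0 N0; rewrite mul0r.
    rewrite -(W_eqm E0 (fun _ _ => erefl)).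
    rewrite (le_trans (Lcan_disc_time pV C0 sV N0 r0 cr (lexx 0) l0 lT))// lee_fin subr0.
    by rewrite mulrC ler_wpM2l.
  have h2 := grad_integral_lip tf M0 dfM ddfM pV C0 sV lip cl cr' Wl.
  rewrite -/(grad_const (RM r) K) -/B in h2.
  have h3 : `|s * G (Ldisc V N nu l) - s * G nu| <= s * (B * (n%:R / N%:R + MV r * h)).
    by rewrite -mulrBr normrM ger0_norm// ler_wpM2l.
  move: h1 ih h3; rewrite -/(push_const (RM r)) -/A /D.
  set x1 := F (push _ _ _ _); set x2 := F (Ldisc _ _ _ l); set x3 := F (Ldisc _ _ _ 0).
  set g1 := G (Ldisc _ _ _ l); set g2 := G nu; set q := l%:R / N%:R.
  move=> h1 h4 h3.
  rewrite (_ : _ - _ = (x1 - (x2 + s * g1)) + ((x2 - (x3 + q * g2)) + (s * g1 - s * g2))); last by ring.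
  rewrite (le_trans (ler_normD _ _))// (le_trans (lerD h1 (le_trans (ler_normD _ _) (lerD h4 h3))))//.
  by rewrite le_eqVlt; apply/orP; left; apply/eqP; ring.
have disc l : l%:R / N%:R <= h ->
    `|F (Ldisc V N nu l) - (F (Ldisc V N nu 0) + l%:R / N%:R * G nu)| <= l%:R / N%:R * D.
  elim: l => [_|l ih lh]; first by rewrite !mul0r addr0 subrr normr0.
  have lE : l.+1%:R / N%:R = l%:R / N%:R + N%:R^-1 :> R by rewrite -natr1 mulrDl mul1r.
  have lh' : l%:R / N%:R <= h by rewrite (le_trans _ lh)// lE lerDl invr_ge0.
  by rewrite lE; apply: step => //; [rewrite invr_ge0 ler0n lexx|exact: ih].
have [l [s [hE sN lh]]] := time_decomp N0 h0.
have -> : F (L N nu h) = F (push V N s (Ldisc V N nu l)).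
  by rewrite hE; apply: eqm_Rintegral; exact: Lcan_push.
by rewrite {1 2}hE; apply: step => //; exact: disc.
Qed.

(** As $N$ grows, the terms in $1/N$ vanish and only the motion term, quadratic in [h], survives.
    The three parts $e/3$ are the distance to the limit, the rounding of the datum and the terms in
    $1/N$. *)
Lemma semigroup_taylor r K (nu : P) h : 0 <= r -> WV_lip V (RM r) K ->
  conc r nu -> 0 <= h -> h <= T ->
  `|F (S h nu) - (F nu + h * G nu)| <= grad_const (RM r) K * MV r * h ^+ 2.
Proof.
move=> r0 lip cr h0 hT; have K0 := ltW lip.1.
have R0 : 0 <= RM r by rewrite (le_trans r0)//; exact: Rmax_ge.
apply/ler_addgt0Pr => e e0; have e3 : 0 < e / 3 by rewrite divr_gt0.
have nM0 : 0 <= n%:R * M by rewrite mulr_ge0.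
have d0 : 0 < e / 3 / (n%:R * M + 1) by rewrite divr_gt0// ltr_wpDl.
have nMd : n%:R * M * (e / 3 / (n%:R * M + 1)) <= e / 3.
  rewrite mulrA ler_pdivrMr ?ltr_wpDl// mulrC ler_wpM2l ?(ltW e3)//.
  by rewrite lerDl.
set B := grad_const _ _; set A := push_const (RM r).
have [N [N0 [h1 [h2 h3]]]] := filter_ex (filterI near_pos (filterI
  (semigroup_cvg_pt pV C_gt0 sV lV T_gt0 dcv r0 cr h0 hT d0) (filterI (near_ratio_le n%:R d0)
  (near_ratio_le (h * (A + B * n%:R)) e3)))).
have k1 := test_integral_lip tf M0 fM dfM h1.
have W0 : (W (Ldisc V N nu 0) nu <= (e / 3 / (n%:R * M + 1))%:E)%E.
  by rewrite W_sym (le_trans (W_rnd_le 2 _ N0))// lee_fin (le_trans _ h2)// ratio_sqr.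
have k2 := test_integral_lip tf M0 fM dfM W0.
have k3 := Lcan_taylor N0 r0 lip cr h0 hT.
move: k1 k2 k3; rewrite -/A -/B.
set x1 := F (S h nu); set x2 := F (L N nu h); set x3 := F (Ldisc _ _ _ 0).
set x4 := F nu; set g := G nu => k1 k2 k3.
have {}k1 := le_trans k1 nMd; have {}k2 := le_trans k2 nMd; rewrite distrC in k1.
rewrite (_ : _ - _ = (x1 - x2) + ((x2 - (x3 + h * g)) + (x3 - x4))); last by ring.
rewrite (le_trans (ler_normD _ _))// (le_trans (lerD k1 (le_trans (ler_normD _ _) (lerD k3 k2))))//.
rewrite (_ : h * _ = h * (A + B * n%:R) / N%:R + B * MV r * h ^+ 2); last by ring.
by move: h3; lra.
Qed.

End with_test_function.

Lemma semigroup_solution (mu : P) : compact_supp mu -> solution T V (fun t => S t mu).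
Proof.
move=> /compact_conc[r /ltW r0 cr] f tf.
have [M [M0 fM dfM ddfM]] := test_function_bounds tf.
pose r1 := RM r; have r10 : 0 <= r1 by rewrite (le_trans r0)//; exact: Rmax_ge.
have cS t : 0 <= t <= T -> conc r1 (S t mu).
  by case/andP => t0 tT; exact: (semigroup_Rmax pV C_gt0 sV lV T_gt0 dcv).
(* [K] serves lattice solutions restarted from points of the trajectory, which may reach radius
   [RM r1]; [K1] below serves the trajectory itself, which stays within [r1]. *)
have [K lip] := WV_lip_ex (RM r1) lV; have K0 := ltW lip.1.
have [K1 lip1] := WV_lip_ex r1 lV; have K10 := ltW lip1.1.
have R10 : 0 <= RM r1 by rewrite (le_trans r10)//; exact: Rmax_ge.
have MV0 : 0 <= MV r by exact: Mvel_ge0.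
have MV1 : 0 <= MV r1 by exact: Mvel_ge0.
pose F t := \int[S t mu]_x f x; pose G t := \int[V (S t mu)]_z grad_dot f z.
pose cF := n%:R * M * MV r; pose cG := grad_const M r1 K1 * MV r.
have cF0 : 0 <= cF by rewrite !mulr_ge0.
have cG0 : 0 <= cG by rewrite mulr_ge0// grad_const_ge0.
have WS s t : 0 <= s <= T -> 0 <= t <= T -> (W (S s mu) (S t mu) <= (MV r * `|s - t|)%:E)%E.
  move=> /andP[s0 sT] /andP[t0 tT].
  exact: (semigroup_time pV C_gt0 sV lV T_gt0 dcv r0 cr s0 sT t0 tT).
have Flip s t : 0 <= s <= T -> 0 <= t <= T -> `|F s - F t| <= cF * `|s - t|.
  by move=> sT tT; rewrite /cF -mulrA; apply: test_integral_lip => //; exact: WS.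
have Glip s t : 0 <= s <= T -> 0 <= t <= T -> `|G s - G t| <= cG * `|s - t|.
  move=> sT tT; rewrite /cG -mulrA.
  by apply: (grad_integral_lip tf M0 dfM ddfM pV C0 sV lip1 (cS _ sT) (cS _ tT)); exact: WS.
have gI s : 0 <= s <= T -> (V (S s mu)).-integrable setT (EFin \o grad_dot f).
  by move=> sT; exact: (grad_dot_integrable tf M0 dfM pV C0 sV (cS _ sT)).
split.
- by apply: aeW => s; rewrite in_itv/= => /gI.
- have iG : lebesgue_measure.-integrable `[0, T] (EFin \o G).
    apply: continuous_compact_integrable; first exact: segment_compact.
    exact: lipschitz_continuous_within cG0 Glip.
  apply: eq_integrable iG => // s; rewrite inE/= in_itv/= => sT.
  by rewrite /G /Rintegral fineK//; apply: integrable_fin_num => //; exact: gI.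
- exact: lipschitz_absolutely_continuous cF0 Flip.
(* The derivative is two-sided and the curve is controlled on $[0, T]$ only, so the endpoints form
   the exceptional null set. *)
exists ([set 0] `|` [set T]); split.
- exact: measurableU.
- apply/eqP; rewrite eq_le measure_ge0 andbT (le_trans (measureU2 _ _ _))//.
  rewrite [X in (X + _)%E](_ : _ = 0%E); last exact: lebesgue_measure_set1.
  by rewrite [X in (_ + X)%E](_ : _ = 0%E) ?adde0//; exact: lebesgue_measure_set1.
move=> t nt; apply: contrapT => tn0; apply: nt => /=; rewrite in_itv/= => tT.
have [t0 tT'] : 0 < t /\ t < T.
  move: tn0 => /not_orP[/eqP t0 /eqP tT']; case/andP : tT => t0' tT.
  by rewrite !lt_neqAle eq_sym t0 t0' tT' tT.
pose A := grad_const M (RM r1) K * MV r1.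
have A0 : 0 <= A by rewrite mulr_ge0// grad_const_ge0.
have add s h : 0 <= s -> 0 <= h -> s + h <= T -> `|F (s + h) - (F s + h * G s)| <= A * h ^+ 2.
  move=> s0 h0 shT; have sT : s <= T by rewrite (le_trans _ shT)// lerDl.
  have hT : h <= T by rewrite (le_trans _ shT)// lerDr.
  have hsT : h + s <= T by rewrite [h + s]addrC.
  have hs := semigroup_add pV C_gt0 sV lV T_gt0 dcv r0 cr h0 s0 hsT.
  rewrite [s + h]addrC [F (h + s)](_ : _ = \int[S h (S s mu)]_x f x); last first.
    exact: esym (eqm_Rintegral f hs).
  have cs : conc r1 (S s mu) by apply: cS; rewrite s0.
  exact: (semigroup_taylor tf M0 fM dfM ddfM r10 lip cs h0 hT).
apply: (@is_derive_quadratic _ F t (G t) (A + cG) (Num.min t (T - t))).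
- by rewrite lt_min t0 subr_gt0.
- by rewrite addr_ge0.
move=> h; rewrite lt_min => /andP[ht hT]; have [h0|h0] := leP 0 h.
  rewrite ger0_norm// in hT; rewrite (le_trans (add t h (ltW t0) h0 _))//.
    by rewrite -lerBrDl ltW.
  by rewrite ler_wpM2r ?sqr_ge0// lerDl.
rewrite ltr0_norm// in ht.
have th0 : 0 <= t + h by move: ht; lra.
have thT : t + h <= T by move: h0 tT'; lra.
have := add (t + h) (- h) th0; rewrite addrK oppr_ge0 (ltW h0) ltW// sqrrN => /(_ isT isT) k1.
have k2 : `|(- h) * (G t - G (t + h))| <= cG * h ^+ 2.
  rewrite normrM normrN (le_trans (ler_wpM2l (normr_ge0 h) (Glip t (t + h) _ _)))//.
    by rewrite th0.
  by rewrite opprD addrA subrr sub0r normrN mulrCA -expr2 real_normK ?num_real.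
exact: backward_error k1 k2.
Qed.

End semigroup_solutions.

(** * Existence and uniqueness of the Lipschitz semigroup *)

Theorem theorem5p2 (R : realType) (n : nat)
    (V : probability 'rV[R]_n R -> probability ('rV[R]_n * 'rV[R]_n)%type R)
    (C T : R) :
  is_pvf V ->
  0 < C -> support_sublinear C V ->
  locally_WV_lipschitz V ->
  0 < T ->
  (forall mu : probability 'rV[R]_n R,
     finite_dirac_sum mu -> LAS_cvg_unique T V mu) ->
  exists2 S : R -> probability 'rV[R]_n R -> probability 'rV[R]_n R,
    lipschitz_semigroup T V C S /\ trajectories_LAS_limits T V S &
    forall S' : R -> probability 'rV[R]_n R -> probability 'rV[R]_n R,
      lipschitz_semigroup T V C S' -> trajectories_LAS_limits T V S' ->
      forall (t : R) (mu : probability 'rV[R]_n R), t \in `[0, T] ->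
      compact_supp mu -> S' t mu ≡μ S t mu.
Proof.
move=> pV C0 sV lV T0 dcv; exists (semigroup V); last first.
  move=> S' _ trS' t mu; rewrite in_itv/= => /andP[t0 tT] cmu.
  exact: (LAS_limit_unique pV C0 sV lV T0 dcv trS' cmu t0 tT).
split; last exact: semigroup_LAS_limits pV C0 sV lV T0 dcv.
split.
- move=> t mu; rewrite in_itv/= => /andP[t0 tT] /compact_conc[r /ltW r0 cr].
  exact: conc_compact (semigroup_Rmax pV C0 sV lV T0 dcv r0 cr t0 tT).
- by move=> mu /compact_conc[r /ltW r0 cr]; exact: (semigroup0 pV C0 sV lV T0 dcv r0 cr).
- move=> t s mu; rewrite !in_itv/= => /andP[t0 _] /andP[s0 _] tsT /compact_conc[r /ltW r0 cr].
  exact: (semigroup_add pV C0 sV lV T0 dcv r0 cr t0 s0 tsT).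
- by move=> mu cmu; exact: (semigroup_solution pV C0 sV lV T0 dcv cmu).
move=> r r_gt0; have r0 := ltW r_gt0; have [K lip] := WV_lip_ex (Rmax n C T r) lV.
have K0 := lip.1; have M0 : 0 <= Mvel n C T r by apply: Mvel_ge0 => //; exact: ltW.
(* A single constant has to dominate both the exponential rate [K] and the speed [Mvel]. *)
exists (K + Mvel n C T r); first by rewrite ltr_wpDr.
move=> mu nu t s _ _ /Supp_eball_conc cm /Supp_eball_conc cn.
rewrite !in_itv/= => /andP[t0 tT] /andP[s0 sT]; split.
- apply: conc_Supp_eball (semigroup_conc pV C0 sV lV T0 dcv r0 cm t0 tT).
  by rewrite [r + 1]addrC ltrBlDr ltrDl.
- rewrite (le_trans (semigroup_lip pV C0 sV lV T0 dcv r0 lip cm cn t0 tT))//.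
  apply: lee_wpmul2r; first exact: W_ge0.
  by rewrite lee_fin ler_expR ler_wpM2r// lerDl.
- rewrite (le_trans (semigroup_time pV C0 sV lV T0 dcv r0 cm t0 tT s0 sT))//.
  by rewrite lee_fin ler_wpM2r// lerDr ltW.
Qed.
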